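(* In the particular case $\alpha=\mu=0$, the entire solution of the rotating segregated system in $\mathbb{R}^2$ (which exists, when $K\ge3$ and $a_{ij}>0$, for almost every $(\mu,\omega)$) is related to the nodal components of a smooth rotating solution of the pure heat equation. Precisely, let $\omega>0$, let $k\ge1$ be an integer and let $I_k$ denote the modified Bessel function of the first kind, with parameter $k$. Then the function $$U(re^{i\vartheta},t)=\mathrm{Re}\left[e^{ik(\vartheta+\omega t)}I_k\left(\frac{\sqrt{2\omega k}}{2}(1+i)r\right)\right]$$ is an entire, eternal rotating solution of the heat equation $$U_t-\Delta U=0\qquad\text{in }\mathbb{R}^2\times\mathbb{R}$$ having $2k$ nodal regions, which coincide up to rotations multiple of $\pi/k$. The equi-distributed nodal lines admit a straight tangent as $r\to0$, while they behave like arithmetic spirals of equation $\vartheta=\sqrt{\frac{\omega}{2k}}\,r$ as $r\to+\infty$. Moreover, as $\omega\to0$, a suitable renormalization of $U$ converges to the entire harmonic function $\mathrm{Re}\,z^k$.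
   Context: $\mathbb{R}^2$ is identified with $\mathbb{C}$, with polar coordinates $z=re^{i\vartheta}$. The nodal regions of $U$ are the connected components, at each fixed time $t$, of $\{U(\cdot,t)\neq0\}$, and the nodal lines separate them. A rotating solution is one of the form $U(\mathbf{x},t)=U_0(\mathcal{R}_{\omega t}\mathbf{x})$, with $\mathcal{R}_\theta$ the rotation matrix of angle $\theta$. The rotating segregated system in $\mathbb{R}^2$ with parameters $(\mu,\omega)$ is, for non-negative $(u_1,\dots,u_K)$ and every $i$, $$-\Delta u_i+\omega\,\mathbf{x}^\perp\cdot\nabla u_i\le\mu u_i,\qquad -\Delta\widehat u_i+\omega\,\mathbf{x}^\perp\cdot\nabla\widehat u_i\ge\mu\widehat u_i\quad\text{in }\mathbb{R}^2,\qquad u_i\cdot u_j=0\ \text{ for } i\ne j$$ (inequalities in the variational sense), where $\mathbf{x}^\perp=\mathcal{R}_{\pi/2}\mathbf{x}$ and $\widehat u_i=u_i-\sum_{j\neq i}\frac{a_{ij}}{a_{ji}}u_j$; moreover $$\alpha=\frac{1}{2\pi}\ln\left(\frac{a_{12}}{a_{21}}\cdot\frac{a_{23}}{a_{32}}\cdots\frac{a_{K1}}{a_{1K}}\right).$$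
   Formalization: For U as displayed the nodal lines turn the other way: the formal statement proves that they behave as r→+∞ like arithmetic spirals ϑ = −√(ω/(2k)) r + const, instead of the printed ϑ = √(ω/(2k)) r, whose sign is wrong for this U. *)

(* Defs.v *)
(* The reals are an abstract R : realType, the plane is R * R and is identified
   with R[i] through x.1 +i* x.2. *)
From HB Require Import structures.
From mathcomp Require Import all_boot all_order all_algebra.
From mathcomp Require Import all_classical all_reals all_analysis.
From mathcomp Require Export complex.

Set Implicit Arguments.
Unset Strict Implicit.
Unset Printing Implicit Defensive.

Import Order.TTheory GRing.Theory Num.Theory.
Import numFieldNormedType.Exports.

Local Open Scope classical_set_scope.
Local Open Scope ring_scope.

Section Plane.
Context {R : realType}.
Implicit Types (x : R * R) (r th : R).

Definition polar r th : R * R := (r * cos th, r * sin th).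

Definition modulus x : R := Num.sqrt (x.1 ^+ 2 + x.2 ^+ 2).

(* Some polar angle of x, defined up to 2 pi (arbitrary if x = 0). *)
Definition angle x : R := get [set th | polar (modulus x) th = x].

Definition rotation th x : R * R :=
  (cos th * x.1 - sin th * x.2, sin th * x.1 + cos th * x.2).

Definition perp x : R * R := rotation (pi / 2) x.

Definition expi th : R[i] := (cos th +i* sin th)%C.

Definition zpow (k : nat) x : R := complex.Re ((x.1 +i* x.2)%C ^+ k).

End Plane.

Section Bessel.
Context {R : realType}.

(* Modified Bessel function of the first kind, of integer order. The ascription
   to numFieldType gives R[i] the topology of its modulus. *)
Definition besselI (k : nat) (z : R[i]) : R[i] :=
  limn (series (fun m : nat =>
    (z / 2%:R) ^+ (2 * m + k) / (m`! * (m + k)`!)%:R : (R[i] : numFieldType))).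

(* Re [e^{ik(th + omega t)} I_k (sqrt (2 omega k) / 2 (1 + i) r)] at
   x = r e^{i th}. The choice of angle does not matter: k is an integer, and
   I_k 0 = 0 for k >= 1. *)
Definition rotU (omega : R) (k : nat) (x : R * R) (t : R) : R :=
  complex.Re (expi (k%:R * (angle x + omega * t)) *
    besselI k
      ((Num.sqrt (2%:R * omega * k%:R) / 2%:R)%:C * (1 +i* 1) *
       (modulus x)%:C))%C.

End Bessel.

Section Calculus.
Context {R : realType}.

(* C^oo: all iterated directional derivatives exist and are differentiable. *)
Definition smooth (V : normedModType R) (f : V -> R) : Prop :=
  forall (s : seq V) (x : V),
    differentiable (foldr (fun v g => fun y => 'D_v g y) f s) x.

Definition e1 : R * R := (1, 0).
Definition e2 : R * R := (0, 1).

Definition laplacian (f : R * R -> R) (x : R * R) : R :=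
  'D_e1 (fun y => 'D_e1 f y) x + 'D_e2 (fun y => 'D_e2 f y) x.

Definition harmonic_function (f : R * R -> R) : Prop :=
  smooth f /\ forall x, laplacian f x = 0.

Definition smooth_heat_solution (U : R * R -> R -> R) : Prop :=
  smooth (fun p : R * R * R => U p.1 p.2) /\
  forall x t, derive1 (U x) t - laplacian (U ^~ t) x = 0.

Definition rotating (omega : R) (U : R * R -> R -> R) : Prop :=
  exists U0 : R * R -> R, forall x t, U x t = U0 (rotation (omega * t) x).

Definition nonzero_set (U : R * R -> R -> R) (t : R) : set (R * R) :=
  [set x | U x t != 0].

Definition nodal_regions (U : R * R -> R -> R) (t : R) : set (set (R * R)) :=
  connected_component (nonzero_set U t) @` nonzero_set U t.

End Calculus.

Section Variational.
Context {R : realType}.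

Definition leb2 := (@lebesgue_measure R \x @lebesgue_measure R)%E.

Definition test_function (phi : R * R -> R) : Prop :=
  smooth phi /\ compact (closure [set x | phi x != 0]).

Definition L2loc (f : R * R -> R) : Prop :=
  measurable_fun [set: R * R] f /\
  forall C : set (R * R), compact C ->
    leb2.-integrable C (fun x => (f x ^+ 2)%:E).

Definition weak_derivative (v : R * R) (f g : R * R -> R) : Prop :=
  forall phi, test_function phi ->
    \int[leb2]_x (f x * 'D_v phi x) = - \int[leb2]_x (g x * phi x).

(* u is in H^1_loc, with weak gradient (g.1, g.2). *)
Definition weak_gradient (u : R * R -> R) (g : R * R -> R * R) : Prop :=
  [/\ L2loc u, L2loc (fun x => (g x).1), L2loc (fun x => (g x).2),
      weak_derivative e1 u (fun x => (g x).1) &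
      weak_derivative e2 u (fun x => (g x).2)].

(* The weak form of  - Laplacian u + omega x^perp . grad u - mu u,
   with g the gradient of u, tested against phi. *)
Definition rot_form (mu omega : R) (u : R * R -> R) (g : R * R -> R * R)
    (phi : R * R -> R) : R :=
  \int[leb2]_x
    ((g x).1 * 'D_e1 phi x + (g x).2 * 'D_e2 phi x
     + omega * ((perp x).1 * (g x).1 + (perp x).2 * (g x).2) * phi x
     - mu * u x * phi x).

Definition rot_subsolution (mu omega : R) (u : R * R -> R) : Prop :=
  exists2 g, weak_gradient u g &
    forall phi, test_function phi -> (forall x, 0 <= phi x) ->
      rot_form mu omega u g phi <= 0.

Definition rot_supersolution (mu omega : R) (u : R * R -> R) : Prop :=
  exists2 g, weak_gradient u g &
    forall phi, test_function phi -> (forall x, 0 <= phi x) ->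
      0 <= rot_form mu omega u g phi.

Definition hat (K : nat) (a : 'I_K -> 'I_K -> R) (u : 'I_K -> R * R -> R)
    (i : 'I_K) (x : R * R) : R :=
  u i x - \sum_(j < K | j != i) a i j / a j i * u j x.

Definition segregated_system (mu omega : R) (K : nat) (a : 'I_K -> 'I_K -> R)
    (u : 'I_K -> R * R -> R) : Prop :=
  [/\ forall i x, 0 <= u i x,
      forall i, rot_subsolution mu omega (u i),
      forall i, rot_supersolution mu omega (hat a u i) &
      forall i j, i != j -> forall x, u i x * u j x = 0].

(* ordS is the cyclic successor on 'I_K. *)
Definition alpha (K : nat) (a : 'I_K -> 'I_K -> R) : R :=
  (2%:R * pi)^-1 * ln (\prod_(i < K) (a i (ordS i) / a (ordS i) i)).

End Variational.

(* Main.v *)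
Require Import Defs.
From HB Require Import structures.
From mathcomp Require Import all_boot all_order all_algebra.
From mathcomp Require Import all_classical all_reals all_analysis.
From mathcomp Require Import measurable_realfun ring lra zify.

Set Implicit Arguments.
Unset Strict Implicit.
Unset Printing Implicit Defensive.

Import Order.TTheory GRing.Theory Num.Theory.
Import numFieldNormedType.Exports.

Local Open Scope classical_set_scope.
Local Open Scope ring_scope.

(* Write I_k(z) = (z/2)^k H_k((z/2)^2). With a = omega k / 4 the function U is, up to a
   constant, Re (e^{i tau} z^k h(a |z|^2)), where h(u) = H_k(i u) is entire and tau is
   affine in t; hence U is smooth across the origin, and Bessel's equation is the heat
   equation. Multiplying that equation by the conjugate of h shows that |h|^2 increases,
   so h = |h| e^{i b} with a smooth phase b and
     U(r e^{i th}, t) = rho(r) cos(k (th + g(r))),   k g = k (omega t + pi/4) + b(a r^2).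
   The untwisting th -> th + g(r) straightens the nodal regions into 2k equal sectors.
   The logarithmic derivative of sqrt(r) r^k h(r^2) solves a Riccati equation with a stable
   equilibrium, which it approaches up to an error O(1/r^2): the phase is linear up to a
   convergent remainder, whence the arithmetic spirals.
   When alpha = 0 there are c_i > 0 with c_{i+1} a_{i,i+1} = c_i a_{i+1,i} cyclically, and
   the components are c_i |U| on the i-th sector. Each is a subsolution (Kato). The
   combination hat u_i is +- c_i U on sector i and its two neighbours, where it solves the
   equation, and is negative away from sector i, where it is a negated subsolution; an
   angular cutoff glues these, the origin having zero capacity. *)

(** * Bessel functions on the ray of argument pi / 4 *)

(** Complex values are traded for a real family with two indices, in which differentiation and
    multiplication by i are both index shifts and Bessel's equation is a three-term relation;
    identities between derivatives are then left to [ring] and [field]. For the segregated system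
    the obstacle is that the components have kinks along the nodal lines. Instead of integrating by
    parts sector by sector, with boundary terms, one works on the whole plane with D cut_n(U): D is
    locally constant off {U = 0} and cut_n vanishes near 0, so that D jumps only where the product
    is 0. As n grows, s cut_n'(s) stays bounded and tends to 0, which settles the weak gradient of D
    U; the second-order term keeps cut_n'(U) |grad U|^2, of which only the sign is retained, and
    this sign is Kato's inequality. At the origin an angular cutoff has a gradient of size 1/r. Here
    K = 2k >= 3 gives k >= 2, so that r U_r = O(r^2), and a radial cutoff at the single scale
    n^(-1/2) removes the origin at no cost in the limit. *)

Section KelvinSeries.
Context {R : realType}.
Implicit Types (u : R) (j p m : nat).

(* [cosq n = Re (i ^ n)]. *)
Definition cosq (n : nat) : R := (~~ odd n)%:R * (-1) ^+ n./2.
Arguments cosq : simpl never.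

Lemma cosq0 : cosq 0 = 1.
Proof. by rewrite /cosq /= expr0 mulr1. Qed.

Lemma cosq1 : cosq 1 = 0.
Proof. by rewrite /cosq mul0r. Qed.

Lemma cosqSS n : cosq n.+2 = - cosq n.
Proof. by rewrite /cosq /= negbK exprS mulN1r mulrN. Qed.

Lemma cosq_le1 n : `|cosq n| <= 1.
Proof.
by rewrite /cosq normrM normrX normrN1 expr1n mulr1; case: (odd n) => /=;
  rewrite ?normr0 ?normr1.
Qed.

Definition kcoef j p (m : nat) : R := cosq (m + p) / (m`! * (m + j)`!)%:R.

(* [kel j p u = Re (i ^ p H_j (i u))], where [H_j z] is the sum of the
   [z ^ m / (m! (m + j)!)], so that [I_k z = (z / 2) ^ k H_k ((z / 2) ^ 2)]. *)
Definition kel j p u : R := limn (pseries (kcoef j p) u).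

Lemma cvg_kel j p u : cvgn (pseries (kcoef j p) u).
Proof.
apply: normed_cvg.
apply: (series_le_cvg _ _ _ (is_cvg_series_exp_coeff `|u|)) => n /=.
- by [].
- by rewrite divr_ge0 ?exprn_ge0.
rewrite exp_coeffE /= /kcoef normrM normrX -[cosq _ / _]/(cosq _ * _) normrM normfV.
rewrite (normr_nat _) natrM.
have f1 i : 1 <= i`!%:R :> R by rewrite ler1n fact_gt0.
have f0 i : 0 < i`!%:R :> R by rewrite ltr0n fact_gt0.
rewrite ler_wpM2r ?exprn_ge0 // invfM mulrCA -[leRHS]mulr1.
apply: ler_wpM2l; first by rewrite invr_ge0 ltW.
rewrite -[leRHS]mulr1; apply: ler_pM => //; first exact: cosq_le1.
by rewrite invf_le1.
Qed.

(** Termwise form of H_j' = H_{j+1}. Differentiating H_j (i u) in u also brings out a factor i, so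
    both indices advance together. *)
Lemma kcoef_diffs j p : pseries_diffs (kcoef j p) = kcoef j.+1 p.+1.
Proof.
apply/funext => m; rewrite /pseries_diffs /kcoef addSnnS addSnnS factS.
rewrite !natrM !invfM.
by field; rewrite nat1r !pnatr_eq0 -!lt0n !fact_gt0.
Qed.

Lemma is_derive_kel j p u : is_derive u 1 (kel j p) (kel j.+1 p.+1 u).
Proof.
rewrite /kel -kcoef_diffs.
apply: (@pseries_snd_diffs _ _ (`|u| + 1)); rewrite ?kcoef_diffs; try exact: cvg_kel.
by rewrite [ltRHS]ger0_norm ?ltrDl ?addr_ge0.
Qed.

Lemma kelSS j p u : kel j p.+2 u = - kel j p u.
Proof.
rewrite /kel -lim_seriesN; last exact: cvg_kel.
congr (limn (series _)); apply/funext => m /=.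
by rewrite /kcoef !addnS cosqSS !mulNr.
Qed.

(** Write 1 / (m! (m + j)!) as (m + j + 1) / (m! (m + j + 1)!); the part with the factor m is a
    derivative. Derivatives being index shifts, this is Bessel's equation z H'' + (j + 1) H' = H, in
    the form used below. *)
Lemma kel_rec j p u : kel j p u = j.+1%:R * kel j.+1 p u + u * kel j.+2 p.+1 u.
Proof.
apply/cvg_lim => //.
have cf := @cvg_kel j.+1 p u.
have := @pseries_diffs_equiv _ (kcoef j.+1 p) u.
rewrite kcoef_diffs => /(_ (@cvg_kel _ _ _)) /= cd.
suff -> : pseries (kcoef j p) u = (fun n => j.+1%:R * pseries (kcoef j.+1 p) u n +
    u * series (fun i : nat => i%:R * kcoef j.+1 p i * u ^+ i.-1) n).
  by apply: cvgD; exact: cvgMl_tmp.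
apply/funext => n; rewrite /pseries /series /= !mulr_sumr -big_split /=.
apply: eq_bigr => i _.
have -> : u * (i%:R * kcoef j.+1 p i * u ^+ i.-1) = i%:R * kcoef j.+1 p i * u ^+ i.
  by case: i => [|i]; rewrite ?mul0r ?mulr0 //= exprS; ring.
rewrite /kcoef addnS factS !natrM.
have h m : m`!%:R != 0 :> R by rewrite pnatr_eq0 -lt0n fact_gt0.
have h2 : (i + j).+1%:R != 0 :> R by rewrite pnatr_eq0.
rewrite -addn1 natrD natrD in h2 *.
by rewrite -addn1 natrD; field; rewrite h2 !h.
Qed.

Lemma kel0 j p : kel j p 0 = cosq p / j`!%:R.
Proof.
rewrite /kel; apply/cvg_lim => //.
rewrite -cvg_shiftS; apply: cvg_near_cst; near=> n.
rewrite /pseries /series /= big_nat_recl // big1 ?addr0.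
  by rewrite expr0 mulr1 /kcoef add0n mul1n.
by move=> i _; rewrite exprS mul0r mulr0.
Unshelve. all: by end_near. Qed.

(* The parity of [kel] in [u] : conjugation symmetry of [H_j (i u)]. *)
Lemma kelN j p u : kel j p (- u) = (-1) ^+ odd p * kel j p u.
Proof.
apply/cvg_lim => //.
suff -> : pseries (kcoef j p) (- u) =
    (fun n => (-1) ^+ odd p * pseries (kcoef j p) u n).
  by apply: cvgMl_tmp; exact: cvg_kel.
apply/funext => n; rewrite /pseries /series /= mulr_sumr; apply: eq_bigr => m _.
rewrite /kcoef /cosq oddD (exprNn u) -[in LHS](signr_odd _ m).
by case: (odd m); case: (odd p); rewrite /= ?expr0 ?expr1; ring.
Qed.

End KelvinSeries.

Section OneVariable.
Context {R : realType}.
Implicit Types (f g : R -> R) (x a b c : R).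

Lemma dv_eq f x a b : is_derive x 1 f a -> a = b -> is_derive x 1 f b.
Proof. by move=> fa <-. Qed.

Lemma dvC c x : is_derive x 1 (fun _ : R => c) 0.
Proof. exact: is_derive_cst. Qed.

Lemma dvid x : is_derive x 1 (fun y : R => y) 1.
Proof. exact: is_derive_id. Qed.

Lemma dvD f g x a b : is_derive x 1 f a -> is_derive x 1 g b ->
  is_derive x 1 (fun y => f y + g y) (a + b).
Proof. by move=> fa gb; exact: is_deriveD. Qed.

Lemma dvN f x a : is_derive x 1 f a -> is_derive x 1 (fun y => - f y) (- a).
Proof. by move=> fa; exact: is_deriveN. Qed.

Lemma dvM f g x a b : is_derive x 1 f a -> is_derive x 1 g b ->
  is_derive x 1 (fun y => f y * g y) (a * g x + f x * b).
Proof.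
move=> fa gb; have /is_derive_eq := is_deriveM fa gb; apply.
by rewrite addrC /GRing.scale /= [g x * a]mulrC.
Qed.

Lemma dvX f n x a : is_derive x 1 f a ->
  is_derive x 1 (fun y => f y ^+ n) (n%:R * f x ^+ n.-1 * a).
Proof.
case: n => [|n] fa; first by rewrite !mul0r; exact: dvC.
by have := is_deriveX n.+1 fa; rewrite exprfctE.
Qed.

Lemma dvV f x a : f x != 0 -> is_derive x 1 f a ->
  is_derive x 1 (fun y => (f y)^-1) (- a / f x ^+ 2).
Proof.
move=> f0 fa; have /is_derive_eq := is_deriveV f0 fa; apply.
by rewrite /GRing.scale /= mulNr mulrC -mulNr.
Qed.

Lemma dv_comp f g x a b : is_derive (g x) 1 f a -> is_derive x 1 g b ->
  is_derive x 1 (fun y => f (g y)) (a * b).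
Proof. by move=> fa gb; exact: is_derive1_comp. Qed.

Lemma dv_cos g x b : is_derive x 1 g b ->
  is_derive x 1 (fun y => cos (g y)) (- sin (g x) * b).
Proof. by move=> gb; apply: (@dv_comp (@cos R)) => //; exact: is_derive_cos. Qed.

Lemma dv_sin g x b : is_derive x 1 g b ->
  is_derive x 1 (fun y => sin (g y)) (cos (g x) * b).
Proof. by move=> gb; apply: (@dv_comp (@sin R)) => //; exact: is_derive_sin. Qed.

Lemma dv_exp g x b : is_derive x 1 g b ->
  is_derive x 1 (fun y => expR (g y)) (expR (g x) * b).
Proof. by move=> gb; apply: (@dv_comp (@expR R)) => //; exact: is_derive_expR. Qed.

Lemma dv_sqrt g x b : 0 < g x -> is_derive x 1 g b ->
  is_derive x 1 (fun y => Num.sqrt (g y)) ((2 * Num.sqrt (g x))^-1 * b).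
Proof. by move=> g0 gb; apply: (@dv_comp (@Num.sqrt R)) => //; exact: is_derive1_sqrt. Qed.

Lemma dv_kel j p g x b : is_derive x 1 g b ->
  is_derive x 1 (fun y => kel j p (g y)) (kel j.+1 p.+1 (g x) * b).
Proof. by move=> gb; apply: (@dv_comp (kel j p)) => //; exact: is_derive_kel. Qed.

Lemma dv_continuous f x a : is_derive x 1 f a -> {for x, continuous f}.
Proof. by case=> /derivable1_diffP/differentiable_continuous. Qed.

Lemma dv_ge0_le f (df : R -> R) a b : a <= b ->
  (forall x, a <= x <= b -> is_derive x 1 f (df x) /\ 0 <= df x) -> f a <= f b.
Proof.
move=> ab H; case: (@MVT_segment _ f df a b ab).
- by move=> x /itvP xab; apply: (proj1 (H x _)); rewrite !xab.
- apply: continuous_in_subspaceT => x; rewrite inE /= in_itv /= => /H[fx _].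
  exact: dv_continuous fx.
- move=> c; rewrite in_itv /= => /H[_ d0] E; rewrite -subr_ge0 E.
  by rewrite mulr_ge0 // subr_ge0.
Qed.

Lemma dv0_eq f a b : a <= b ->
  (forall x, a <= x <= b -> is_derive x 1 f 0) -> f a = f b.
Proof.
move=> ab H; apply/eqP; rewrite eq_le; apply/andP; split.
  by apply: (@dv_ge0_le _ (fun=> 0)) => // x /H.
rewrite -lerN2; apply: (@dv_ge0_le (fun y => - f y) (fun=> 0)) => // x /H h.
by split => //; rewrite -oppr0; exact: dvN.
Qed.

(* The lower bound [-1] makes the primitive two-sided differentiable at 0. *)
Lemma primitive_gtN1 f : continuous f ->
  exists F : R -> R, F 0 = 0 /\ forall x, -1 < x -> is_derive x 1 F (f x).
Proof.
move=> cf; pose G x := (\int[lebesgue_measure]_(t in `[-1, x]) f t)%R.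
exists (fun x => G x - G 0); split; first by rewrite subrr.
move=> x x1; rewrite -[f x]subr0.
have [] := @continuous_FTC1_closed _ f (-1) x (x + 1) _ _ x1 (cf x).
- by rewrite ltrDl.
- apply: continuous_compact_integrable; first exact: segment_compact.
  exact: continuous_subspaceT.
move=> dG Gx; apply: dvD.
by apply: (DeriveDef dG); rewrite -derive1E; exact: Gx.
Qed.

End OneVariable.

(** Follows the shape of the function, trying hypotheses first. The value found is an existential
    variable, compared afterwards with the announced one through [dv_eq]; the goals left over are
    the side conditions of inverses and square roots. *)
Ltac dv :=
  lazymatch goal with |- is_derive _ _ ?F _ =>
    first
    [ lazymatch F with
      | (fun y => y) => eapply dvid
      | (fun _ => ?c) => eapply (dvC c)
      | (fun y => ?g y) =>
          match goal with H : is_derive _ _ g _ |- _ => exact H end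
      | ?g => match goal with H : is_derive _ _ g _ |- _ => exact H end
      end
    | lazymatch F with
      | (fun y => - (@?f y)) => eapply (@dvN _ f); dv
      | (fun y => @?f y + @?g y) => eapply (@dvD _ f g); dv
      | (fun y => @?f y * @?g y) => eapply (@dvM _ f g); dv
      | (fun y => @?f y ^+ ?n) => eapply (@dvX _ f n); dv
      | (fun y => (@?f y)^-1) => eapply (@dvV _ f); [| dv]
      | (fun y => kel ?j ?p (@?f y)) => eapply (@dv_kel _ j p f); dv
      | (fun y => cos (@?f y)) => eapply (@dv_cos _ f); dv
      | (fun y => sin (@?f y)) => eapply (@dv_sin _ f); dv
      | (fun y => expR (@?f y)) => eapply (@dv_exp _ f); dv
      | (fun y => Num.sqrt (@?f y)) => eapply (@dv_sqrt _ f); [| dv]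
      end
    | idtac ]
  | _ => idtac
  end.

Section KelvinPhase.
Context {R : realType}.
Variable k : nat.
Implicit Types (u r : R).

(* With [h u = H_k (i u)], these are [|h|^2] and the real and imaginary parts
   of the product of [h'] and the conjugate of [h]. *)
Definition kmod2 u : R := kel k 0 u ^+ 2 + kel k 1 u ^+ 2.
Definition kreal u : R := kel k 0 u * kel k.+1 1 u - kel k 1 u * kel k.+1 0 u.
Definition kimag u : R := kel k 0 u * kel k.+1 0 u + kel k 1 u * kel k.+1 1 u.

Lemma dv_kmod2 u : is_derive u 1 kmod2 (2 * kreal u).
Proof.
eapply dv_eq; first by rewrite /kmod2; dv.
by rewrite /kreal /= kelSS; ring.
Qed.

(* Multiplying Bessel's equation [(u ^ (k + 1) h')' = i u ^ k h] by the
   conjugate of [h] and taking real parts. *)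
Lemma dv_energy u :
  is_derive u 1 (fun u => u ^+ k.+1 * kreal u)
    (u ^+ k.+1 * (kel k.+1 1 u ^+ 2 + kel k.+1 0 u ^+ 2)).
Proof.
eapply dv_eq; first by rewrite /kreal; dv.
have e0 := kel_rec k 0 u; have e1 := kel_rec k 1 u.
rewrite !kelSS in e1 *.
rewrite /kreal /= e0 e1 exprS; ring.
Qed.

(** The quantity in [dv_energy] is nondecreasing and starts from 0, thanks to its factor
    [u ^+ k.+1]. *)
Lemma kreal_ge0 u : 0 < u -> 0 <= kreal u.
Proof.
move=> u0; have : (0 : R) ^+ k.+1 * kreal 0 <= u ^+ k.+1 * kreal u.
  apply: (@dv_ge0_le _ (fun v => v ^+ k.+1 * kreal v) _ 0 u (ltW u0)) => v /andP[v0 _].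
  split; first exact: dv_energy.
  by rewrite mulr_ge0 ?exprn_ge0 // addr_ge0 ?sqr_ge0.
by rewrite exprS !mul0r pmulr_rge0 // exprn_gt0.
Qed.

Lemma kmod2_gt0_ge0 u : 0 <= u -> 0 < kmod2 u.
Proof.
move=> u0; have k0 : 0 < kmod2 0.
  rewrite /kmod2 !kel0 cosq0 cosq1 mul1r mul0r expr0n addr0.
  by rewrite exprn_gt0 // invr_gt0 ltr0n fact_gt0.
apply: (lt_le_trans k0); apply: (@dv_ge0_le _ _ (fun v => 2 * kreal v)) => //.
move=> v /andP[v0 _]; split; first exact: dv_kmod2.
rewrite mulr_ge0 //; move: v0; rewrite le_eqVlt => /predU1P[<-|]; last exact: kreal_ge0.
by rewrite /kreal !kel0 cosq1 !mul0r mulr0 subr0.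
Qed.

(** On the negative half-line h takes conjugate values. Positivity there makes [kimag u / kmod2 u]
    continuous on the whole line, as [primitive_gtN1] asks. *)
Lemma kmod2_gt0 u : 0 < kmod2 u.
Proof.
have [/kmod2_gt0_ge0//|u0] := leP 0 u.
have : 0 < kmod2 (- u) by apply: kmod2_gt0_ge0; rewrite oppr_ge0 ltW.
by rewrite /kmod2 !kelN /= expr0 expr1 mul1r mulN1r sqrrN.
Qed.

Lemma continuous_kimag_kmod2 : continuous (fun u => kimag u / kmod2 u).
Proof.
move=> u; have N0 := lt0r_neq0 (kmod2_gt0 u).
apply: (@dv_continuous _ _ u _); rewrite /kimag /kmod2; dv.
exact: N0.
Qed.

(** With b a primitive of Im (h' / h), the real and imaginary parts [X] and [Y] of h e^{-ib} solve
    the same linear equation as |h|. Their quotients by |h| are therefore constant, equal to 1 and 0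
    by the values at u = 0, where h is positive. *)
Lemma kel_polar : exists b : R -> R, [/\ b 0 = 0,
  forall u, -1 < u -> is_derive u 1 b (kimag u / kmod2 u) &
  forall u, 0 <= u -> kel k 0 u = Num.sqrt (kmod2 u) * cos (b u) /\
                     - kel k 1 u = Num.sqrt (kmod2 u) * sin (b u)].
Proof.
have [b [b0 db]] := primitive_gtN1 continuous_kimag_kmod2.
exists b; split => // u u0.
pose X (v : R) : R := kel k 0 v * cos (b v) - kel k 1 v * sin (b v).
pose Y (v : R) : R := - kel k 0 v * sin (b v) - kel k 1 v * cos (b v).
have N0 v := lt0r_neq0 (kmod2_gt0 v).
have E v : kmod2 v = kel k 0 v ^+ 2 + kel k 1 v ^+ 2 by [].
have dX (v : R) : -1 < v -> is_derive v 1 X (kreal v / kmod2 v * X v).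
  move=> /db dbv; eapply dv_eq; first by rewrite /X; dv.
  move: (N0 v); rewrite /X /kreal /kimag kelSS E => ?; by field.
have dY (v : R) : -1 < v -> is_derive v 1 Y (kreal v / kmod2 v * Y v).
  move=> /db dbv; eapply dv_eq; first by rewrite /Y; dv.
  move: (N0 v); rewrite /Y /kreal /kimag kelSS E => ?; by field.
have S0 v : 0 < Num.sqrt (kmod2 v) by rewrite sqrtr_gt0 kmod2_gt0.
have SS v : Num.sqrt (kmod2 v) ^+ 2 = kmod2 v by rewrite sqr_sqrtr // ltW // kmod2_gt0.
have cst (Z : R -> R) : (forall v : R, -1 < v -> is_derive v 1 Z (kreal v / kmod2 v * Z v)) ->
    Z u / Num.sqrt (kmod2 u) = Z 0 / Num.sqrt (kmod2 0).
  move=> dZ; apply/esym/(@dv0_eq _ (fun v => Z v / Num.sqrt (kmod2 v))) => // v /andP[v0 _].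
  have dZv : is_derive v 1 Z (kreal v / kmod2 v * Z v).
    by apply: dZ; rewrite (lt_le_trans _ v0) // ltrN10.
  have dN := dv_kmod2 v.
  eapply dv_eq; first dv.
  - by rewrite lt0r_neq0.
  - exact: kmod2_gt0.
  rewrite -[in kreal v / kmod2 v](SS v); move: (lt0r_neq0 (S0 v)) => ?.
  by field.
have Y0 : Y u = 0.
  have /eqP := cst Y dY; rewrite {2}/Y b0 sin0 !kel0 cosq1 mulr0 !mul0r subr0 mul0r.
  by rewrite mulf_eq0 invr_eq0 (gt_eqF (S0 u)) orbF => /eqP.
have X0 : X u = Num.sqrt (kmod2 u).
  have := cst X dX; rewrite {2}/X b0 sin0 cos0 mulr0 subr0 mulr1.
  have -> : kel k 0 0 = Num.sqrt (kmod2 0).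
    rewrite /kmod2 !kel0 cosq1 mul0r expr0n addr0 sqrtr_sqr ger0_norm //.
    by rewrite cosq0 mul1r invr_ge0.
  rewrite divff ?lt0r_neq0 // => /(congr1 (fun z => z * Num.sqrt (kmod2 u))).
  by rewrite mul1r divfK // lt0r_neq0.
have cs := cos2Dsin2 (b u).
rewrite -X0; split.
  rewrite -[LHS]mulr1 -cs -[RHS]subr0 -(mul0r (sin (b u))) -Y0 /X /Y; ring.
rewrite -[LHS]mulr1 -cs -[RHS]addr0 -(mul0r (cos (b u))) -Y0 /X /Y; ring.
Qed.

End KelvinPhase.

(** * Riccati equation and asymptotics of the phase *)

Section Riccati.
Context {R : realType}.
Implicit Types (r : R).
Variable k : nat.

(** The 1/2 comes from the factor sqrt r, which removes the first-order term of Bessel's equation: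
    the Riccati equation then depends explicitly on r only through 1 / r^2. *)
Definition logder_re r : R := (k%:R + 1 / 2) / r + 2 * r * (kreal k (r ^+ 2) / kmod2 k (r ^+ 2)).
Definition logder_im r : R := 2 * r * (kimag k (r ^+ 2) / kmod2 k (r ^+ 2)).

(* [q = logder_re + i logder_im] is the logarithmic derivative of
   [sqrt r * I_k ((1 + i) sqrt 2 r)], and satisfies the Riccati equation
   [q' = 4 i + (k^2 - 1/4) / r^2 - q^2]. *)
Lemma dv_logder_re r : 0 < r ->
  is_derive r 1 logder_re ((k%:R ^+ 2 - 1 / 4) / r ^+ 2 - logder_re r ^+ 2 + logder_im r ^+ 2).
Proof.
move=> r0; have N0 := lt0r_neq0 (@kmod2_gt0 R k (r ^+ 2)).
have r0' := lt0r_neq0 r0.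
eapply dv_eq; first by rewrite /logder_re /kreal /kmod2; dv.
rewrite /logder_re /logder_im /kreal /kimag /=.
have E : kmod2 k (r ^+ 2) = kel k 0 (r ^+ 2) ^+ 2 + kel k 1 (r ^+ 2) ^+ 2 by [].
have e0 := kel_rec k 0 (r ^+ 2); have e1 := kel_rec k 1 (r ^+ 2).
rewrite !kelSS in e1 *.
rewrite E in N0 *.
(* Bessel's equation enters here, eliminating the functions of order k + 2. *)
have -> : kel k.+2 1 (r ^+ 2) = (kel k 0 (r ^+ 2) - k.+1%:R * kel k.+1 0 (r ^+ 2)) / r ^+ 2.
  by rewrite e0; field.
have -> : kel k.+2 0 (r ^+ 2) = (k.+1%:R * kel k.+1 1 (r ^+ 2) - kel k 1 (r ^+ 2)) / r ^+ 2.
  by rewrite e1; field.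
rewrite -[k.+1]addn1 natrD; field.
by rewrite N0 r0'.
Qed.

Lemma dv_logder_im r : 0 < r -> is_derive r 1 logder_im (4 - 2 * logder_re r * logder_im r).
Proof.
move=> r0; have N0 := lt0r_neq0 (@kmod2_gt0 R k (r ^+ 2)).
have r0' := lt0r_neq0 r0.
eapply dv_eq; first by rewrite /logder_im /kimag /kmod2; dv.
rewrite /logder_re /logder_im /kreal /kimag /=.
have E : kmod2 k (r ^+ 2) = kel k 0 (r ^+ 2) ^+ 2 + kel k 1 (r ^+ 2) ^+ 2 by [].
have e0 := kel_rec k 0 (r ^+ 2); have e1 := kel_rec k 1 (r ^+ 2).
rewrite !kelSS in e1 *.
rewrite E in N0 *.
have -> : kel k.+2 1 (r ^+ 2) = (kel k 0 (r ^+ 2) - k.+1%:R * kel k.+1 0 (r ^+ 2)) / r ^+ 2.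
  by rewrite e0; field.
have -> : kel k.+2 0 (r ^+ 2) = (k.+1%:R * kel k.+1 1 (r ^+ 2) - kel k 1 (r ^+ 2)) / r ^+ 2.
  by rewrite e1; field.
rewrite -[k.+1]addn1 natrD; field.
by rewrite N0 r0'.
Qed.

End Riccati.

Section Asymptotics.
Context {R : realType}.
Implicit Types (f : R -> R) (r : R).

(** The derivative of M / r is minus the bound, so [f + M / r] is nonincreasing and [f - M / r]
    nondecreasing; the second bounds the first from below. *)
Lemma cvgy_of_derive_le (f : R -> R) (df : R -> R) (r0 M : R) :
  0 < r0 -> 0 <= M ->
  (forall r, r0 <= r -> is_derive r 1 f (df r) /\ `|df r| <= M / r ^+ 2) ->
  exists c : R, f r @[r --> +oo] --> c.
Proof.
move=> r00 M0 H.
have pos r : r0 <= r -> 0 < r by exact: lt_le_trans.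
have up r s : r0 <= r -> r <= s -> f s + M / s <= f r + M / r.
  move=> r0r rs; rewrite -lerN2.
  apply: (@dv_ge0_le _ (fun t => - (f t + M / t)) (fun t => - (df t - M / t ^+ 2))) => // t /andP[rt _].
  have [dft /ler_normlP[_ ub]] := H t (le_trans r0r rt).
  have t0 := pos t (le_trans r0r rt).
  split; last by rewrite oppr_ge0 subr_le0.
  eapply dv_eq; first by dv; rewrite lt0r_neq0.
  by move: (lt0r_neq0 t0) => ?; field.
have dn s : r0 <= s -> f r0 - M / r0 <= f s.
  move=> r0s; apply: (@le_trans _ _ (f s - M / s)); last first.
    by rewrite lerBlDr lerDl divr_ge0 // ltW // pos.
  apply: (@dv_ge0_le _ (fun t => f t - M / t) (fun t => df t + M / t ^+ 2)) => // t /andP[rt _].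
  have [dft /ler_normlP[lb _]] := H t rt.
  have t0 := pos t rt.
  split; last by rewrite addrC -[df t]opprK subr_ge0.
  eapply dv_eq; first by dv; rewrite lt0r_neq0.
  by move: (lt0r_neq0 t0) => ?; field.
(* Freezing the argument below [r0] gives a function that is monotone on the whole line. *)
pose g s := - (f (Num.max r0 s) + M / Num.max r0 s).
have gnd : nondecreasing_fun g.
  move=> a b ab; rewrite lerN2; apply: up; first by rewrite le_max lexx.
  by rewrite le_max2 //.
have gub : has_ubound (range g).
  exists (- (f r0 - M / r0)) => _ [s _ <-]; rewrite lerN2.
  have r0m : r0 <= Num.max r0 s by rewrite le_max lexx.
  apply: (le_trans (dn _ r0m)); rewrite lerDl divr_ge0 // ltW //.
  exact: pos.
have gc := nondecreasing_cvgr gnd gub.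
exists (- sup (range g)).
have Mc : M / r @[r --> +oo] --> (0 : R).
  by rewrite -(mulr0 M); apply: cvgMl_tmp; apply/gtr0_cvgV0; [near=> r|exact: cvg_id].
rewrite -[X in _ --> X]subr0.
have : (- g r - M / r) @[r --> +oo] --> - sup (range g) - 0.
  by apply: cvgB => //; apply: cvgN.
apply: cvg_trans; apply: near_eq_cvg; near=> r.
have -> : g r = - (f r + M / r).
  by rewrite /g max_r.
by rewrite opprK addrK.
Unshelve. all: by end_near. Qed.

Variable k : nat.
Let x : R -> R := logder_re k.
Let y : R -> R := logder_im k.

Let c : R := Num.sqrt 2.
Let D r : R := (x r - c) ^+ 2 + (y r - c) ^+ 2.
Let K : R := k%:R ^+ 2 - 1 / 4.

Let c0 : 0 < c. Proof. by rewrite sqrtr_gt0. Qed.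
Let c2 : c ^+ 2 = 2. Proof. by rewrite sqr_sqrtr. Qed.

Let x_ge0 r : 0 < r -> 0 <= x r.
Proof.
move=> r0; have r1 := ltW r0.
have N0 := ltW (@kmod2_gt0 R k (r ^+ 2)).
have Q0 : 0 <= kreal k (r ^+ 2) by apply: kreal_ge0; rewrite exprn_gt0.
apply: addr_ge0; first by apply: divr_ge0 => //; apply: addr_ge0 => //; exact: divr_ge0.
by apply: mulr_ge0; [exact: mulr_ge0 | exact: divr_ge0].
Qed.

(* The distance of [q] to the stable equilibrium [(1 + i) sqrt 2] is a Lyapunov
   function, because [x >= 0]. *)
Let distance_bound : exists M r0, [/\ 0 < r0, 0 <= M &
  forall r, r0 <= r -> r ^+ 4 * D r <= M].
Proof.
(* Beyond [r0] the aim is (r^4 D)' <= - (c / 2) (r^4 D - m). Of the decay rate 2 c of D, Young's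
   inequality for the term in K / r^2 spends c and leaves K^2 / (c r^4); absorbing the derivative 4
   r^3 of the weight spends c / 2, whence 8 <= c r. The constant [m] balances K^2 / c against the
   remaining c / 2. *)
pose r0 := 8 / c; pose m := 2 * K ^+ 2 / c ^+ 2.
pose E r := (r ^+ 4 * D r - m) * expR (c / 2 * r).
have r00 : 0 < r0 by rewrite divr_gt0.
have m0 : 0 <= m by rewrite divr_ge0 // ?sqr_ge0 // mulr_ge0 // sqr_ge0.
exists (m + `|E r0|), r0; split => //; first by rewrite addr_ge0.
move=> r r0r; have r_gt0 := lt_le_trans r00 r0r.
have : - E r0 <= - E r.
  pose dD t := 2 * (K * (x t - c) / t ^+ 2 - D t * (c + x t)).
  pose dE t := (4 * t ^+ 3 * D t + t ^+ 4 * dD t + (t ^+ 4 * D t - m) * (c / 2)) *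
    expR (c / 2 * t).
  apply: (@dv_ge0_le _ (fun t => - E t) (fun t => - dE t) r0 r r0r) => t /andP[r0t _].
  have t0 := lt_le_trans r00 r0t; have t0' := lt0r_neq0 t0.
  split.
    apply: dvN; have dx : is_derive t 1 x _ := dv_logder_re k t0.
    have dy : is_derive t 1 y _ := dv_logder_im k t0.
    eapply dv_eq; first by rewrite /E /D; dv.
    rewrite /dE /dD /D /= -/x -/y; move: (x t) (y t) => X Y.
    rewrite -/K; have -> : (4 : R) = 2 * c ^+ 2 by rewrite c2; ring.
    by field.
  rewrite oppr_ge0 pmulr_lle0 ?expR_gt0 //.
  have x0 := x_ge0 t0; have D0 : 0 <= D t by rewrite addr_ge0 ?sqr_ge0.
  have h1 : 2 * (K * (x t - c) / t ^+ 2) <= c * D t + K ^+ 2 / c / t ^+ 4.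
    apply: (@le_trans _ _ (c * (x t - c) ^+ 2 + K ^+ 2 / c / t ^+ 4)).
      rewrite -subr_ge0.
      have -> : c * (x t - c) ^+ 2 + K ^+ 2 / c / t ^+ 4 - 2 * (K * (x t - c) / t ^+ 2) =
          c * ((x t - c) - K / c / t ^+ 2) ^+ 2.
        by field; rewrite t0' lt0r_neq0.
      by rewrite mulr_ge0 ?sqr_ge0 // ltW.
    by rewrite lerD2r; apply: ler_wpM2l; [exact: ltW | rewrite lerDl sqr_ge0].
  have h2 : dD t <= - c * D t + K ^+ 2 / c / t ^+ 4.
    have : 0 <= D t * x t by rewrite mulr_ge0.
    by rewrite /dD; nra.
  have h3 : 4 * t ^+ 3 * D t <= c / 2 * (t ^+ 4 * D t).
    have : 4 <= c / 2 * t.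
      have : 8 <= c * t by rewrite -ler_pdivrMl // mulrC.
      lra.
    have : 0 <= t ^+ 3 * D t by rewrite mulr_ge0 // exprn_ge0 // ltW.
    by rewrite exprS; nra.
  have h4 : t ^+ 4 * dD t <= - c * (t ^+ 4 * D t) + K ^+ 2 / c.
    apply: (le_trans (ler_wpM2l (exprn_ge0 4 (ltW t0)) h2)).
    by rewrite le_eqVlt; apply/orP; left; apply/eqP; field; rewrite t0' lt0r_neq0.
  have h5 : m * (c / 2) = K ^+ 2 / c by rewrite /m; field; rewrite lt0r_neq0.
  by rewrite mulrBl h5; lra.
rewrite lerN2 /E => h; rewrite -lerBlDl.
have e1 : 1 <= expR (c / 2 * r).
  by rewrite -expR0 ler_expR mulr_ge0 // ?divr_ge0 // ltW.
(* The exponential, at least 1, may be dropped only in front of a positive quantity. *)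
have [neg|pos] := leP (r ^+ 4 * D r - m) 0; first exact: (le_trans neg).
apply: le_trans (le_trans h (ler_norm _)).
by rewrite -[leLHS]mulr1 ler_wpM2l // ltW.
Qed.

(** The derivative of [b (r ^+ 2)] is [logder_im], and the weight r^4 on the squared distance
    becomes an error sqrt M / r^2, integrable at infinity. *)
Lemma phase_asymptotics (b : R -> R) :
  (forall u : R, -1 < u -> is_derive u 1 b (kimag k u / kmod2 k u)) ->
  exists l : R, b (r ^+ 2) - Num.sqrt 2 * r @[r --> +oo] --> l.
Proof.
move=> db; have [M [r0 [r00 M0 DM]]] := distance_bound.
apply: (@cvgy_of_derive_le _ (fun r => y r - c) r0 (Num.sqrt M)) => //.
move=> r r0r; have r_gt0 := lt_le_trans r00 r0r; split.
  have r21 : -1 < r ^+ 2 by rewrite (lt_le_trans (ltrN10 _)) // sqr_ge0.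
  have dbr := @dv_comp _ b (fun r => r ^+ 2) r _ _ (db _ r21) (dvX 2 (dvid r)).
  eapply dv_eq; first by eapply dvD; [exact: dbr | dv].
  by rewrite /y /logder_im /c /=; ring.
rewrite ler_pdivlMr ?exprn_gt0 // -[r ^+ 2]ger0_norm ?sqr_ge0 // -normrM.
rewrite -sqrtr_sqr ler_sqrt //.
apply: le_trans (DM r r0r).
rewrite exprMn mulrC -exprM; apply: ler_wpM2l; first exact/exprn_ge0/ltW.
by rewrite lerDr sqr_ge0.
Qed.

End Asymptotics.

Section BesselSeries.
Context {R : realType}.
Implicit Types (u s : R) (z : R[i]).

Lemma cvg_complexR (p : nat -> R) (l : R) : p @ \oo --> l ->
  (fun n => ((p n)%:C)%C : (R[i] : numFieldType)) @ \oo --> ((l%:C)%C : (R[i] : numFieldType)).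
Proof.
move=> pl; apply/cvgrPdist_lt => e e0.
(* A positive element of R[i] is real. *)
have [e' e'0 ->] : exists2 e' : R, 0 < e' & e = (e'%:C)%C.
  case: e e0 => a b; rewrite ltcE /= => /andP[/eqP -> a0].
  by exists a.
near=> n; rewrite -rmorphB normc_def /= expr0n addr0 sqrtr_sqr ltcR.
by near: n; move/cvgrPdist_lt : pl; apply.
Unshelve. all: by end_near. Qed.

Lemma expr_i m : 'i%C ^+ m = (cosq m +i* - cosq m.+1)%C :> R[i].
Proof.
elim: m => [|m IH]; first by rewrite expr0 cosq0 cosq1 oppr0.
rewrite exprS IH; apply/eqP; rewrite eq_complex /= cosqSS.
by apply/andP; split; apply/eqP; ring.
Qed.

(** On this ray the square of z / 2 is i u with u real: the factor (z / 2)^(2 m) is i^m u^m, and the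
    series splits into two real ones. *)
Lemma besselI_ray k s : besselI k (s%:C * (1 +i* 1))%C =
  ((s / 2)%:C * (1 +i* 1))%C ^+ k *
  (kel k 0 (s ^+ 2 / 2) +i* - kel k 1 (s ^+ 2 / 2))%C.
Proof.
set u := s ^+ 2 / 2; set w := ((s / 2)%:C * _)%C.
have zw : (s%:C * (1 +i* 1))%C / 2%:R = w.
  by rewrite /w rmorphM /= fmorphV /= rmorph_nat mulrAC.
have w2 : w ^+ 2 = (u%:C * 'i)%C.
  rewrite /w expr2; simpc; apply/eqP; rewrite eq_complex /= /u.
  by apply/andP; split; apply/eqP; field.
suff h : (series (fun m : nat => ((s%:C * (1 +i* 1))%C / 2%:R) ^+ (2 * m + k) /
    (m`! * (m + k)`!)%:R : (R[i] : numFieldType))) @ \oo -->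
    ((w ^+ k * (kel k 0 u +i* - kel k 1 u)%C) : (R[i] : numFieldType)).
  exact: (cvg_lim (@norm_hausdorff _ _) h).
have -> : series (fun m : nat => ((s%:C * (1 +i* 1))%C / 2%:R) ^+ (2 * m + k) /
    (m`! * (m + k)`!)%:R : (R[i] : numFieldType)) =
  fun n => w ^+ k * ((pseries (kcoef k 0) u n)%:C + 'i * (- pseries (kcoef k 1) u n)%:C)%C.
  apply/funext => n; rewrite /pseries /series /= -sumrN !rmorph_sum /= mulr_sumr.
  rewrite -big_split /= mulr_sumr; apply: eq_bigr => m _.
  rewrite zw exprD exprM w2 exprMn expr_i mulrC mulrA [RHS]mulrC.
  congr (_ * _).
  rewrite /kcoef addn0 addn1.
  rewrite -[((m`! * (m + k)`!)%:R)^-1]/(((m`! * (m + k)`!)%:R : R[i])^-1).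
  have -> : ((m`! * (m + k)`!)%:R : R[i])^-1 = (((m`! * (m + k)`!)%:R^-1)%:C)%C.
    by rewrite fmorphV rmorph_nat.
  rewrite -rmorphXn /=; simpc; apply/eqP; rewrite eq_complex /=.
  by apply/andP; split; apply/eqP; ring.
have -> : (kel k 0 u +i* - kel k 1 u)%C = ((kel k 0 u)%:C + 'i * (- kel k 1 u)%:C)%C.
  by simpc.
apply: cvgMl_tmp; apply: cvgD; first exact/cvg_complexR/cvg_kel.
apply: cvgMl_tmp; apply: cvg_complexR; apply: cvgN; exact: cvg_kel.
Qed.

End BesselSeries.

(** * The rotating solution in Cartesian coordinates *)

Section Polar.
Context {R : realType}.
Implicit Types (x : R * R) (r th a b : R).

Lemma polar_exists x : exists th, polar (modulus x) th = x.
Proof.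
case: x => x y; rewrite /polar /modulus /=; set r := Num.sqrt _.
have r2 : r ^+ 2 = x ^+ 2 + y ^+ 2 by rewrite sqr_sqrtr // addr_ge0 // sqr_ge0.
have [r0|r0] := eqVneq r 0.
  exists 0; rewrite r0 !mul0r; move/eqP: r2; rewrite r0 expr0n eq_sym /=.
  by rewrite paddr_eq0 ?sqr_ge0 // !sqrf_eq0 => /andP[/eqP-> /eqP->].
have rp : 0 < r by rewrite lt0r r0 sqrtr_ge0.
have y2 : (y / r) ^+ 2 = 1 - (x / r) ^+ 2.
  have -> : 1 - (x / r) ^+ 2 = (r ^+ 2 - x ^+ 2) / r ^+ 2 by field.
  by rewrite exprMn exprVn; congr (_ / _); rewrite r2; ring.
have xr : -1 <= x / r <= 1.
  rewrite -ler_norml -(@ler_pXn2r _ 2) ?nnegrE // expr1n real_normK ?num_real //.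
  by rewrite -subr_ge0 -y2 sqr_ge0.
have [y0|y0] := leP 0 y.
  exists (acos (x / r)); rewrite sin_acos // acosK // -y2 sqrtr_sqr.
  rewrite ger0_norm; last exact: divr_ge0 y0 (ltW rp).
  by congr pair; field.
exists (- acos (x / r)); rewrite cosN sinN sin_acos // acosK // -y2 sqrtr_sqr.
rewrite ler0_norm; last by rewrite pmulr_lle0 ?invr_gt0 // ltW.
by congr pair; field.
Qed.

Lemma polar_angle x : polar (modulus x) (angle x) = x.
Proof. by rewrite /angle; have := getPex (polar_exists x). Qed.

Lemma modulus_ge0 x : 0 <= modulus x.
Proof. exact: sqrtr_ge0. Qed.

Lemma sqr_modulus x : modulus x ^+ 2 = x.1 ^+ 2 + x.2 ^+ 2.
Proof. by rewrite sqr_sqrtr // addr_ge0 // sqr_ge0. Qed.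

Lemma modulus_polar r th : 0 <= r -> modulus (polar r th) = r.
Proof.
move=> r0; rewrite /modulus /polar /= !exprMn -mulrDr cos2Dsin2 mulr1.
by rewrite sqrtr_sqr ger0_norm.
Qed.

Lemma expiD a b : expi (a + b) = expi a * expi b.
Proof. by rewrite /expi cosD sinD; simpc; rewrite addrC [sin a * _ + _]addrC. Qed.

Lemma expiMn n a : expi (n%:R * a) = expi a ^+ n.
Proof.
elim: n => [|n IH]; first by rewrite mul0r /expi cos0 sin0.
by rewrite -addn1 natrD mulrDl mul1r expiD IH exprD.
Qed.

Lemma polarE r th : let x := polar r th in (x.1 +i* x.2)%C = (r%:C)%C * expi th.
Proof. by rewrite /polar /expi /=; simpc. Qed.

Lemma cos_piquarter : cos (pi / 4) = (Num.sqrt 2)^-1 :> R.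
Proof. by rewrite -atan1 cos_atan expr1n. Qed.

Lemma sin_piquarter : sin (pi / 4) = (Num.sqrt 2)^-1 :> R.
Proof.
rewrite -cosBpihalf (_ : pi / 4 - pi / 2 = - (pi / 4)) ?cosN ?cos_piquarter //.
by field.
Qed.

Definition zimpow (k : nat) x : R := complex.Im ((x.1 +i* x.2)%C ^+ k).

Lemma zpow_zimpow k x : ((x.1 +i* x.2)%C ^+ k) = (zpow k x +i* zimpow k x)%C.
Proof. by rewrite /zpow /zimpow; case: (_ ^+ _). Qed.

Lemma zpow_polar k r th :
  zpow k (polar r th) = r ^+ k * cos (k%:R * th) /\
  zimpow k (polar r th) = r ^+ k * sin (k%:R * th).
Proof.
rewrite /zpow /zimpow polarE exprMn -expiMn -rmorphXn /= /expi; simpc.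
by split.
Qed.

Lemma zpow0 x : zpow 0 x = 1. Proof. by rewrite /zpow expr0. Qed.
Lemma zimpow0 x : zimpow 0 x = 0. Proof. by rewrite /zimpow expr0. Qed.

Lemma zpowS k x : zpow k.+1 x = x.1 * zpow k x - x.2 * zimpow k x.
Proof. by rewrite {1}/zpow exprS zpow_zimpow. Qed.

Lemma zimpowS k x : zimpow k.+1 x = x.1 * zimpow k x + x.2 * zpow k x.
Proof. by rewrite {1}/zimpow exprS zpow_zimpow. Qed.

End Polar.

Section CartesianForm.
Context {R : realType}.
Variables (omega : R) (k : nat).
Hypothesis omega_ge0 : 0 <= omega.
Implicit Types (x : R * R) (r th t : R).

Definition bessel_scale : R := omega * k%:R / 4.

Lemma bessel_scale_ge0 : 0 <= bessel_scale.
Proof. by rewrite /bessel_scale !mulr_ge0. Qed.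

(* [I_k ((1 + i) sqrt (2 omega k) r / 2) = (sqrt a r e^{i pi/4})^k h (a r^2)],
   with [a = bessel_scale] and [h u = H_k (i u)]. *)
Lemma rot_cartesian r th t :
  let x := polar r th in let u := bessel_scale * (x.1 ^+ 2 + x.2 ^+ 2) in
  let tau := k%:R * (omega * t + pi / 4) in
  complex.Re (expi (k%:R * (th + omega * t)) *
     besselI k ((Num.sqrt (2%:R * omega * k%:R) / 2%:R)%:C * (1 +i* 1) * r%:C))%C =
  Num.sqrt bessel_scale ^+ k *
   (zpow k x * (cos tau * kel k 0 u + sin tau * kel k 1 u) -
    zimpow k x * (sin tau * kel k 0 u - cos tau * kel k 1 u)).
Proof.
move=> x u tau.
set s := Num.sqrt (2%:R * omega * k%:R) / 2%:R.
have s2 : s ^+ 2 = omega * k%:R / 2.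
  by rewrite exprMn sqr_sqrtr ?mulr_ge0 //; field.
have s0 : 0 <= s by rewrite divr_ge0 ?sqrtr_ge0.
clearbody s.
have -> : (s%:C * (1 +i* 1) * r%:C)%C = ((s * r)%:C * (1 +i* 1))%C.
  by rewrite [in RHS]rmorphM /= mulrAC.
rewrite besselI_ray.
have -> : (s * r) ^+ 2 / 2 = u.
  by rewrite /u /x /polar /= !exprMn -mulrDr cos2Dsin2 mulr1 s2 /bessel_scale; field.
have -> : ((s * r / 2)%:C * (1 +i* 1))%C =
    ((Num.sqrt bessel_scale)%:C * (r%:C * expi (pi / 4)))%C.
  have a2 : Num.sqrt bessel_scale ^+ 2 = bessel_scale.
    by rewrite sqr_sqrtr ?bessel_scale_ge0.
  have q2 : Num.sqrt 2 ^+ 2 = 2 :> R by rewrite sqr_sqrtr.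
  have q0 : 0 < Num.sqrt 2 :> R by rewrite sqrtr_gt0.
  have a0 : 0 <= Num.sqrt bessel_scale by rewrite sqrtr_ge0.
  have e : s / 2 = Num.sqrt bessel_scale * (Num.sqrt 2)^-1.
    have n1 : s / 2 \is Num.nneg by rewrite nnegrE divr_ge0.
    have n2 : Num.sqrt bessel_scale * (Num.sqrt 2)^-1 \is Num.nneg.
      by rewrite nnegrE divr_ge0 // ltW.
    apply: (@pexpIrn _ 2) => //; move: a2 q2.
    move: (Num.sqrt bessel_scale) (Num.sqrt 2) => q w q2 w2.
    by rewrite !exprMn s2 q2 !exprVn w2 /bessel_scale; field.
  rewrite /expi cos_piquarter sin_piquarter.
  have -> : s * r / 2 = Num.sqrt bessel_scale * r * (Num.sqrt 2)^-1.
    by rewrite mulrAC e; ring.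
  apply/eqP; rewrite eq_complex /=; apply/andP; split; apply/eqP; ring.
rewrite exprMn -rmorphXn /= !mulrA.
have -> : k%:R * (th + omega * t) = k%:R * th + k%:R * (omega * t) by rewrite mulrDr.
have e : (expi (k%:R * th + k%:R * (omega * t)) * (r%:C * expi (pi / 4)) ^+ k =
    (x.1 +i* x.2) ^+ k * expi tau)%C.
  rewrite expiD polarE !exprMn -!expiMn /tau mulrDr expiD; ring.
set c := ((Num.sqrt bessel_scale) ^+ k).
set E := expi _ in e *; set F := (_ ^+ k)%C in e *.
have -> : (E * c%:C * F)%C = (c%:C * (E * F))%C by rewrite mulrAC mulrC.
by rewrite e zpow_zimpow /expi /=; ring.
Qed.

Lemma rotUE x t :
  let u := bessel_scale * (x.1 ^+ 2 + x.2 ^+ 2) in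
  let tau := k%:R * (omega * t + pi / 4) in
  rotU omega k x t =
  Num.sqrt bessel_scale ^+ k *
   (zpow k x * (cos tau * kel k 0 u + sin tau * kel k 1 u) -
    zimpow k x * (sin tau * kel k 0 u - cos tau * kel k 1 u)).
Proof. by rewrite /rotU rot_cartesian polar_angle. Qed.

(** The right side of [rot_cartesian] sees only the point, so it does not matter which determination
    [angle] returns. *)
Lemma rotU_polar r th t :
  rotU omega k (polar r th) t =
  complex.Re (expi (k%:R * (th + omega * t)) *
     besselI k ((Num.sqrt (2%:R * omega * k%:R) / 2%:R)%:C * (1 +i* 1) * r%:C))%C.
Proof. by rewrite rot_cartesian rotUE. Qed.

End CartesianForm.

(** * Differential calculus in several variables and smoothness *)

Section Differential.
Context {R : realType} {V : normedModType R}.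
Implicit Types (f g : V -> R) (x v : V).

Lemma df_eq f x (df dg : V -> R) : is_diff x f df -> df =1 dg -> is_diff x f dg.
Proof. by move=> fx /funext <-. Qed.

Lemma dfC (c : R) x : is_diff x (fun=> c) (fun=> 0).
Proof. exact: is_diff_cst. Qed.

Lemma dfD f g x df dg : is_diff x f df -> is_diff x g dg ->
  is_diff x (fun y => f y + g y) (fun v => df v + dg v).
Proof. by move=> fx gx; exact: (is_diffD fx gx). Qed.

Lemma dfN f x df : is_diff x f df -> is_diff x (fun y => - f y) (fun v => - df v).
Proof. by move=> fx; exact: (is_diffN fx). Qed.

Lemma dfM f g x df dg : is_diff x f df -> is_diff x g dg ->
  is_diff x (fun y => f y * g y) (fun v => df v * g x + f x * dg v).
Proof.
move=> fx gx; apply: df_eq (is_diffM fx gx) _ => v.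
by rewrite /GRing.scale /= addrC mulrC.
Qed.

Lemma df_comp f (h : R -> R) x df a : is_derive (f x) 1 h a -> is_diff x f df ->
  is_diff x (fun y => h (f y)) (fun v => a * df v).
Proof.
move=> [/derivable1_diffP hx ha] fx.
have hd : is_diff (f x) h (fun t => a * t).
  apply: DiffDef => //; apply/funext => t.
  by rewrite diff1E // derive1E ha /GRing.scale /= mulrC.
exact: (is_diff_comp fx hd).
Qed.

Lemma dfX f n x df : is_diff x f df ->
  is_diff x (fun y => f y ^+ n) (fun v => n%:R * f x ^+ n.-1 * df v).
Proof.
by move=> fx; apply: (@df_comp f (fun t => t ^+ n)) => //; eapply dv_eq; first dv; rewrite mulr1.
Qed.

Lemma df_cos f x df : is_diff x f df ->
  is_diff x (fun y => cos (f y)) (fun v => - sin (f x) * df v).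
Proof. by move=> fx; apply: (@df_comp f (@cos R)) => //; exact: is_derive_cos. Qed.

Lemma df_sin f x df : is_diff x f df ->
  is_diff x (fun y => sin (f y)) (fun v => cos (f x) * df v).
Proof. by move=> fx; apply: (@df_comp f (@sin R)) => //; exact: is_derive_sin. Qed.

Lemma df_kel j p f x df : is_diff x f df ->
  is_diff x (fun y => kel j p (f y)) (fun v => kel j.+1 p.+1 (f x) * df v).
Proof. by move=> fx; apply: (@df_comp f (kel j p)) => //; exact: is_derive_kel. Qed.

Lemma df_derive f x df v : is_diff x f df -> 'D_v f x = df v.
Proof. by move=> fx; rewrite deriveE ?diff_val //; exact: ex_diff. Qed.

Lemma df_continuous f x df : is_diff x f df -> {for x, continuous f}.
Proof. by move=> fx; apply: differentiable_continuous; exact: ex_diff. Qed.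

(* The closure of the linear forms under ring operations and composition with
   smooth functions of one variable; every directional derivative stays in it. *)
Inductive elementary : (V -> R) -> Prop :=
| elem_linear f of (forall x, is_diff x f f) : elementary f
| elem_cst c : elementary (fun=> c)
| elem_add f g of elementary f & elementary g : elementary (fun x => f x + g x)
| elem_mul f g of elementary f & elementary g : elementary (fun x => f x * g x)
| elem_comp (h : nat -> R -> R) n f of
    (forall i (t : R), is_derive t 1 (h i) (h i.+1 t)) & elementary f :
    elementary (fun x => h n (f x)).

Lemma elem_diff f : elementary f -> exists df : V -> V -> R,
  (forall x, is_diff x f (df x)) /\ forall v, elementary (fun x => df x v).
Proof.
elim=> {f} [f fx|c|f g ef [df [dfx edf]] eg [dg [dgx edg]]|
            f g ef [df [dfx edf]] eg [dg [dgx edg]]|h n f hh ef [df [dfx edf]]].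
- by exists (fun=> f); split => // v; exact: (elem_cst (f v)).
- by exists (fun _ _ => 0); split => [x|v]; [exact: dfC|exact: (elem_cst 0)].
- exists (fun x v => df x v + dg x v); split => [x|v]; first exact: dfD.
  exact: elem_add.
- exists (fun x v => df x v * g x + f x * dg x v); split => [x|v]; first exact: dfM.
  by apply: elem_add; exact: elem_mul.
- exists (fun x v => h n.+1 (f x) * df x v); split => [x|v]; first exact: df_comp.
  by apply: elem_mul => //; exact: elem_comp.
Qed.

Lemma elementary_smooth f : elementary f -> smooth f.
Proof.
move=> ef s; have : elementary (foldr (fun v g => fun y => 'D_v g y) f s).
  elim: s => //= v s /elem_diff[df [dfx edf]].
  rewrite (_ : (fun y => _) = (fun x => df x v)); first exact: edf.
  by apply/funext => y; exact: df_derive.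
by move=> /elem_diff[df [dfx _]] x; case: (dfx x).
Qed.

Lemma elementary_kel j p f : elementary f -> elementary (fun x => kel j p (f x)).
Proof.
move=> ef; rewrite -[j]addn0 -[p]addn0.
apply: (@elem_comp (fun n => kel (j + n) (p + n)) 0) => // i t.
by rewrite !addnS; exact: is_derive_kel.
Qed.

Lemma elementary_opp f : elementary f -> elementary (fun x => - f x).
Proof.
move=> ef; rewrite (_ : (fun x => _) = fun x => (-1) * f x).
  by apply: elem_mul => //; exact: elem_cst.
by apply/funext => x; rewrite mulN1r.
Qed.

Lemma elementary_cos f : elementary f -> elementary (fun x => cos (f x)).
Proof.
move=> ef.
(* Each derivative of the cosine advances its phase by pi / 2, which gives the whole tower of
   derivatives required by [elem_comp]. *)
pose h n (t : R) := cos (t + n%:R * (pi / 2)).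
rewrite (_ : (fun x => _) = fun x => h 0%N (f x)).
  apply: elem_comp ef => i t; eapply dv_eq; first by rewrite /h; dv.
  rewrite /h /= addr0 mulr1 -cosDpihalf -[i.+1%:R]natr1; congr (cos _); ring.
by apply/funext => x; rewrite /h mul0r addr0.
Qed.

Lemma elementary_sin f : elementary f -> elementary (fun x => sin (f x)).
Proof.
move=> ef; rewrite (_ : (fun x => _) = fun x => cos (f x + - (pi / 2))).
  by apply: elementary_cos; apply: elem_add => //; exact: elem_cst.
by apply/funext => x; rewrite cosBpihalf.
Qed.

End Differential.

Section Plane.
Context {R : realType}.
Implicit Types (x : R * R) (p : R * R * R).

Lemma df_fst {V W : normedModType R} (x : V * W) : is_diff x (fun y => y.1) (fun y => y.1).
Proof.
have c : continuous (fun y : V * W => y.1) by move=> ?; exact: cvg_fst.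
by split; [exact: (linear_differentiable _ c)| exact: (diff_lin _ c)].
Qed.

Lemma df_snd {V W : normedModType R} (x : V * W) : is_diff x (fun y => y.2) (fun y => y.2).
Proof.
have c : continuous (fun y : V * W => y.2) by move=> ?; exact: cvg_snd.
by split; [exact: (linear_differentiable _ c)| exact: (diff_lin _ c)].
Qed.

Lemma df_fst_fst (x : R * R * R) : is_diff x (fun y => y.1.1) (fun y => y.1.1).
Proof. exact: (is_diff_comp (df_fst x) (df_fst _)). Qed.

Lemma df_fst_snd (x : R * R * R) : is_diff x (fun y => y.1.2) (fun y => y.1.2).
Proof. exact: (is_diff_comp (df_fst x) (df_snd _)). Qed.

End Plane.

Ltac df :=
  lazymatch goal with |- @is_diff_def _ ?V _ _ _ ?F _ =>
    first
    [ lazymatch F with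
      | (fun y => y.1) => eapply (@df_fst _ _ _ _)
      | (fun y => y.2) => eapply (@df_snd _ _ _ _)
      | (fun _ => ?c) => eapply (@dfC _ V c)
      | (fun y => ?g y) =>
          match goal with H : is_diff _ g _ |- _ => exact H end
      | ?g => match goal with H : is_diff _ g _ |- _ => exact H end
      end
    | lazymatch F with
      | (fun y => - (@?f y)) => eapply (@dfN _ V f); df
      | (fun y => @?f y + @?g y) => eapply (@dfD _ V f g); df
      | (fun y => @?f y * @?g y) => eapply (@dfM _ V f g); df
      | (fun y => @?f y ^+ ?n) => eapply (@dfX _ V f n); df
      | (fun y => kel ?j ?p (@?f y)) => eapply (@df_kel _ V j p f); df
      | (fun y => cos (@?f y)) => eapply (@df_cos _ V f); df
      | (fun y => sin (@?f y)) => eapply (@df_sin _ V f); df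
      end
    | idtac ]
  | _ => idtac
  end.

Ltac dfe := lazymatch goal with |- @is_diff_def _ ?V _ _ _ _ _ =>
  eapply (@df_eq _ V); [by df|] end.

Section Powers.
Context {R : realType}.
Implicit Types (x v : R * R).

Lemma laplacianE (f f1 f2 : R * R -> R) x :
  (forall y, 'D_e1 f y = f1 y) -> (forall y, 'D_e2 f y = f2 y) ->
  laplacian f x = 'D_e1 f1 x + 'D_e2 f2 x.
Proof. by move=> /funext <- /funext <-. Qed.

(** The recursion for z^(k+1) mixes the two parts, hence the joint induction. Together they say that
    the differential of z^k is k z^(k-1) v; at k = 0 the factor k cancels the truncated exponent. *)
Lemma df_zpow_zimpow k x :
  is_diff x (@zpow R k)
    (fun v => k%:R * (v.1 * zpow k.-1 x - v.2 * zimpow k.-1 x)) /\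
  is_diff x (@zimpow R k)
    (fun v => k%:R * (v.1 * zimpow k.-1 x + v.2 * zpow k.-1 x)).
Proof.
elim: k => [|k [IH1 IH2]].
  split.
    rewrite (_ : zpow 0 = fun=> 1); last by apply/funext => y; exact: zpow0.
    by apply: df_eq (dfC _ _) _ => v; rewrite mul0r.
  rewrite (_ : zimpow 0 = fun=> 0); last by apply/funext => y; exact: zimpow0.
  by apply: df_eq (dfC _ _) _ => v; rewrite mul0r.
split.
  rewrite (_ : zpow k.+1 = fun y => y.1 * zpow k y - y.2 * zimpow k y); last first.
    by apply/funext => y; exact: zpowS.
  dfe.
  move=> v /=; rewrite -[k.+1%:R]natr1.
  by case: k {IH1 IH2} => [|k] /=; rewrite ?(zpow0, zimpow0, zpowS, zimpowS); ring.
rewrite (_ : zimpow k.+1 = fun y => y.1 * zimpow k y + y.2 * zpow k y); last first.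
  by apply/funext => y; exact: zimpowS.
dfe.
move=> v /=; rewrite -[k.+1%:R]natr1.
by case: k {IH1 IH2} => [|k] /=; rewrite ?(zpow0, zimpow0, zpowS, zimpowS); ring.
Qed.

Definition df_zpow k x := proj1 (df_zpow_zimpow k x).
Definition df_zimpow k x := proj2 (df_zpow_zimpow k x).

Lemma elementary_zpow {V : normedModType R} k (f : V -> R * R) :
  elementary (fun y => (f y).1) -> elementary (fun y => (f y).2) ->
  elementary (fun y => zpow k (f y)) /\ elementary (fun y => zimpow k (f y)).
Proof.
move=> e1 e2; elim: k => [|k [IH1 IH2]].
  split.
    rewrite (_ : (fun y => _) = fun=> 1); first exact: elem_cst.
    by apply/funext => y; exact: zpow0.
  rewrite (_ : (fun y => _) = fun=> 0); first exact: elem_cst.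
  by apply/funext => y; exact: zimpow0.
split.
  rewrite (_ : (fun y => _) = fun y => (f y).1 * zpow k (f y) + - ((f y).2 * zimpow k (f y))).
    apply: elem_add; first exact: elem_mul.
    by apply: elementary_opp; exact: elem_mul.
  by apply/funext => y; exact: zpowS.
rewrite (_ : (fun y => _) = fun y => (f y).1 * zimpow k (f y) + (f y).2 * zpow k (f y)).
  by apply: elem_add; exact: elem_mul.
by apply/funext => y; exact: zimpowS.
Qed.

Lemma elementary_fst : elementary (fun x : R * R => x.1).
Proof. by apply: elem_linear => x; exact: df_fst. Qed.

Lemma elementary_snd : elementary (fun x : R * R => x.2).
Proof. by apply: elem_linear => x; exact: df_snd. Qed.

Lemma zpow_rotation k th x :
  zpow k (rotation th x) = cos (k%:R * th) * zpow k x - sin (k%:R * th) * zimpow k x /\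
  zimpow k (rotation th x) = sin (k%:R * th) * zpow k x + cos (k%:R * th) * zimpow k x.
Proof.
have := zpow_zimpow k (rotation th x).
have -> : ((rotation th x).1 +i* (rotation th x).2)%C = expi th * (x.1 +i* x.2)%C.
  by rewrite /rotation /expi /=; simpc; rewrite [X in (_ +i* X)%C]addrC.
by rewrite exprMn -expiMn zpow_zimpow /expi => -[<- <-]; split => //; rewrite addrC.
Qed.

Lemma harmonic_zpow k : harmonic_function (@zpow R k).
Proof.
split; first by apply: elementary_smooth; apply: (elementary_zpow k elementary_fst elementary_snd).1.
move=> x; rewrite (@laplacianE _ (fun y => k%:R * zpow k.-1 y) (fun y => - (k%:R * zimpow k.-1 y))).
- have d1 := df_zpow k.-1 x; have d2 := df_zimpow k.-1 x.
  rewrite (df_derive e1 (dfM (dfC k%:R x) d1)).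
  rewrite (df_derive e2 (dfN (dfM (dfC k%:R x) d2))).
  by rewrite /e1 /e2 /=; ring.
- by move=> y; rewrite (df_derive e1 (df_zpow k y)) /e1 /=; ring.
- by move=> y; rewrite (df_derive e2 (df_zpow k y)) /e2 /=; ring.
Qed.

End Powers.

(** * The heat equation for the rotating wave *)

Section Heat.
Context {R : realType}.
Variables (a : R) (k : nat).
Implicit Types (x v : R * R) (tau : R).

(* [ke tau j p u = Re (i ^ p e^{i tau} H_j (i u))], and [wave tau] is the real part
   of [e^{i tau} z^k H_k (i a |z|^2)]. *)
Definition ke tau j p u : R := cos tau * kel j p u + sin tau * kel j p.+1 u.

Let sq x : R := a * (x.1 ^+ 2 + x.2 ^+ 2).

Definition wave tau x : R :=
  zpow k x * ke tau k 0 (sq x) + zimpow k x * ke tau k 1 (sq x).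

(** The contribution to the gradient of the dependence on |z|^2, up to the factor 2 a x: H_k is
    replaced by i H_{k+1}. *)
Definition radial tau x : R :=
  zpow k x * ke tau k.+1 1 (sq x) + zimpow k x * ke tau k.+1 2 (sq x).

Definition wave1 tau x : R :=
  k%:R * (zpow k.-1 x * ke tau k 0 (sq x) + zimpow k.-1 x * ke tau k 1 (sq x)) +
  2 * a * x.1 * radial tau x.

Definition wave2 tau x : R :=
  k%:R * (zpow k.-1 x * ke tau k 1 (sq x) - zimpow k.-1 x * ke tau k 0 (sq x)) +
  2 * a * x.2 * radial tau x.

Lemma df_ke tau j p x :
  is_diff x (fun y => ke tau j p (sq y))
    (fun v => ke tau j.+1 p.+1 (sq x) * (2 * a * (v.1 * x.1 + v.2 * x.2))).
Proof.
rewrite /ke /sq; dfe.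
by move=> v /=; ring.
Qed.

Lemma df_wave tau x :
  is_diff x (wave tau) (fun v => v.1 * wave1 tau x + v.2 * wave2 tau x).
Proof.
have d1 := df_zpow k x; have d2 := df_zimpow k x.
have d3 := df_ke tau k 0 x; have d4 := df_ke tau k 1 x.
apply: df_eq (dfD (dfM d1 d3) (dfM d2 d4)) _ => v.
by rewrite /wave1 /wave2 /radial /=; ring.
Qed.

Lemma elementary_ke tau j p : elementary (fun x => ke tau j p (sq x)).
Proof.
have e : elementary sq.
  apply: elem_mul; first exact: elem_cst.
  by apply: elem_add; apply: elem_mul; rewrite ?expr1;
    (exact: elementary_fst || exact: elementary_snd).
by apply: elem_add; apply: elem_mul; (exact: elem_cst || exact: elementary_kel).
Qed.

Lemma elementary_wave tau : elementary (wave tau).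
Proof.
have [e1 e2] := elementary_zpow k (@elementary_fst R) (@elementary_snd R).
by apply: elem_add; apply: elem_mul => //; exact: elementary_ke.
Qed.

Lemma keSS tau j p u : ke tau j p.+2 u = - ke tau j p u.
Proof. by rewrite /ke !kelSS; ring. Qed.

Lemma ke_rec tau j p u :
  ke tau j p u = j.+1%:R * ke tau j.+1 p u + u * ke tau j.+2 p.+1 u.
Proof. by rewrite /ke (kel_rec j p) (kel_rec j p.+1); ring. Qed.

Lemma df_radial tau x :
  is_diff x (radial tau) (fun v =>
    k%:R * (v.1 * zpow k.-1 x - v.2 * zimpow k.-1 x) * ke tau k.+1 1 (sq x) +
    zpow k x * (ke tau k.+2 2 (sq x) * (2 * a * (v.1 * x.1 + v.2 * x.2))) +
    (k%:R * (v.1 * zimpow k.-1 x + v.2 * zpow k.-1 x) * ke tau k.+1 2 (sq x) +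
    zimpow k x * (ke tau k.+2 3 (sq x) * (2 * a * (v.1 * x.1 + v.2 * x.2))))).
Proof.
have d1 := df_zpow k x; have d2 := df_zimpow k x.
have d3 := df_ke tau k.+1 1 x; have d4 := df_ke tau k.+1 2 x.
exact: (dfD (dfM d1 d3) (dfM d2 d4)).
Qed.

Lemma derive_wave tau x :
  'D_e1 (wave tau) x = wave1 tau x /\ 'D_e2 (wave tau) x = wave2 tau x.
Proof.
by rewrite !(df_derive _ (df_wave tau x)) /e1 /e2 /=; split; ring.
Qed.

(* Bessel's equation: [Laplacian (z^k h) = 4 a i z^k h]. *)
Lemma laplacian_wave tau x : (0 < k)%N ->
  laplacian (wave tau) x =
  4 * a * (zpow k x * ke tau k 1 (sq x) + zimpow k x * ke tau k 2 (sq x)).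
Proof.
move=> k0; rewrite (@laplacianE _ _ (wave1 tau) (wave2 tau)); last first.
- by move=> y; exact: (derive_wave tau y).2.
- by move=> y; exact: (derive_wave tau y).1.
have d1 := df_zpow k.-1 x; have d2 := df_zimpow k.-1 x.
have d3 := df_ke tau k 0 x; have d4 := df_ke tau k 1 x.
have d5 := df_radial tau x.
have c (b : R) := dfC b x.
have dx1 := @dfM _ _ (fun=> 2 * a) (fun x => x.1) x _ _ (c _) (df_fst x).
have dx2 := @dfM _ _ (fun=> 2 * a) (fun x => x.2) x _ _ (c _) (df_snd x).
have D1 := dfD (dfM (c k%:R) (dfD (dfM d1 d3) (dfM d2 d4))) (dfM dx1 d5).
have D2 := dfD (dfM (c k%:R) (dfD (dfM d1 d4) (dfN (dfM d2 d3)))) (dfM dx2 d5).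
rewrite (df_derive e1 D1 : 'D_e1 (wave1 tau) x = _) (df_derive e2 D2 : 'D_e2 (wave2 tau) x = _).
rewrite /e1 /e2 /radial (ke_rec tau k 1) (ke_rec tau k 2) -(prednK k0) /=.
rewrite zpowS zimpowS /sq -![_.+1%:R]natr1 !keSS; ring.
Qed.

(** A rotation multiplies z^k by e^{i k phi} and preserves |z|, so the phase [tau] absorbs it. *)
Lemma rotation_wave tau phi x :
  wave tau (rotation phi x) = wave (tau + k%:R * phi) x.
Proof.
have [e e'] := zpow_rotation k phi x.
have sr : sq (rotation phi x) = sq x.
  have cs := cos2Dsin2 phi.
  rewrite /sq /rotation /=; congr (_ * _).
  rewrite -[RHS]mulr1 -cs; ring.
by rewrite /wave sr e e' /ke !cosD !sinD !kelSS; ring.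
Qed.

Lemma dv_wave_time (f : R -> R) (t df : R) x : is_derive t 1 f df ->
  is_derive t 1 (fun s => wave (f s) x)
    (df * (zpow k x * ke (f t) k 1 (sq x) + zimpow k x * ke (f t) k 2 (sq x))).
Proof.
by move=> fd; rewrite /wave /ke; eapply dv_eq; [dv | rewrite !kelSS; ring].
Qed.

(** Along circles only z^k varies, with angular derivative i k z^k. The drift, the time derivative
    and the Laplacian are thus multiples of one and the same expression. *)
Lemma wave_rotation_derivative tau x :
  - x.2 * wave1 tau x + x.1 * wave2 tau x =
  k%:R * (zpow k x * ke tau k 1 (sq x) + zimpow k x * ke tau k 2 (sq x)).
Proof.
rewrite /wave1 /wave2; case: k => [|m]; first by rewrite !mul0r; ring.
by rewrite zpowS zimpowS /= keSS; ring.
Qed.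

End Heat.

Section RotatingSolution.
Context {R : realType}.
Variables (omega : R) (k : nat).
Hypothesis omega_ge0 : 0 <= omega.
Implicit Types (x : R * R) (t : R).

Let a := bessel_scale omega k.
Let tau t : R := k%:R * (omega * t + pi / 4).

Lemma rotU_wave x t :
  rotU omega k x t = Num.sqrt a ^+ k * wave a k (tau t) x.
Proof. by rewrite rotUE // /wave /ke !kelSS /tau; congr (_ * _); ring. Qed.

Lemma rotating_rotU : rotating omega (rotU omega k).
Proof.
exists (rotU omega k ^~ 0) => x t; rewrite !rotU_wave rotation_wave.
by congr (_ * wave _ _ _ _); rewrite /tau; ring.
Qed.

Lemma smooth_rotU : smooth (fun p : R * R * R => rotU omega k p.1 p.2).
Proof.
apply: elementary_smooth.
rewrite (_ : (fun p => _) = fun p => Num.sqrt a ^+ k * wave a k (tau p.2) p.1); last first.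
  by apply/funext => p; exact: rotU_wave.
apply: elem_mul; first exact: elem_cst.
have x1 : elementary (fun p : R * R * R => p.1.1) by apply: elem_linear => p; exact: df_fst_fst.
have x2 : elementary (fun p : R * R * R => p.1.2) by apply: elem_linear => p; exact: df_fst_snd.
have x3 : elementary (fun p : R * R * R => p.2) by apply: elem_linear => p; exact: df_snd.
have et : elementary (fun p : R * R * R => tau p.2).
  apply: elem_mul; first exact: elem_cst.
  apply: elem_add; last exact: elem_cst.
  by apply: elem_mul => //; exact: elem_cst.
have es : elementary (fun p : R * R * R => a * (p.1.1 ^+ 2 + p.1.2 ^+ 2)).
  by apply: elem_mul; [exact: elem_cst | apply: elem_add; exact: elem_mul].
have [z1 z2] := @elementary_zpow R (R * R * R)%type k fst x1 x2.
have ke_el j p : elementary (fun q : R * R * R => ke (tau q.2) j p (a * (q.1.1 ^+ 2 + q.1.2 ^+ 2))).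
  apply: elem_add; apply: elem_mul; try exact: elementary_kel.
    exact: elementary_cos.
  exact: elementary_sin.
by apply: elem_add; exact: elem_mul.
Qed.

Lemma heat_rotU : (0 < k)%N -> smooth_heat_solution (rotU omega k).
Proof.
move=> k0; split; first exact: smooth_rotU.
move=> x t; rewrite (_ : rotU omega k x = fun t => Num.sqrt a ^+ k * wave a k (tau t) x); last first.
  by apply/funext => s; exact: rotU_wave.
rewrite (_ : rotU omega k ^~ t = fun x => Num.sqrt a ^+ k * wave a k (tau t) x); last first.
  by apply/funext => y; exact: rotU_wave.
have dt : is_derive t 1 tau (k%:R * omega).
  by rewrite /tau; eapply dv_eq; [dv | ring].
have Dt := dvM (dvC (Num.sqrt a ^+ k) t) (dv_wave_time a k x dt).
rewrite derive1E (@derive_val _ _ _ _ _ _ _ Dt).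
have -> : laplacian (fun x => Num.sqrt a ^+ k * wave a k (tau t) x) x =
    Num.sqrt a ^+ k * laplacian (wave a k (tau t)) x.
  have dd (f : R * R -> R) v y : differentiable f y ->
      'D_v (fun x => Num.sqrt a ^+ k * f x) y = Num.sqrt a ^+ k * 'D_v f y.
    move=> fd; have := @derivableP _ _ _ f y v (diff_derivable fd).
    by move=> /(is_deriveZ (Num.sqrt a ^+ k)) h; have := @derive_val _ _ _ _ _ _ _ h.
  have sm := elementary_smooth (elementary_wave a k (tau t)).
  rewrite (laplacianE _ (fun y => dd _ _ _ (sm [::] y)) (fun y => dd _ _ _ (sm [::] y))).
  rewrite [RHS]mulrDr; congr (_ + _).
    exact: (dd (fun y => 'D_e1 (wave a k (tau t)) y) e1 x (sm [:: e1] x)).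
  exact: (dd (fun y => 'D_e2 (wave a k (tau t)) y) e2 x (sm [:: e2] x)).
(* The two factors are [k%:R * omega] and [4 * a], which agree by the choice of [bessel_scale]. *)
by rewrite laplacian_wave // /a /bessel_scale; field.
Qed.

End RotatingSolution.

(** * Nodal regions and nodal lines *)

Section Trigonometry.
Context {R : realType}.
Implicit Types (a b y T : R) (n : int).

Lemma nearest_multiple y T : 0 < T ->
  exists n : int, - (T / 2) <= y - n%:~R * T < T / 2.
Proof.
move=> T0; exists (Num.floor (y / T + 1 / 2)).
have /andP[h1 h2] := @floor_itv R (y / T + 1 / 2).
move: h1 h2; rewrite intrD; set n := _%:~R => h1 h2.
have -> : y = y / T * T by rewrite divfK // lt0r_neq0.
rewrite -mulrBl [in X in - X]mulrC -mulNr [T / 2]mulrC ler_pM2r // ltr_pM2r //.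
by apply/andP; split; lra.
Qed.

Lemma cosDz n a : cos (a + n%:~R * (pi *+ 2)) = cos a.
Proof.
case: n => n.
  by have := periodicn (@cosD2pi R) n a; rewrite -mulr_natl.
have := periodicn (@cosD2pi R) n.+1 (a + (Negz n)%:~R * (pi *+ 2)).
by rewrite -[pi *+ 2 *+ n.+1]mulr_natl NegzE mulrNz mulNr addrNK.
Qed.

Lemma sinDz n a : sin (a + n%:~R * (pi *+ 2)) = sin a.
Proof. by rewrite -!cosBpihalf addrAC cosDz. Qed.

Lemma polarDz r a n : polar r (a + n%:~R * (pi *+ 2)) = polar r a.
Proof. by rewrite /polar cosDz sinDz. Qed.

Lemma pi2_gt0 : 0 < pi *+ 2 :> R.
Proof. by rewrite mulrn_wgt0 // pi_gt0. Qed.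

Lemma cos_gt_cos a b : 0 <= b <= pi -> cos b < cos a ->
  exists n : int, `|a - n%:~R * (pi *+ 2)| < b.
Proof.
move=> b0pi ab; have [n /andP[h1 h2]] := nearest_multiple a pi2_gt0.
exists n; set d := a - _ in h1 h2 *.
have e : (pi *+ 2) / 2 = pi :> R by field.
have dpi : `|d| <= pi by rewrite ler_norml -{1}e h1 -e ltW.
rewrite -ltr_cos ?in_itv /= ?normr_ge0 //.
by rewrite cos_norm /d -mulNr -mulrNz cosDz.
Qed.

Lemma abs_lt_cos a b : 0 <= b <= pi -> `|a| < b -> cos b < cos a.
Proof.
move=> /andP[b0 bpi] ab; rewrite -(cos_norm a) ltr_cos // in_itv /= ?b0 //.
by rewrite normr_ge0 (le_trans (ltW ab)).
Qed.

Lemma cos_alternates n a : cos (a + n%:~R * pi) = (-1) ^+ `|n|%N * cos a.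
Proof.
case: n => n.
  by rewrite -(alternatingn (@cosDpi R) n a) -mulr_natl.
rewrite NegzE abszN absz_nat mulrNz mulNr.
have := alternatingn (@cosDpi R) n.+1 (a - n.+1%:R * pi).
rewrite -[pi *+ n.+1]mulr_natl addrNK => ->.
by rewrite mulrA -exprMn mulN1r opprK expr1n mul1r.
Qed.

Lemma cos_near_gt0 a n : `|a - n%:~R * pi| < pi / 2 -> 0 < (-1) ^+ `|n|%N * cos a.
Proof.
move=> h; have -> : a = (a - n%:~R * pi) + n%:~R * pi by rewrite addrNK.
rewrite cos_alternates mulrA -exprMn mulN1r opprK expr1n mul1r.
by apply: cos_gt0_pihalf; rewrite -ltr_norml.
Qed.

Lemma cos_neq0_near a : cos a != 0 -> exists n : int, `|a - n%:~R * pi| < pi / 2.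
Proof.
move=> a0; have [n /andP[h1 h2]] := nearest_multiple a (@pi_gt0 R).
exists n; rewrite ltr_norml h2 andbT lt_neqAle h1 andbT.
apply: contra a0 => /eqP e; have -> : a = - (pi / 2) + n%:~R * pi by rewrite e addrNK.
by rewrite cos_alternates cosN cos_pihalf mulr0.
Qed.

Lemma cos_eq0_form a : cos a = 0 -> exists n : int, a = pi / 2 + n%:~R * pi.
Proof.
move=> a0; have [n /andP[h1 h2]] := nearest_multiple a (@pi_gt0 R).
(* The zero can only be the left end - pi / 2 + n pi of the interval, which is pi / 2 + (n - 1)
   pi. *)
exists (n - 1); rewrite intrB mulrBl mul1r.
move: h1; rewrite le_eqVlt => /predU1P[e|h1].
  have -> : a = - (pi / 2) + n%:~R * pi by rewrite e addrNK.
  by field.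
have := @cos_near_gt0 a n; rewrite ltr_norml h1 h2 a0 mulr0 ltxx => /(_ isT).
by [].
Qed.

End Trigonometry.

(** * Twisted sectors *)

Section SpiralSectors.
Context {R : realType}.
Variables (k : nat) (g : R -> R).
Hypothesis k_gt0 : (0 < k)%N.
Hypothesis cont_g : forall r, 0 < r -> {for r, continuous g}.
Implicit Types (x : R * R) (r s th : R) (z n : int).

Let w : R := pi / k%:R.

Let kR : 0 < k%:R :> R. Proof. by rewrite ltr0n. Qed.
Let w0 : 0 < w. Proof. by rewrite divr_gt0 ?pi_gt0. Qed.
Let w2 : 0 <= w / 2 <= pi.
Proof.
apply/andP; split; first by rewrite divr_ge0 // ltW.
rewrite ler_pdivrMr // /w ler_pdivrMr // -mulrA ler_peMr ?pi_ge0 //.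
have : 1 <= k%:R :> R by rewrite ler1n.
lra.
Qed.

(* With [x = r e^{i th}], this is [r cos (th + g r - z pi / k)]. *)
Definition tilt z x : R :=
  x.1 * cos (g (modulus x) - z%:~R * w) - x.2 * sin (g (modulus x) - z%:~R * w).

Lemma tilt_polar z r th : 0 <= r ->
  tilt z (polar r th) = r * cos (th + (g r - z%:~R * w)).
Proof. by move=> r0; rewrite /tilt modulus_polar // /polar /= (cosD th); ring. Qed.

(** A condition on the cosine involves no choice of an angle and is continuous off the origin, which
    makes openness immediate; [sectorP] recovers the description by angles. *)
Definition sector z : set (R * R) :=
  [set x | 0 < modulus x /\ cos (w / 2) * modulus x < tilt z x].

Lemma sectorP z x : sector z x <->
  exists r s, [/\ 0 < r, `|s - z%:~R * w| < w / 2 & x = polar r (s - g r)].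
Proof.
split.
  move=> [r0]; rewrite -{2}(polar_angle x) tilt_polar ?modulus_ge0 //.
  rewrite [_ * modulus x]mulrC ltr_pM2l // => /(cos_gt_cos w2)[n].
  set r := modulus x; set th := angle x => h.
  exists r, (th + g r - n%:~R * (pi *+ 2)); split => //.
    by rewrite (_ : _ - z%:~R * w = th + (g r - z%:~R * w) - n%:~R * (pi *+ 2)) //; ring.
  by rewrite addrAC addrK -mulNr -mulrNz polarDz polar_angle.
move=> [r [s [r0 sz ->]]]; split; first by rewrite modulus_polar // ltW.
rewrite tilt_polar ?modulus_polar ?(ltW r0) // [_ * r]mulrC ltr_pM2l //.
by apply: abs_lt_cos => //; rewrite addrA subrK.
Qed.

Lemma tilt_periodic z n x : tilt (z + n * (2 * k)%:Z) x = tilt z x.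
Proof.
rewrite /tilt.
have e : g (modulus x) - (z + n * (2 * k)%:Z)%:~R * w + n%:~R * (pi *+ 2) =
    g (modulus x) - z%:~R * w.
  rewrite intrD intrM -[((2 * k)%:Z)%:~R]/((2 * k)%:R : R) natrM /w -mulr_natr.
  by field; rewrite lt0r_neq0.
by rewrite -(cosDz n (_ - (z + _)%:~R * w)) -(sinDz n (_ - (z + _)%:~R * w)) e.
Qed.

Lemma sector_periodic z n : sector (z + n * (2 * k)%:Z) = sector z.
Proof. by apply/seteqP; split => x; rewrite /sector /= tilt_periodic. Qed.

Lemma sector_modz z : sector z = sector (z %% (2 * k)%:Z)%Z.
Proof.
by rewrite {1}(divz_eq z (2 * k)%:Z) addrC sector_periodic.
Qed.

Lemma sector_nat z : exists2 m : nat, (m < 2 * k)%N & sector z = sector m%:Z.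
Proof.
have k2 : (2 * k)%:Z != 0 by rewrite -lt0n muln_gt0.
exists `|(z %% (2 * k)%:Z)%Z|%N.
  by rewrite -ltz_nat gez0_abs ?modz_ge0 // ltz_pmod // ltz_nat muln_gt0.
by rewrite sector_modz gez0_abs // modz_ge0.
Qed.

(** A common point is within w / 2 of both centre lines, up to full turns; the centres then differ
    by less than one step w, hence by 0 steps. *)
Lemma sector_unique z n x : sector z x -> sector n x ->
  exists q : int, z = n + q * (2 * k)%:Z.
Proof.
move=> [r0 zx] [_ nx]; move: zx nx.
rewrite -{2 4}(polar_angle x) !tilt_polar ?modulus_ge0 //.
rewrite ![_ * modulus x]mulrC !ltr_pM2l //.
move=> /(cos_gt_cos w2)[p hp] /(cos_gt_cos w2)[q hq].
exists (q - p).
have : `|(z - n - (q - p) * (2 * k)%:Z)%:~R * w| < w.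
  set A := angle x + _ - p%:~R * _ in hp; set B := angle x + _ - q%:~R * _ in hq.
  have -> : (z - n - (q - p) * (2 * k)%:Z)%:~R * w = B - A.
    rewrite /A /B !intrB intrM intrB -[((2 * k)%:Z)%:~R]/((2 * k)%:R : R) natrM /w.
    by rewrite -[pi *+ 2]mulr_natr; field; rewrite lt0r_neq0.
  apply: (le_lt_trans (ler_normB _ _)).
  by rewrite [X in _ < X](splitr w) ltrD.
rewrite normrM (gtr0_norm w0) -[X in _ < X]mul1r ltr_pM2r // -intr_norm ltrz1.
move: ((q - p) * _) => D h; lia.
Qed.

Lemma sector_cover x : 0 < modulus x ->
  cos (k%:R * (angle x + g (modulus x))) != 0 -> exists z, sector z x.
Proof.
move=> r0 /cos_neq0_near[z h]; exists z; apply/sectorP.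
exists (modulus x), (angle x + g (modulus x)); split => //.
  have -> : angle x + g (modulus x) - z%:~R * w =
      (k%:R * (angle x + g (modulus x)) - z%:~R * pi) / k%:R.
    by rewrite /w; field; rewrite lt0r_neq0.
  by rewrite normrM normfV (gtr0_norm kR) ltr_pdivrMr // /w mulrAC divfK ?lt0r_neq0.
by rewrite addrK polar_angle.
Qed.

Lemma sector_sign z x : sector z x ->
  0 < (-1) ^+ `|z|%N * cos (k%:R * (angle x + g (modulus x))).
Proof.
move=> [r0]; rewrite -{2}(polar_angle x) tilt_polar ?modulus_ge0 //.
rewrite [_ * modulus x]mulrC ltr_pM2l // => /(cos_gt_cos w2)[n].
set c := angle x + g (modulus x) => h.
have -> : cos (k%:R * c) = cos (k%:R * (c - n%:~R * (pi *+ 2))).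
  rewrite mulrBr -(cosDz (- (n * k%:Z)) (k%:R * c)); congr cos; congr (_ + _).
  by rewrite intrN intrM -[(k%:Z)%:~R]/(k%:R : R); ring.
apply: cos_near_gt0.
have -> : k%:R * (c - n%:~R * (pi *+ 2)) - z%:~R * pi =
    k%:R * (angle x + (g (modulus x) - z%:~R * w) - n%:~R * (pi *+ 2)).
  by rewrite /c /w; field; rewrite lt0r_neq0.
rewrite normrM (gtr0_norm kR) mulrC -ltr_pdivlMr //.
by rewrite -mulrAC.
Qed.

Lemma continuous_modulus : continuous (@modulus R).
Proof.
move=> x; apply: continuous_comp; last exact: sqrt_continuous.
by apply: (@df_continuous _ _ (fun x : R * R => x.1 ^+ 2 + x.2 ^+ 2)); df.
Qed.

Lemma continuous_tilt z x : 0 < modulus x -> {for x, continuous (tilt z)}.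
Proof.
move=> r0.
have gc : {for x, continuous (fun y => g (modulus y) - z%:~R * w)}.
  apply: continuousB; last exact: cst_continuous.
  by apply: continuous_comp; [exact: continuous_modulus | exact: cont_g].
rewrite /tilt; apply: continuousB; apply: continuousM.
- exact: cvg_fst.
- by apply: continuous_comp; [exact: gc | exact: continuous_cos].
- exact: cvg_snd.
- by apply: continuous_comp; [exact: gc | exact: continuous_sin].
Qed.

Lemma sector_open z : open (sector z).
Proof.
rewrite openE => x [r0 h]; rewrite /interior.
have c1 : {for x, continuous (@modulus R)} by exact: continuous_modulus.
have c2 : {for x, continuous (fun y => tilt z y - cos (w / 2) * modulus y)}.
  apply: continuousB; first exact: continuous_tilt.
  by apply: continuousM => //; exact: cst_continuous.
near=> y; split.
  by near: y; apply: (cvgr_gt (modulus x)).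
rewrite -subr_gt0; near: y; apply: (cvgr_gt (tilt z x - cos (w / 2) * modulus x)) => //.
by rewrite subr_gt0.
Unshelve. all: by end_near. Qed.

Lemma continuous_polar (f h : R -> R) s : {for s, continuous f} -> {for s, continuous h} ->
  {for s, continuous (fun t => polar (f t) (h t))}.
Proof.
move=> fc hc.
have c1 : {for s, continuous (fun t => f t * cos (h t))}.
  apply: continuousM => //.
  by apply: continuous_comp; [exact: hc | exact: continuous_cos].
have c2 : {for s, continuous (fun t => f t * sin (h t))}.
  apply: continuousM => //.
  by apply: continuous_comp; [exact: hc | exact: continuous_sin].
exact: (cvg_pair c1 c2).
Qed.

(** Every point lies on a twisted ray that crosses the arc of radius 1, so the sector is a union of
    connected sets sharing this arc. *)
Lemma sector_connected z : connected (sector z).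
Proof.
pose S := [set s : R | `|s - z%:~R * w| < w / 2].
pose arc := (fun s => polar 1 (s - g 1)) @` S.
pose ray s := (fun r => polar r (s - g r)) @` [set r : R | 0 < r].
have cz : S (z%:~R * w) by rewrite /S /= subrr normr0 divr_gt0.
have S_itv : is_interval S.
  move=> a b; rewrite /S /= !ltr_norml => /andP[a1 a2] /andP[b1 b2] c /andP[ac cb].
  by rewrite ltr_norml; apply/andP; split; lra.
have carc : connected arc.
  apply: connected_continuous_connected; first exact/connected_intervalP.
  apply: continuous_subspaceT => s.
  apply: (@continuous_polar (fun=> 1) (fun s => s - g 1)); first exact: cst_continuous.
  by apply: continuousB; [exact: cvg_id | exact: cst_continuous].
have cray s : connected (ray s).
  apply: connected_continuous_connected.
    apply/connected_intervalP => a b /= a0 b0 c /andP[ac _].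
    exact: (lt_le_trans a0).
  apply: continuous_in_subspaceT => r; rewrite inE /= => r0.
  apply: (@continuous_polar (fun r => r) (fun r => s - g r)); first exact: cvg_id.
  by apply: continuousB; [exact: cst_continuous | exact: cont_g].
rewrite (_ : sector z = \bigcup_(s in S) (ray s `|` arc)).
  apply: bigcup_connected.
    by exists (polar 1 (z%:~R * w - g 1)) => s _; right; exists (z%:~R * w).
  move=> s Ss; apply: connectedU => //.
  by exists (polar 1 (s - g 1)); split; [exists 1 => /= | exists s].
apply/seteqP; split => x.
  by move=> /sectorP[r [s [r0 h ->]]]; exists s => //; left; exists r.
move=> [s Ss [[r r0 <-]|[s' Ss' <-]]]; apply/sectorP.
  by exists r, s.
by exists 1, s'.
Qed.

Lemma sector_nonempty z : sector z !=set0.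
Proof.
exists (polar 1 (z%:~R * w - g 1)); apply/sectorP; exists 1, (z%:~R * w).
by split => //; rewrite subrr normr0 divr_gt0.
Qed.

Lemma rotation_polar th r s : rotation th (polar r s) = polar r (s + th).
Proof. by rewrite /rotation /polar /= cosD sinD; congr pair; ring. Qed.

Lemma rotation_sector (m : nat) z :
  rotation (m%:R * w) @` sector z = sector (z + m%:Z).
Proof.
apply/seteqP; split => x.
  move=> [y /sectorP[r [s [r0 h ->]]] <-]; rewrite rotation_polar; apply/sectorP.
  exists r, (s + m%:R * w); split => //; last by congr polar; ring.
  by rewrite intrD -[(m%:Z)%:~R]/(m%:R : R) mulrDl opprD addrACA subrr addr0.
move=> /sectorP[r [s [r0 h ->]]]; exists (polar r (s - m%:R * w - g r)).
  apply/sectorP; exists r, (s - m%:R * w); split => //.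
  by move: h; rewrite intrD -[(m%:Z)%:~R]/(m%:R : R) mulrDl opprD addrA addrAC.
by rewrite rotation_polar; congr polar; ring.
Qed.

End SpiralSectors.

Section NodalRegions.
Context {R : realType}.
Variables (k : nat) (g rho : R -> R) (u : R * R -> R).
Hypothesis k_gt0 : (0 < k)%N.
Hypothesis cont_g : forall r, 0 < r -> {for r, continuous g}.
Hypothesis rho_gt0 : forall r, 0 < r -> 0 < rho r.
Hypothesis rho0 : rho 0 = 0.
Hypothesis uE : forall x,
  u x = rho (modulus x) * cos (k%:R * (angle x + g (modulus x))).
Implicit Types (x : R * R) (r s th : R) (z n : int).

Let w : R := pi / k%:R.
Let V : set (R * R) := [set x | u x != 0].
Let sec z : set (R * R) := sector k g z.

Lemma modulus_neq0 x : u x != 0 -> 0 < modulus x.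
Proof.
move=> ux; rewrite lt0r modulus_ge0 andbT; apply: contraNneq ux => r0.
by rewrite uE r0 rho0 mul0r.
Qed.

Lemma nonzero_sector z x : sec z x -> 0 < (-1) ^+ `|z|%N * u x.
Proof.
move=> zx; have [r0 _] := zx; have := sector_sign k_gt0 zx.
by rewrite uE mulrCA (pmulr_rgt0 _ (rho_gt0 r0)).
Qed.

Lemma nonzero_cover x : u x != 0 <-> exists z, sec z x.
Proof.
split=> [ux|[z /nonzero_sector]]; last first.
  by move=> h; apply: contraTneq h => ->; rewrite mulr0 ltxx.
apply: sector_cover => //; first exact: modulus_neq0.
by move: ux; rewrite uE mulf_eq0 negb_or => /andP[].
Qed.

(** Sectors are open and pairwise equal or disjoint, so a sector is both open and closed in the
    component that meets it. *)
Lemma sector_component z x : sec z x -> connected_component V x = sec z.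
Proof.
move=> zx; apply/seteqP; split; last first.
  apply: connected_component_max => //; last exact: sector_connected.
  by move=> y zy; apply/nonzero_cover; exists z.
have VC := @connected_component_sub _ V x.
set C := connected_component V x in VC *.
have Cx : C x by apply: connected_component_refl; apply/nonzero_cover; exists z.
have Cc : connected C by exact: component_connected.
have E : C `&` sec z = C.
  apply: (Cc (C `&` sec z)); first by exists x.
    by exists (sec z) => //; exact: sector_open.
  (* Indices are periodic, so the other sectors are singled out as sets not contained in this one,
     rather than by a different index. *)
  exists (~` \bigcup_(n in [set n | ~ (sec n `<=` sec z)]) sec n).
    by rewrite closedC; apply: bigcup_open => n _; exact: sector_open.
  apply/seteqP; split => y [Cy].
    move=> zy; split => // -[n /= nz ny]; apply: nz.
    have [q ->] := sector_unique k_gt0 ny zy.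
    by rewrite /sec sector_periodic.
  move=> ny; split => //; have /nonzero_cover[n zn] := VC _ Cy.
  by apply: contrapT => zy; apply: ny; exists n => // /(_ _ zn).
by rewrite -E => y [].
Qed.

Lemma regionsE : connected_component V @` V = (fun m : nat => sec m%:Z) @` `I_(2 * k).
Proof.
apply/seteqP; split => A.
  move=> [x Vx <-]; have /nonzero_cover[z zx] := Vx.
  rewrite (sector_component zx); have [m mk e] := sector_nat g k_gt0 z.
  by exists m.
move=> [m mk <-]; have [x mx] := sector_nonempty g k_gt0 m%:Z.
exists x; last exact: sector_component.
by apply/nonzero_cover; exists m%:Z.
Qed.

Lemma sector_inj : {in `I_(2 * k) &, injective (fun m : nat => sec m%:Z)}.
Proof.
move=> m n; rewrite !inE /= => mk nk e.
have [x mx] := sector_nonempty g k_gt0 m%:Z.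
have nx : sec n%:Z x by rewrite -e.
have [q] := sector_unique k_gt0 mx nx.
move: mk nk; move: (2 * k)%N => N mk nk.
case: q => [[|q]|q].
- by rewrite mul0r addr0 => -[].
- have : (N <= q.+1 * N)%N by rewrite leq_pmull.
  by rewrite -PoszM; lia.
- have : (N <= q.+1 * N)%N by rewrite leq_pmull.
  by rewrite NegzE mulNr -PoszM; lia.
Qed.

Lemma card_regions : (connected_component V @` V #= `I_(2 * k))%card.
Proof. by rewrite regionsE; apply: inj_card_eq; exact: sector_inj. Qed.

Lemma regions_rotation A B : (connected_component V @` V) A ->
  (connected_component V @` V) B ->
  exists m : nat, B = rotation (m%:R * w) @` A.
Proof.
rewrite regionsE => -[m mk <-] [n nk <-].
(* The full turn 2 k keeps the subtraction of natural numbers from truncating. *)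
exists (n + 2 * k - m)%N; rewrite rotation_sector // /sec.
rewrite -(sector_periodic g k_gt0 n%:Z 1); congr (sector _ _ _).
by move: mk nk => /=; lia.
Qed.

Lemma nodal_lines :
  [set x | u x = 0] `\ (0, 0) =
  \bigcup_(m in `I_(2 * k))
    [set polar r ((pi / 2 / k%:R - g r) + m%:R * w) | r in [set r : R | 0 < r]].
Proof.
have kR : k%:R != 0 :> R by rewrite pnatr_eq0 -lt0n.
apply/seteqP; split => x.
  move=> [/= ux x0]; have r0 : 0 < modulus x.
    rewrite lt0r modulus_ge0 andbT; apply: contra_not_neq x0 => r0.
    by rewrite -(polar_angle x) r0 /polar !mul0r.
  move: ux; rewrite uE => /eqP; rewrite mulf_eq0 gt_eqF ?rho_gt0 //= => /eqP.
  move=> /cos_eq0_form[z hz].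
  have k2 : (2 * k)%:Z != 0 by rewrite -lt0n muln_gt0.
  have rem0 := modz_ge0 z k2.
  exists `|(z %% (2 * k)%:Z)%Z|%N.
    by rewrite /= -ltz_nat gez0_abs // ltz_pmod // ltz_nat muln_gt0.
  exists (modulus x) => //.
  rewrite -[RHS]polar_angle.
  have -> : angle x = (pi / 2 / k%:R - g (modulus x)) + z%:~R * w.
    rewrite /w; apply: (mulfI kR); apply: (addIr (k%:R * g (modulus x))).
    by rewrite -mulrDr hz; field.
  rewrite [in RHS](divz_eq z (2 * k)%:Z) intrD intrM -[((2 * k)%:Z)%:~R]/((2 * k)%:R : R).
  have -> : `|(z %% (2 * k)%:Z)%Z|%N%:R = (z %% (2 * k)%:Z)%Z%:~R :> R.
    by rewrite -[in RHS](gez0_abs rem0).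
  rewrite -(polarDz _ _ (z %/ (2 * k)%:Z)%Z); congr polar.
  by rewrite natrM /w -mulr_natr; field.
move=> [m mk [r r0 <-]].
have r0' := ltW (r0 : 0 < r).
split; last first.
  move=> /(congr1 (@modulus R)); rewrite modulus_polar // => e.
  by move: r0; rewrite /= e /modulus /= expr0n addr0 sqrtr0 ltxx.
rewrite /= uE modulus_polar //.
set th := _ + _ * w.
(* The angle returned for this point may differ from [th], but the k-th power of the point
   determines the cosine and sine of k times either. *)
have -> : cos (k%:R * (angle (polar r th) + g r)) = cos (k%:R * (th + g r)).
  have ex : polar r (angle (polar r th)) = polar r th.
    by have := polar_angle (polar r th); rewrite modulus_polar.
  have [z1 z2] := zpow_polar k r (angle (polar r th)); have [z3 z4] := zpow_polar k r th.
  rewrite ex in z1 z2; rewrite z3 in z1; rewrite z4 in z2.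
  have rk : r ^+ k != 0 by rewrite expf_neq0 // gt_eqF.
  by rewrite (mulrDr _ (angle _)) (mulrDr _ th) !cosD (mulfI rk z1) (mulfI rk z2).
have -> : k%:R * (th + g r) = pi / 2 + m%:~R * pi by rewrite /th /w; field.
by rewrite (cos_alternates m%:Z) cos_pihalf !mulr0.
Qed.

End NodalRegions.

Section RotatingNodal.
Context {R : realType}.
Variables (omega : R) (k : nat).
Hypothesis omega_gt0 : 0 < omega.
Hypothesis k_gt0 : (0 < k)%N.
Implicit Types (x : R * R) (t r th : R).

Let a := bessel_scale omega k.
Let kR : 0 < k%:R :> R. Proof. by rewrite ltr0n. Qed.
Let a_gt0 : 0 < a. Proof. by rewrite /a /bessel_scale !mulr_gt0. Qed.

Variable b : R -> R.
Hypothesis b0 : b 0 = 0.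
Hypothesis db : forall u : R, -1 < u -> is_derive u 1 b (kimag k u / kmod2 k u).
Hypothesis bE : forall u, 0 <= u ->
  kel k 0 u = Num.sqrt (kmod2 k u) * cos (b u) /\
  - kel k 1 u = Num.sqrt (kmod2 k u) * sin (b u).

Definition twist t r : R := (k%:R * (omega * t + pi / 4) + b (a * r ^+ 2)) / k%:R.

Definition amplitude r : R :=
  Num.sqrt a ^+ k * (r ^+ k * Num.sqrt (kmod2 k (a * r ^+ 2))).

Lemma rotU_twist x t : rotU omega k x t =
  amplitude (modulus x) * cos (k%:R * (angle x + twist t (modulus x))).
Proof.
rewrite rotU_wave ?ltW // /wave /ke -/a -sqr_modulus.
set r := modulus x; set u := a * r ^+ 2.
have [z1 z2] := zpow_polar k r (angle x); rewrite polar_angle in z1 z2.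
have u0 : 0 <= u by apply: mulr_ge0; [exact: ltW | exact: sqr_ge0].
have [e1 e2] := bE u0.
have -> : k%:R * (angle x + twist t r) =
    k%:R * angle x + (k%:R * (omega * t + pi / 4) + b u).
  by rewrite /twist mulrDr; congr (_ + _); field; rewrite gt_eqF.
have e3 : kel k 1 u = - (Num.sqrt (kmod2 k u) * sin (b u)) by rewrite -e2 opprK.
rewrite z1 z2 kelSS e3 e1 /amplitude -/u !cosD !sinD; ring.
Qed.

Lemma dv_b_sq r : is_derive r 1 (fun r => b (a * r ^+ 2))
  (kimag k (a * r ^+ 2) / kmod2 k (a * r ^+ 2) * (2 * a * r)).
Proof.
apply: (@dv_comp _ b (fun r => a * r ^+ 2)).
  by apply: db; apply: (lt_le_trans (ltrN10 _)); apply: mulr_ge0; [exact: ltW | exact: sqr_ge0].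
by eapply dv_eq; [dv | rewrite /=; ring].
Qed.

Lemma continuous_twist t : continuous (twist t).
Proof.
move=> r; have := dv_b_sq r; set d := _ / _ * _ => dr.
apply: (@dv_continuous _ _ _ (d / k%:R)).
eapply dv_eq.
  apply: (dvM (dvD (dvC (k%:R * (omega * t + pi / 4)) r) dr) (dvC (k%:R^-1) r)).
by rewrite add0r mulr0 addr0.
Qed.

Lemma amplitude_gt0 r : 0 < r -> 0 < amplitude r.
Proof.
move=> r0; rewrite /amplitude !mulr_gt0 ?exprn_gt0 ?sqrtr_gt0 //.
exact: kmod2_gt0.
Qed.

Lemma amplitude0 : amplitude 0 = 0.
Proof. by rewrite /amplitude expr0n gtn_eqF // mul0r mulr0. Qed.

Lemma card_nodal_regions t : (nodal_regions (rotU omega k) t #= `I_(2 * k))%card.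
Proof.
apply: (@card_regions _ k (twist t) amplitude) => //.
- by move=> r _; exact: continuous_twist.
- exact: amplitude_gt0.
- exact: amplitude0.
- by move=> x; exact: rotU_twist.
Qed.

Lemma rotate_nodal_regions t A B :
  nodal_regions (rotU omega k) t A -> nodal_regions (rotU omega k) t B ->
  exists m : nat, B = rotation (m%:R * (pi / k%:R)) @` A.
Proof.
apply: (@regions_rotation _ k (twist t) amplitude) => //.
- by move=> r _; exact: continuous_twist.
- exact: amplitude_gt0.
- exact: amplitude0.
- by move=> x; exact: rotU_twist.
Qed.

(** On the nodal lines, angle plus [twist] is an odd multiple of pi / (2 k). The twist grows
    linearly with r, so the nodal angle decreases linearly, whence the sign in the last limit. *)
Lemma spiral_nodal_lines t : exists theta : R -> R,
  [/\ {in `]0, +oo[, continuous theta},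
      [set x | rotU omega k x t = 0] `\ (0, 0) =
        \bigcup_(m in `I_(2 * k))
          [set polar r (theta r + m%:R * (pi / k%:R)) | r in [set r : R | 0 < r]],
      exists theta0 : R, theta r @[r --> 0^'+] --> theta0 &
      exists c : R, theta r + Num.sqrt (omega / (2%:R * k%:R)) * r @[r --> +oo] --> c].
Proof.
exists (fun r => pi / 2 / k%:R - twist t r).
have ct : continuous (fun r => pi / 2 / k%:R - twist t r).
  by move=> r; apply: cvgB; [exact: cvg_cst | exact: continuous_twist].
split.
- by move=> r _; exact: ct.
- apply: (@nodal_lines _ k (twist t) amplitude (rotU omega k ^~ t)) => //.
  + exact: amplitude_gt0.
  + by move=> x; exact: rotU_twist.
- exists (pi / 2 / k%:R - twist t 0).
  by apply: cvg_at_right_filter; exact: ct.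
have [l bl] := phase_asymptotics db.
exists (pi / 2 / k%:R - (k%:R * (omega * t + pi / 4) + l) / k%:R).
have sa : 0 < Num.sqrt a by rewrite sqrtr_gt0.
(* In [phase_asymptotics] the variable is sqrt a times r; the slope sqrt 2 becomes sqrt (2 a) / k
   after division by k, which is sqrt (omega / (2 k)). *)
have sy : Num.sqrt a * r @[r --> +oo] --> +oo by apply: gt0_cvgMry => //; exact: cvg_id.
have h : b (a * r ^+ 2) - Num.sqrt 2 * (Num.sqrt a * r) @[r --> +oo] --> l.
  have := cvg_comp _ _ sy bl.
  rewrite (_ : _ \o _ = fun r => b (a * r ^+ 2) - Num.sqrt 2 * (Num.sqrt a * r)) //.
  by apply/funext => r /=; rewrite exprMn sqr_sqrtr // ltW.
have e : Num.sqrt (omega / (2%:R * k%:R)) = Num.sqrt 2 * Num.sqrt a / k%:R.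
  rewrite -sqrtrM // -[k%:R in RHS]gtr0_norm // -sqrtr_sqr -sqrtrV ?sqr_ge0 // -sqrtrM.
    by congr Num.sqrt; rewrite /a /bessel_scale; field; rewrite gt_eqF.
  by rewrite mulr_ge0 // ltW.
rewrite (_ : (fun r => _) = fun r => pi / 2 / k%:R - (k%:R * (omega * t + pi / 4) +
   (b (a * r ^+ 2) - Num.sqrt 2 * (Num.sqrt a * r))) / k%:R); last first.
  by apply/funext => r; rewrite e /twist; field; rewrite gt_eqF.
apply: cvgB; first exact: cvg_cst.
apply: cvgMr_tmp; apply: cvgD => //; exact: cvg_cst.
Qed.

End RotatingNodal.

(** * The limit of slow rotation *)

Section SmallRotation.
Context {R : realType}.
Variable k : nat.
Hypothesis k_gt0 : (0 < k)%N.
Implicit Types (omega : R) (p : R * R * R).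

Lemma elementary_comp_fst {V W : normedModType R} (f : V -> R) :
  elementary f -> elementary (fun q : V * W => f q.1).
Proof.
elim=> {f} [f fx|c|f g _ ef _ eg|f g _ ef _ eg|h n f hh _ ef].
- apply: elem_linear => q; exact: (is_diff_comp (df_fst q) (fx q.1)).
- exact: elem_cst.
- exact: elem_add.
- exact: elem_mul.
- exact: (elem_comp n hh ef).
Qed.

(** k! compensates the value 1 / k! of H_k at 0, and the denominator the prefactor of [rotU], which
    vanishes with omega. *)
Definition rescale omega : R := k`!%:R / Num.sqrt (bessel_scale omega k) ^+ k.

(** With omega as a fourth variable, the renormalized solution extends to an elementary function
    across omega = 0, so the limit is an instance of joint continuity. *)
Let ff (q : R * R * R * R) : R := k`!%:R * wave (bessel_scale q.2 k) k (k%:R * (q.2 * q.1.2)) q.1.1.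

(** The rotation by - pi / 4 cancels the constant phase k pi / 4 that the ray of argument pi / 4
    leaves in the wave. *)
Lemma rescaleE omega p : 0 < omega ->
  rescale omega * rotU omega k (rotation (- (pi / 4)) p.1) p.2 = ff (p, omega).
Proof.
move=> o0; rewrite rotU_wave ?ltW // rotation_wave /rescale /ff /=.
have s0 : Num.sqrt (bessel_scale omega k) ^+ k != 0.
  rewrite expf_neq0 // gt_eqF // sqrtr_gt0 /bessel_scale !mulr_gt0 //.
  by rewrite ltr0n.
rewrite (_ : k%:R * (omega * p.2 + pi / 4) + k%:R * - (pi / 4) = k%:R * (omega * p.2)).
  by field.
by ring.
Qed.

Lemma rescale_gt0 omega : 0 < omega -> 0 < rescale omega.
Proof.
move=> o0; rewrite divr_gt0 ?ltr0n ?fact_gt0 // exprn_gt0 // sqrtr_gt0.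
by rewrite /bessel_scale !mulr_gt0 // ltr0n.
Qed.

Lemma ff0 p : ff (p, 0) = zpow k p.1.
Proof.
rewrite /ff /wave /ke /bessel_scale /= !mul0r mulr0 cos0 sin0 !kel0 cosq0 cosq1.
rewrite !mul0r mul1r addr0 mulr0 addr0 mul1r !mulr0 addr0 mulrCA divff ?mulr1 //.
Qed.

Lemma elementary_ff : elementary ff.
Proof.
have x1 : elementary (fun q : R * R * R * R => q.1.1.1).
  apply: (@elementary_comp_fst (R * R * R)%type R (fun p => p.1.1)).
  by apply: elem_linear => p; exact: df_fst_fst.
have x2 : elementary (fun q : R * R * R * R => q.1.1.2).
  apply: (@elementary_comp_fst (R * R * R)%type R (fun p => p.1.2)).
  by apply: elem_linear => p; exact: df_fst_snd.
have x3 : elementary (fun q : R * R * R * R => q.1.2).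
  apply: (@elementary_comp_fst (R * R * R)%type R (fun p => p.2)).
  by apply: elem_linear => p; exact: df_snd.
have x4 : elementary (fun q : R * R * R * R => q.2) by apply: elem_linear => p; exact: df_snd.
have et : elementary (fun q : R * R * R * R => k%:R * (q.2 * q.1.2)).
  by apply: elem_mul; [exact: elem_cst | exact: elem_mul].
have es : elementary (fun q : R * R * R * R =>
    bessel_scale q.2 k * (q.1.1.1 ^+ 2 + q.1.1.2 ^+ 2)).
  apply: elem_mul; last by apply: elem_add; exact: elem_mul.
  by apply: elem_mul; [apply: elem_mul => //|]; exact: elem_cst.
have [z1 z2] := @elementary_zpow R (R * R * R * R)%type k (fun q => q.1.1) x1 x2.
have ke_el j m : elementary (fun q : R * R * R * R =>
    ke (k%:R * (q.2 * q.1.2)) j m (bessel_scale q.2 k * (q.1.1.1 ^+ 2 + q.1.1.2 ^+ 2))).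
  apply: elem_add; apply: elem_mul; try exact: elementary_kel.
    exact: elementary_cos.
  exact: elementary_sin.
apply: elem_mul; first exact: elem_cst.
by apply: elem_add; exact: elem_mul.
Qed.

Lemma rescaled_cvg :
  {family compact,
    (fun p => rescale omega * rotU omega k (rotation (- (pi / 4)) p.1) p.2)
      @[omega --> (0 : R)^'+] --> (fun p => zpow k p.1)}.
Proof.
apply/fam_cvgP => K Kc U /=; rewrite uniform_nbhs => -[E [+ EU]].
rewrite -entourage_ballE => -[e /= e0 eE].
have main : \forall omega \near (0 : R)^'+, K `<=` [set p | ball (zpow k p.1) e
    (rescale omega * rotU omega k (rotation (- (pi / 4)) p.1) p.2)].
  apply: (compact_near_coveringP K).1 => // p Kp.
  have [df [dfx _]] := elem_diff elementary_ff.
  have cf : {for (p, 0 : R), continuous ff} by exact: df_continuous (dfx _).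
  have [d1 [d1x _]] := elem_diff (elementary_zpow k (@elementary_fst R) (@elementary_snd R)).1.
  have cz : {for p, continuous (fun p => zpow k p.1)}.
    apply: continuous_comp; first exact: cvg_fst.
    exact: df_continuous (d1x _).
  have e2 : 0 < e / 2 by rewrite divr_gt0.
  have [[A B] /= [nA nB] AB] := (cvgrPdist_lt _ _).1 cf _ e2.
  have nC := (cvgrPdist_lt _ _).1 cz _ e2.
  exists (A `&` [set q | `|zpow k p.1 - zpow k q.1| < e / 2], B `&` [set o | 0 < o]) => /=.
    split; first by apply: filterI; [exact: nA | exact: nC].
    by apply: filterI; [exact: cvg_within nB | exact: nbhs_right_gt].
  move=> [q o] /= [[Aq Cq] [Bo o0]].
  rewrite rescaleE // /ball /=.
  have := AB (q, o) (conj Aq Bo); rewrite /= ff0 => h.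
  have -> : zpow k q.1 - ff (q, o) =
    (zpow k p.1 - ff (q, o)) - (zpow k p.1 - zpow k q.1) by ring.
  by apply: (le_lt_trans (ler_normB _ _)); rewrite [X in _ < X](splitr e) ltrD.
apply: filterS main => omega h; apply: EU => p Kp /=; apply: eE => /=.
exact: h.
Qed.

End SmallRotation.

(** * Integration in the plane *)

Section PlaneMeasure.
Context {R : realType}.
Implicit Types (f g : R * R -> R) (x : R * R).

Let mu := (@lebesgue_measure R \x @lebesgue_measure R)%E.
Let T2 := (measurableTypeR R * measurableTypeR R)%type.

Definition box (N : R) : set (R * R) := [set x | `|x.1| <= N /\ `|x.2| <= N].

Lemma boxE N : box N = `[- N, N] `*` `[- N, N].
Proof. by apply/seteqP; split => -[a b]; rewrite /box /= !in_itv /= !ler_norml. Qed.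

Lemma measurable_box N : measurable (box N : set T2).
Proof. by rewrite boxE; apply: measurableX; exact: measurable_itv. Qed.

Lemma box_fin N : (mu (box N) < +oo)%E.
Proof.
have [r hr] : exists r, lebesgue_measure (`[- N, N]%classic : set R) = r%:E.
  rewrite lebesgue_measure_itv /=; case: ifP => _; last by exists 0.
  by exists (N - - N); rewrite EFinB.
rewrite /mu boxE product_measure1E; [|exact: measurable_itv..].
rewrite (_ : (_ * _)%E = (r * r)%:E) ?ltry // EFinM; congr (_ * _)%E; exact: hr.
Qed.

(** Measurability refers to the product structure, so an open set is written as a countable union of
    rational rectangles. *)
Lemma open_measurable2 (A : set (R * R)) : open A -> measurable (A : set T2).
Proof.
move=> oA.
pose B (q : (rat * rat) * (rat * rat)) : set (R * R) :=
  `](ratr q.1.1 : R), ratr q.1.2[ `*` `](ratr q.2.1 : R), ratr q.2.2[.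
have -> : A = \bigcup_(q in [set q | B q `<=` A]) B q.
  apply/seteqP; split => [[a b] Aab|x [q qA qx]]; last exact: qA.
  have [e e0 eA] : exists2 e : R, 0 < e & forall y, `|a - y.1| < e -> `|b - y.2| < e -> A y.
    have := open_nbhs_nbhs (conj oA Aab).
    move=> /nbhs_ballP[e e0 eA]; exists e => // y y1 y2; apply: eA.
    by split.
  have rq (c : R) : exists p q : rat, [/\ c - e < ratr p, ratr p < c, c < ratr q & ratr q < c + e].
    have [|p] := @rat_in_itvoo R (c - e) c; first by rewrite gtrBl.
    rewrite in_itv /= => /andP[p1 p2].
    have [|q] := @rat_in_itvoo R c (c + e); first by rewrite ltrDl.
    rewrite in_itv /= => /andP[q1 q2].
    by exists p, q.
  have [p1 [q1 [h1 h2 h3 h4]]] := rq a; have [p2 [q2 [h5 h6 h7 h8]]] := rq b.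
  exists ((p1, q1), (p2, q2)); last by rewrite /B /= !in_itv /= h2 h3 h6 h7.
  move=> [c d] []; rewrite /= !in_itv /= => /andP[c1 c2] /andP[d1 d2].
  by apply: eA; rewrite /= ltr_distlC; apply/andP; split; lra.
rewrite bigcup_mkcond; apply: countable_bigcupT_measurable => [|q]; first exact: countableP.
by case: ifP => _ //; apply: measurableX; exact: measurable_itv.
Qed.

Lemma continuous_measurable2 f : continuous f -> measurable_fun [set: R * R] f.
Proof.
move=> /continuousP cf; apply: (measurability _ (RGenOpens.measurableE R)).
move=> _ [_ [a [b ->] <-]]; rewrite setTI; apply: open_measurable2.
exact/cf/interval_open.
Qed.

(** Bounded integrands carried by a box: a class stable under sums and under products with locally
    bounded functions, which makes integrability automatic. *)
Definition tame f : Prop := measurable_fun [set: R * R] f /\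
  exists N M, forall x, `|f x| <= M /\ (f x != 0 -> box N x).

Lemma tame_integrable f : tame f -> mu.-integrable setT (EFin \o f).
Proof.
move=> [mf [N [M fNM]]].
have -> : EFin \o f = (EFin \o f) \_ (box N).
  apply/funext => x; rewrite /patch; case: ifPn => // xN /=.
  have [->//|f0] := eqVneq (f x) 0.
  by move/negP: xN; rewrite inE; case; exact: (fNM x).2.
apply/(integrable_mkcond _ (measurable_box N)).
apply: measurable_bounded_integrable; [exact: measurable_box | exact: box_fin | |].
  exact: measurable_funTS.
by exists M; split; rewrite ?num_real // => C MC x _ /=; exact: le_trans (fNM x).1 (ltW MC).
Qed.

End PlaneMeasure.

Section PlaneIntegral.
Context {R : realType}.
Implicit Types (f g h : R * R -> R) (x : R * R).

Definition locally_bounded f : Prop := measurable_fun [set: R * R] f /\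
  forall N, exists M, forall x, box N x -> `|f x| <= M.

Lemma box_compact (N : R) : compact (box N).
Proof. by rewrite boxE; apply: compact_setX; exact: segment_compact. Qed.

Lemma continuous_locally_bounded f : continuous f -> locally_bounded f.
Proof.
move=> cf; split; first exact: continuous_measurable2.
move=> N; have : compact (f @` box N).
  by apply: continuous_compact; [exact: continuous_subspaceT | exact: box_compact].
move=> /compact_bounded[M [_ Mf]]; exists (M + 1) => x xN.
by apply: (Mf (M + 1)); [rewrite ltrDl | exists x].
Qed.

Lemma tame_locally_bounded f : tame f -> locally_bounded f.
Proof. by move=> [mf [N [M fNM]]]; split => // N'; exists M => x _; exact: (fNM x).1. Qed.

Lemma locally_boundedD f g : locally_bounded f -> locally_bounded g ->
  locally_bounded (fun x => f x + g x).
Proof.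
move=> [mf bf] [mg bg]; split; first exact: measurable_funD.
move=> N; have [M1 h1] := bf N; have [M2 h2] := bg N; exists (M1 + M2) => x xN.
by apply: (le_trans (ler_normD _ _)); apply: lerD; [exact: h1 | exact: h2].
Qed.

Lemma locally_boundedM f g : locally_bounded f -> locally_bounded g ->
  locally_bounded (fun x => f x * g x).
Proof.
move=> [mf bf] [mg bg]; split; first exact: measurable_funM.
move=> N; have [M1 h1] := bf N; have [M2 h2] := bg N; exists (M1 * M2) => x xN.
by rewrite normrM; apply: ler_pM => //; [exact: h1 | exact: h2].
Qed.

Lemma locally_bounded_cst (c : R) : locally_bounded (fun=> c).
Proof. by split; [exact: measurable_cst | move=> N; exists `|c|]. Qed.

Lemma locally_boundedN f : locally_bounded f -> locally_bounded (fun x => - f x).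
Proof.
move=> fb; have := locally_boundedM (locally_bounded_cst (-1)) fb.
by rewrite (_ : (fun x => -1 * f x) = fun x => - f x) //; apply/funext => x; rewrite mulN1r.
Qed.

Lemma tameM f g : tame f -> locally_bounded g -> tame (fun x => f x * g x).
Proof.
move=> [mf [N [M fNM]]] [mg bg]; split; first exact: measurable_funM.
have [M' hM'] := bg N; exists N, `|M * M'| => x.
have [->|f0] := eqVneq (f x) 0; first by rewrite mul0r normr0 eqxx.
have xN := (fNM x).2 f0; split; last by [].
rewrite normrM; apply: (le_trans _ (ler_norm _)).
by apply: ler_pM => //; [exact: (fNM x).1 | exact: hM'].
Qed.

Lemma box_le (N N' : R) : N <= N' -> box N `<=` box N'.
Proof. by move=> NN x [h1 h2]; split; exact: le_trans NN. Qed.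

Lemma tameD f g : tame f -> tame g -> tame (fun x => f x + g x).
Proof.
move=> [mf [N1 [M1 h1]]] [mg [N2 [M2 h2]]]; split; first exact: measurable_funD.
exists (Num.max N1 N2), (M1 + M2) => x; split.
  by apply: (le_trans (ler_normD _ _)); apply: lerD; [exact: (h1 x).1 | exact: (h2 x).1].
have [f0|f0] := eqVneq (f x) 0.
  rewrite f0 add0r => g0; apply: box_le ((h2 x).2 g0); rewrite le_max lexx orbT //.
by move=> _; apply: box_le ((h1 x).2 f0); rewrite le_max lexx.
Qed.

Lemma tameZ (c : R) f : tame f -> tame (fun x => c * f x).
Proof.
move=> tf; have := tameM tf (locally_bounded_cst c).
by rewrite (_ : (fun x => f x * c) = fun x => c * f x) //; apply/funext => x; rewrite mulrC.
Qed.

Lemma tame_eq f g : f =1 g -> tame f -> tame g.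
Proof. by move=> /funext ->. Qed.

Lemma tameMl f g : tame f -> locally_bounded g -> tame (fun x => g x * f x).
Proof. by move=> tf lg; apply: tame_eq (tameM tf lg) => x; exact: mulrC. Qed.

Lemma int_eq f g : f =1 g -> \int[leb2]_x f x = \int[leb2]_x g x.
Proof. by move=> /funext ->. Qed.

Lemma intD f g : tame f -> tame g ->
  \int[leb2]_x (f x + g x) = \int[leb2]_x f x + \int[leb2]_x g x.
Proof.
move=> tf tg; exact: (RintegralD measurableT (tame_integrable tf) (tame_integrable tg)).
Qed.

Lemma intZ (c : R) f : tame f -> \int[leb2]_x (c * f x) = c * \int[leb2]_x f x.
Proof. by move=> tf; exact: (RintegralZl c measurableT (tame_integrable tf)). Qed.

Lemma int_ge0 f : (forall x, 0 <= f x) -> 0 <= \int[leb2]_x f x.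
Proof. by move=> f0; apply: Rintegral_ge0. Qed.

Lemma int_cvg (F : nat -> R * R -> R) f (N M : R) :
  (forall n, measurable_fun [set: R * R] (F n)) -> measurable_fun [set: R * R] f ->
  (forall n x, `|F n x| <= M /\ (F n x != 0 -> box N x)) ->
  (forall x, F n x @[n --> \oo] --> f x) ->
  \int[leb2]_x F n x @[n --> \oo] --> \int[leb2]_x f x.
Proof.
move=> mF mf bF Ff.
have M0 : 0 <= M by exact: le_trans (bF 0%N (0, 0)).1.
have tg : tame (fun x => M * \1_(box N) x).
  split; first by apply: measurable_funM => //; apply: measurable_indic; exact: measurable_box.
  exists N, M => x; rewrite indicE; case: (boolP (x \in box N)); rewrite ?inE => xN /=.
    by split => //; rewrite mulr1 ger0_norm.
  by rewrite mulr0 normr0; split => //; rewrite eqxx.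
have [] := @dominated_convergence _ _ _ (@lebesgue_measure R \x @lebesgue_measure R)%E setT
   measurableT (fun n => EFin \o F n) (EFin \o f) (EFin \o (fun x => M * \1_(box N) x)).
- by move=> n; apply/measurable_EFinP; exact: mF.
- exact/measurable_EFinP.
- by apply: aeW => x _; apply: cvg_comp (Ff x) _; exact: cvg_id.
- exact: tame_integrable.
- apply: aeW => x n _ /=; rewrite lee_fin indicE.
  case: (boolP (x \in box N)); rewrite ?inE => xN /=; first by rewrite mulr1; exact: (bF n x).1.
  have [->|f0] := eqVneq (F n x) 0; first by rewrite normr0 mulr0.
  by move/negP : xN; rewrite inE; case; exact: (bF n x).2.
move=> fi _ cv; apply: fine_cvg.
rewrite fineK; first exact: cv.
exact: integrable_fin_num.
Qed.

Lemma is_derive_off_itv (F F1 : R -> R) (N : R) :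
  (forall a : R, is_derive a 1 F (F1 a)) -> continuous F1 -> 0 <= N ->
  (forall a, N < `|a| -> F a = 0 /\ F1 a = 0) ->
  (\int[lebesgue_measure]_a (F1 a)%:E)%E = 0%E.
Proof.
move=> dF cF1 N0 F0; pose L : R := N + 1.
have L0 : - L < L by rewrite /L; lra.
have F0' a : L <= `|a| -> F a = 0 /\ F1 a = 0.
  by move=> La; apply: F0; apply: lt_le_trans La; rewrite ltrDl.
transitivity (\int[lebesgue_measure]_(a in `[(- L)%R, L]) (F1 a)%:E)%E.
  rewrite [RHS]integral_mkcond; apply: eq_integral => a _; rewrite /patch.
  case: ifPn => // /negP; rewrite inE /= in_itv /= -ler_norml => /negP; rewrite -ltNge => La.
  by rewrite (F0' a (ltW La)).2.
have cF : continuous F by move=> a; exact: dv_continuous (dF a).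
rewrite (@continuous_FTC2 _ F1 F).
- have Lp : 0 <= L by rewrite addr_ge0.
  by rewrite (F0' L _).1 ?(F0' (- L) _).1 ?normrN ?ger0_norm ?subee.
- exact: L0.
- exact: continuous_subspaceT.
- split; first by move=> a _; exact: ex_derive.
    by apply: cvg_at_right_filter; exact: cF.
  by apply: cvg_at_left_filter; exact: cF.
- by move=> a _; rewrite derive1E; exact: derive_val.
Qed.

Lemma tame_continuous f N : continuous f -> (forall x, ~ box N x -> f x = 0) -> tame f.
Proof.
move=> cf f0; have [mf bf] := continuous_locally_bounded cf.
split => //; have [M hM] := bf N; exists N, `|M| => x.
have [e|fx] := eqVneq (f x) 0.
  by rewrite e normr0; split => // /negP; rewrite eqxx.
have xN : box N x by apply: contrapT => /f0 e; rewrite e eqxx in fx.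
by split => // ; apply: (le_trans (hM x xN)); exact: ler_norm.
Qed.

Lemma int_derive1_eq0 f f1 N : 0 <= N ->
  (forall a b : R, is_derive a 1 (fun s => f (s, b)) (f1 (a, b))) -> continuous f1 ->
  (forall x, ~ box N x -> f x = 0 /\ f1 x = 0) -> \int[leb2]_x f1 x = 0.
Proof.
move=> N0 df cf1 f0.
have t1 : tame f1 by apply: (@tame_continuous _ N) => // x /f0[].
rewrite /Rintegral /leb2 -(integral21_prod_meas1 (tame_integrable t1)).
rewrite integral0_eq // => b _; rewrite /fubini_G /=.
apply: (@is_derive_off_itv (fun a => f (a, b)) (fun a => f1 (a, b)) N) => //.
- move=> a; apply: (@continuous_comp _ _ _ (fun a => (a, b)) f1); last exact: cf1.
  have c1 : {for a, continuous (fun a : R => a)} by exact: cvg_id.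
  have c2 : {for a, continuous (fun a : R => b)} by exact: cvg_cst.
  exact: (cvg_pair c1 c2).
- move=> a Na; apply: f0 => -[/= h _]; by move: (lt_le_trans Na h); rewrite ltxx.
Qed.

Lemma int_derive2_eq0 f f2 N : 0 <= N ->
  (forall a b : R, is_derive b 1 (fun s => f (a, s)) (f2 (a, b))) -> continuous f2 ->
  (forall x, ~ box N x -> f x = 0 /\ f2 x = 0) -> \int[leb2]_x f2 x = 0.
Proof.
move=> N0 df cf2 f0.
have t2 : tame f2 by apply: (@tame_continuous _ N) => // x /f0[].
rewrite /Rintegral /leb2 -(integral12_prod_meas1 (tame_integrable t2)).
rewrite integral0_eq // => a _; rewrite /fubini_F /=.
apply: (@is_derive_off_itv (fun b => f (a, b)) (fun b => f2 (a, b)) N) => //.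
- move=> b; apply: (@continuous_comp _ _ _ (fun b => (a, b)) f2); last exact: cf2.
  have c1 : {for b, continuous (fun b : R => b)} by exact: cvg_id.
  have c2 : {for b, continuous (fun b : R => a)} by exact: cvg_cst.
  exact: (cvg_pair c2 c1).
- move=> b Nb; apply: f0 => -[/= _ h]; by move: (lt_le_trans Nb h); rewrite ltxx.
Qed.

End PlaneIntegral.

(** * Once differentiable cutoffs *)

Section SmoothStep.
Context {R : realType}.
Implicit Types (s t : R).

Definition pospart t : R := (t + `|t|) / 2.

Lemma pospart_ge t : 0 <= t -> pospart t = t.
Proof. by move=> t0; rewrite /pospart ger0_norm //; field. Qed.

Lemma pospart_le t : t <= 0 -> pospart t = 0.
Proof. by move=> t0; rewrite /pospart ler0_norm // subrr mul0r. Qed.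

Lemma continuous_pospart : continuous pospart.
Proof.
move=> t; apply: cvgMr_tmp; apply: cvgD; first exact: cvg_id.
exact: norm_continuous.
Qed.

Lemma dv_sqpos t : is_derive t 1 (fun t => pospart t ^+ 2) (2 * pospart t).
Proof.
have [t0|t0|->] := ltgtP t 0.
- rewrite pospart_le ?ltW // mulr0; apply: near_eq_is_derive (dvC 0 t).
  near=> y; rewrite pospart_le ?expr0n //.
  by apply/ltW; near: y; exact: lt_nbhsl.
- have h : is_derive t 1 (fun y => y ^+ 2) (2 * t).
    by eapply dv_eq; [dv | rewrite /= expr1 mulr1].
  rewrite pospart_ge ?ltW //; apply: near_eq_is_derive h.
  near=> y; rewrite pospart_ge //.
  by apply/ltW; near: y; exact: lt_nbhsr.
(* At 0 the slope function is [pospart] itself, its square at z being z times its value. *)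
- rewrite pospart_ge // mulr0; apply/is_derive1_caratheodory; exists pospart; split.
  + move=> z; rewrite subr0 (pospart_ge (lexx 0)) expr0n subr0 expr2.
    by have [/pospart_ge->//|/ltW/pospart_le->] := leP 0 z; rewrite !mul0r.
  + exact: continuous_pospart.
  + exact: pospart_ge.
Unshelve. all: by end_near. Qed.

(* A nondecreasing C1 step from 0 on [s <= 0] to 1 on [1 <= s]. *)
Definition step s : R := 1 - pospart (1 - pospart s ^+ 2) ^+ 2.
Definition dstep s : R := 4 * pospart (1 - pospart s ^+ 2) * pospart s.

Lemma dv_step s : is_derive s 1 step (dstep s).
Proof.
have h := dv_sqpos s.
have dq : is_derive s 1 (fun s => 1 - pospart s ^+ 2) (0 - 2 * pospart s).
  exact: dvD (dvC _ _) (dvN h).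
have := @dv_comp _ (fun t => pospart t ^+ 2) (fun s => 1 - pospart s ^+ 2) s _ _
  (dv_sqpos (1 - pospart s ^+ 2)) dq.
move=> hh; have := dvD (dvC 1 s) (dvN hh).
by move=> /dv_eq; apply; rewrite /dstep; ring.
Qed.

Lemma continuous_dstep : continuous dstep.
Proof.
move=> s; apply: cvgM; last exact: continuous_pospart.
apply: cvgMl_tmp.
apply: (@continuous_comp _ _ _ (fun s => 1 - pospart s ^+ 2) pospart); last exact: continuous_pospart.
apply: cvgB; first exact: cvg_cst.
by have := dv_continuous (dv_sqpos s).
Qed.

Lemma step_le0 s : s <= 0 -> step s = 0 /\ dstep s = 0.
Proof.
move=> s0; rewrite /step /dstep (pospart_le s0) expr0n subr0 mulr0.
by rewrite pospart_ge // expr1n subrr.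
Qed.

Lemma step_ge1 s : 1 <= s -> step s = 1 /\ dstep s = 0.
Proof.
move=> s1; rewrite /step /dstep (pospart_ge (le_trans ler01 s1)).
have h : 1 - s ^+ 2 <= 0 by rewrite subr_le0 -[leLHS]mulr1 ler_pM.
by rewrite (pospart_le h) expr0n subr0 mulr0 mul0r.
Qed.

Lemma step_bounds s : 0 <= step s <= 1.
Proof.
have [s0|s0] := leP s 0; first by rewrite (step_le0 s0).1 lexx ler01.
have [s1|s1] := leP 1 s; first by rewrite (step_ge1 s1).1 lexx ler01.
rewrite /step (pospart_ge (ltW s0)) pospart_ge; last first.
  by rewrite subr_ge0 exprn_ile1 ?ltW.
have h : 0 <= s ^+ 2 <= 1 by rewrite sqr_ge0 /= exprn_ile1 ?ltW.
by move: h => /andP[h1 h2]; apply/andP; split; nra.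
Qed.

Lemma dstep_bounds s : 0 <= dstep s <= 4.
Proof.
have [s0|s0] := leP s 0; first by rewrite (step_le0 s0).2 lexx ler0n.
have [s1|s1] := leP 1 s; first by rewrite (step_ge1 s1).2 lexx ler0n.
have h : 0 <= s ^+ 2 <= 1 by rewrite sqr_ge0 /= exprn_ile1 ?ltW.
move: h => /andP[h1 h2].
rewrite /dstep (pospart_ge (ltW s0)) pospart_ge ?subr_ge0 //.
have h3 : 0 <= 1 - s ^+ 2 by rewrite subr_ge0.
have a0 : 0 <= (1 - s ^+ 2) * s by apply: mulr_ge0 => //; exact: ltW.
have a1 : (1 - s ^+ 2) * s <= 1.
  by apply: mulr_ile1 => //; [exact: ltW | rewrite lerBlDr lerDl | exact: ltW].
by rewrite -mulrA; apply/andP; split; lra.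
Qed.

(* A step in [s ^ 2], supported in [1 / n <= s ^ 2] and equal to 1 for [2 / n <= s ^ 2]. *)
Definition cut (n : nat) s : R := step (n%:R * s ^+ 2 - 1).
Definition dcut (n : nat) s : R := dstep (n%:R * s ^+ 2 - 1) * (2 * n%:R * s).

Lemma dv_cut n s : is_derive s 1 (cut n) (dcut n s).
Proof.
have h : is_derive s 1 (fun s => n%:R * s ^+ 2 - 1) (2 * n%:R * s).
  by eapply dv_eq; [dv | rewrite /=; ring].
exact: (@dv_comp _ step (fun s => n%:R * s ^+ 2 - 1) s _ _ (dv_step _) h).
Qed.

Lemma continuous_dcut n : continuous (dcut n).
Proof.
move=> s; have h : is_derive s 1 (fun s => n%:R * s ^+ 2 - 1) (2 * n%:R * s).
  by eapply dv_eq; [dv | rewrite /=; ring].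
apply: cvgM; last by apply: cvgMl_tmp; exact: cvg_id.
apply: (@continuous_comp _ _ _ (fun s => n%:R * s ^+ 2 - 1) dstep); first exact: dv_continuous h.
exact: continuous_dstep.
Qed.

Lemma cut_near0 n s : n%:R * s ^+ 2 <= 1 -> cut n s = 0 /\ dcut n s = 0.
Proof.
move=> h; rewrite /cut /dcut; have := @step_le0 (n%:R * s ^+ 2 - 1).
by rewrite subr_le0 => /(_ h)[-> ->]; rewrite mul0r.
Qed.

Lemma cut_far n s : 2 <= n%:R * s ^+ 2 -> cut n s = 1 /\ dcut n s = 0.
Proof.
move=> h; rewrite /cut /dcut; have := @step_ge1 (n%:R * s ^+ 2 - 1).
have -> : 1 <= n%:R * s ^+ 2 - 1 by lra.
by move=> /(_ isT)[-> ->]; rewrite mul0r.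
Qed.

Lemma cut_bounds n s : `|cut n s| <= 1.
Proof. by have /andP[h1 h2] := step_bounds (n%:R * s ^+ 2 - 1); rewrite ger0_norm. Qed.

(** The support of [dstep] imposes n s^2 <= 2, so the bound 16 = 4 * (2 * 2) is uniform in n: the
    slope of the cutoff grows no faster than 1 / s. *)
Lemma dcut_bounds n s : 0 <= dcut n s * s <= 16.
Proof.
have [h|h] := leP 2 (n%:R * s ^+ 2).
  by rewrite (cut_far h).2 mul0r lexx ler0n.
have /andP[d0 d4] := dstep_bounds (n%:R * s ^+ 2 - 1).
rewrite /dcut.
have -> : dstep (n%:R * s ^+ 2 - 1) * (2 * n%:R * s) * s =
    dstep (n%:R * s ^+ 2 - 1) * (2 * (n%:R * s ^+ 2)) by ring.
have ns0 : 0 <= n%:R * s ^+ 2 by rewrite mulr_ge0 // sqr_ge0.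
apply/andP; split; first by rewrite mulr_ge0 // mulr_ge0.
have -> : 16 = 4 * (2 * 2) :> R by ring.
by apply: ler_pM => //; [exact: mulr_ge0 | rewrite ler_wpM2l // ltW].
Qed.

Lemma cut_eventually s : s != 0 ->
  \forall n \near \oo, cut n s = 1 /\ dcut n s = 0.
Proof.
move=> s0; have s2 : 0 < s ^+ 2 by rewrite lt0r sqrf_eq0 s0 sqr_ge0.
near=> n; apply: cut_far; rewrite -ler_pdivrMr //.
by near: n; exact: nbhs_infty_ger.
Unshelve. all: by end_near. Qed.

Lemma cut0 n : cut n 0 = 0 /\ dcut n 0 = 0.
Proof. by apply: cut_near0; rewrite expr0n mulr0 ler01. Qed.

End SmoothStep.

Section PlaneC1.
Context {R : realType}.
Implicit Types (f g : R * R -> R) (x : R * R) (a b : R) (N : R).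

(** The cutoffs are only once differentiable, which calls for a class wider than [smooth];
    derivatives along lines are what Fubini and the fundamental theorem of calculus act on. *)
Definition C1 f f1 f2 : Prop := [/\ continuous f, continuous f1, continuous f2,
  (forall a b : R, is_derive a 1 (fun s => f (s, b)) (f1 (a, b))) &
  (forall a b : R, is_derive b 1 (fun s => f (a, s)) (f2 (a, b)))].

Lemma slice1 a b : {for a, continuous (fun s : R => (s, b))}.
Proof.
have c1 : {for a, continuous (fun a : R => a)} by exact: cvg_id.
have c2 : {for a, continuous (fun a : R => b)} by exact: cvg_cst.
exact: (cvg_pair c1 c2).
Qed.

Lemma slice2 a b : {for b, continuous (fun s : R => (a, s))}.
Proof.
have c1 : {for b, continuous (fun a : R => a)} by exact: cvg_id.
have c2 : {for b, continuous (fun b : R => a)} by exact: cvg_cst.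
exact: (cvg_pair c2 c1).
Qed.

Lemma C1_cst (c : R) : C1 (fun=> c) (fun=> 0) (fun=> 0).
Proof. by split; (try exact: cst_continuous) => a b; exact: dvC. Qed.

Lemma continuousD2 f g : continuous f -> continuous g -> continuous (fun x => f x + g x).
Proof. by move=> cf cg x; apply: cvgD; [exact: cf | exact: cg]. Qed.

Lemma continuousM2 f g : continuous f -> continuous g -> continuous (fun x => f x * g x).
Proof. by move=> cf cg x; apply: cvgM; [exact: cf | exact: cg]. Qed.

Lemma continuous_comp2 f (h : R -> R) : continuous f -> continuous h ->
  continuous (fun x => h (f x)).
Proof. by move=> cf ch x; apply: (@continuous_comp _ _ _ f h); [exact: cf | exact: ch]. Qed.

Lemma C1D f f1 f2 g g1 g2 : C1 f f1 f2 -> C1 g g1 g2 ->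
  C1 (fun x => f x + g x) (fun x => f1 x + g1 x) (fun x => f2 x + g2 x).
Proof.
move=> [cf cf1 cf2 df1 df2] [cg cg1 cg2 dg1 dg2]; split; try exact: continuousD2.
  by move=> a b; exact: dvD (df1 a b) (dg1 a b).
by move=> a b; exact: dvD (df2 a b) (dg2 a b).
Qed.

Lemma C1M f f1 f2 g g1 g2 : C1 f f1 f2 -> C1 g g1 g2 ->
  C1 (fun x => f x * g x) (fun x => f1 x * g x + f x * g1 x)
     (fun x => f2 x * g x + f x * g2 x).
Proof.
move=> [cf cf1 cf2 df1 df2] [cg cg1 cg2 dg1 dg2]; split.
- exact: continuousM2.
- by apply: continuousD2; exact: continuousM2.
- by apply: continuousD2; exact: continuousM2.
- by move=> a b; exact: dvM (df1 a b) (dg1 a b).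
- by move=> a b; exact: dvM (df2 a b) (dg2 a b).
Qed.

Lemma C1_comp f f1 f2 (h h' : R -> R) : C1 f f1 f2 ->
  (forall s : R, is_derive s 1 h (h' s)) -> continuous h' ->
  C1 (fun x => h (f x)) (fun x => h' (f x) * f1 x) (fun x => h' (f x) * f2 x).
Proof.
move=> [cf cf1 cf2 df1 df2] dh ch.
have ch0 : continuous h by move=> s; exact: dv_continuous (dh s).
split.
- exact: continuous_comp2.
- by apply: continuousM2 => //; exact: continuous_comp2.
- by apply: continuousM2 => //; exact: continuous_comp2.
- by move=> a b; exact: (@dv_comp _ h (fun s => f (s, b)) a _ _ (dh _) (df1 a b)).
- by move=> a b; exact: (@dv_comp _ h (fun s => f (a, s)) b _ _ (dh _) (df2 a b)).
Qed.

Lemma continuous_local f : (forall x, exists2 g, continuous g & \near x, f x = g x) ->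
  continuous f.
Proof.
move=> H x; have [g cg fg] := H x; rewrite /continuous_at (nbhs_singleton fg).
apply: cvg_trans (cg x); apply: near_eq_cvg.
by apply: filterS fg => y ->.
Qed.

Lemma C1_local f f1 f2 : (forall x, exists g g1 g2, C1 g g1 g2 /\
    \forall y \near x, [/\ f y = g y, f1 y = g1 y & f2 y = g2 y]) -> C1 f f1 f2.
Proof.
move=> H; split.
- apply: continuous_local => x; have [g [g1 [g2 [[cg _ _ _ _] h]]]] := H x.
  by exists g => //; apply: filterS h => y [].
- apply: continuous_local => x; have [g [g1 [g2 [[_ cg _ _ _] h]]]] := H x.
  by exists g1 => //; apply: filterS h => y [].
- apply: continuous_local => x; have [g [g1 [g2 [[_ _ cg _ _] h]]]] := H x.
  by exists g2 => //; apply: filterS h => y [].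
- move=> a b; have [g [g1 [g2 [[_ _ _ dg _] h]]]] := H (a, b).
  have [_ -> _] := nbhs_singleton h.
  have e : \forall s \near a, g (s, b) = f (s, b).
    have hh : \forall s \near a, [/\ f (s, b) = g (s, b), f1 (s, b) = g1 (s, b) & f2 (s, b) = g2 (s, b)].
      exact: (@slice1 a b _ h).
    by apply: filterS hh => s [].
  exact: near_eq_is_derive e (dg a b).
- move=> a b; have [g [g1 [g2 [[_ _ _ _ dg] h]]]] := H (a, b).
  have [_ _ ->] := nbhs_singleton h.
  have e : \forall s \near b, g (a, s) = f (a, s).
    have hh : \forall s \near b, [/\ f (a, s) = g (a, s), f1 (a, s) = g1 (a, s) & f2 (a, s) = g2 (a, s)].
      exact: (@slice2 a b _ h).
    by apply: filterS hh => s [].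
  exact: near_eq_is_derive e (dg a b).
Qed.

Lemma C1_eq f f1 f2 g g1 g2 : f =1 g -> f1 =1 g1 -> f2 =1 g2 -> C1 f f1 f2 -> C1 g g1 g2.
Proof. by move=> /funext -> /funext -> /funext ->. Qed.

Lemma C1_of_derive f f1 f2 : (forall x, differentiable f x) ->
  (forall x, 'D_e1 f x = f1 x) -> (forall x, 'D_e2 f x = f2 x) ->
  continuous f1 -> continuous f2 -> C1 f f1 f2.
Proof.
move=> df d1 d2 c1 c2; split => //.
- by move=> x; exact: differentiable_continuous.
- move=> a b; have h1 : derivable f (a, b) e1 by exact: diff_derivable.
  have h2 := d1 (a, b); rewrite /derive /derivable in h1 h2.
  have e : (fun h : R => h^-1 *: (f (h *: (e1 : R * R) + (a, b)) - f (a, b))) =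
     (fun h : R => h^-1 *: (f (h *: (1 : R) + a, b) - f (a, b))).
    apply/funext => h; congr (_ *: (f _ - _)).
    by rewrite /e1; congr pair; rewrite /= scaler0 add0r.
  by rewrite e in h1 h2; apply: DeriveDef; [exact: h1 | exact: h2].
- move=> a b; have h1 : derivable f (a, b) e2 by exact: diff_derivable.
  have h2 := d2 (a, b); rewrite /derive /derivable in h1 h2.
  have e : (fun h : R => h^-1 *: (f (h *: (e2 : R * R) + (a, b)) - f (a, b))) =
     (fun h : R => h^-1 *: (f (a, h *: (1 : R) + b) - f (a, b))).
    apply/funext => h; congr (_ *: (f _ - _)).
    by rewrite /e2; congr pair; rewrite /= scaler0 add0r.
  by rewrite e in h1 h2; apply: DeriveDef; [exact: h1 | exact: h2].
Qed.

Definition C1c f f1 f2 : Prop := C1 f f1 f2 /\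
  exists2 N : R, 0 <= N & forall x, ~ box N x -> [/\ f x = 0, f1 x = 0 & f2 x = 0].

Lemma C1cM f f1 f2 g g1 g2 : C1 f f1 f2 -> C1c g g1 g2 ->
  C1c (fun x => f x * g x) (fun x => f1 x * g x + f x * g1 x)
      (fun x => f2 x * g x + f x * g2 x).
Proof.
move=> cf [cg [N N0 gN]]; split; first exact: C1M.
by exists N => // x /gN[-> -> ->]; rewrite !mulr0 addr0.
Qed.

Lemma C1c_tame f f1 f2 : C1c f f1 f2 -> [/\ tame f, tame f1 & tame f2].
Proof.
move=> [[cf cf1 cf2 _ _] [N N0 fN]].
by split; apply: (@tame_continuous _ _ N) => // x /fN[].
Qed.

Lemma int_C1c f f1 f2 : C1c f f1 f2 ->
  \int[leb2]_x f1 x = 0 /\ \int[leb2]_x f2 x = 0.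
Proof.
move=> [[cf cf1 cf2 df1 df2] [N N0 fN]]; split.
  by apply: (@int_derive1_eq0 _ f f1 N) => // x /fN[].
by apply: (@int_derive2_eq0 _ f f2 N) => // x /fN[].
Qed.

Lemma C1_locally_bounded f f1 f2 : C1 f f1 f2 ->
  [/\ locally_bounded f, locally_bounded f1 & locally_bounded f2].
Proof. by move=> [cf cf1 cf2 _ _]; split; exact: continuous_locally_bounded. Qed.

Lemma int_by_parts f f1 f2 g g1 g2 : C1 f f1 f2 -> C1c g g1 g2 ->
  (\int[leb2]_x (f x * g1 x) = - (\int[leb2]_x (f1 x * g x))) /\
  (\int[leb2]_x (f x * g2 x) = - (\int[leb2]_x (f2 x * g x))).
Proof.
move=> cf cg; have [h1 h2] := int_C1c (C1cM cf cg).
have [bf bf1 bf2] := C1_locally_bounded cf.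
have [tg tg1 tg2] := C1c_tame cg.
rewrite intD in h1; [|exact: tameMl..]; rewrite intD in h2; [|exact: tameMl..].
by split; apply/eqP; rewrite -addr_eq0 addrC ?h1 ?h2.
Qed.

End PlaneC1.

Lemma cvgn_unique {R : realType} (f : nat -> R) (a b : R) :
  f n @[n --> \oo] --> a -> f n @[n --> \oo] --> b -> a = b.
Proof. by move=> /(cvg_lim (@Rhausdorff R)) <- /(cvg_lim (@Rhausdorff R)) <-. Qed.

(** * Solutions weighted by locally constant functions *)

Section NodalWeights.
Context {R : realType}.
Variables (U U1 U2 : R * R -> R).
Hypothesis CU : C1 U U1 U2.
Implicit Types (D T phi : R * R -> R) (x : R * R).

(** The model case is the sign of U on one nodal region and 0 elsewhere, for which D U is |U| on
    that region; linear combinations give the functions [hat]. *)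
Definition nodal_weight D : Prop :=
  [/\ forall x, U x = 0 -> D x = 0,
      forall x, U x != 0 -> \forall y \near x, D y = D x &
      exists M, forall x, `|D x| <= M].

Let cU : continuous U. Proof. by case: CU. Qed.

(** D can jump only where U = 0, and the cutoff of U vanishes in a neighbourhood of such points. *)
Lemma cut_weight_C1 D n : nodal_weight D ->
  C1 (fun x => D x * cut n (U x)) (fun x => D x * (dcut n (U x) * U1 x))
     (fun x => D x * (dcut n (U x) * U2 x)).
Proof.
move=> [D0 Dloc _]; apply: C1_local => x.
have [Ux|Ux] := eqVneq (U x) 0.
  exists (fun=> 0), (fun=> 0), (fun=> 0); split; first exact: C1_cst.
  have c : {for x, continuous (fun y => n%:R * U y ^+ 2)}.
    apply: cvgMl_tmp; apply: (@continuous_comp _ _ _ U (fun s => s ^+ 2)); first exact: cU.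
    exact: exprn_continuous.
  have : \forall y \near x, n%:R * U y ^+ 2 < 1.
    by apply: (cvgr_lt _ c); rewrite Ux expr0n mulr0 ltr01.
  apply: filterS => y /ltW/cut_near0[-> ->].
  by rewrite !mul0r !mulr0.
exists (fun y => D x * cut n (U y)), (fun y => 0 * cut n (U y) + D x * (dcut n (U y) * U1 y)),
  (fun y => 0 * cut n (U y) + D x * (dcut n (U y) * U2 y)); split.
  apply: (@C1M _ (fun=> D x) (fun=> 0) (fun=> 0) (fun y => cut n (U y))).
    exact: C1_cst.
  by apply: C1_comp CU _ _; [exact: dv_cut | exact: continuous_dcut].
by apply: filterS (Dloc x Ux) => y ->; rewrite !mul0r !add0r.
Qed.

Lemma cut_weight_cvg D x : nodal_weight D -> D x * cut n (U x) @[n --> \oo] --> D x.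
Proof.
move=> [D0 _ _]; have [Ux|Ux] := eqVneq (U x) 0.
  by rewrite (D0 x Ux); under eq_fun do rewrite mul0r; exact: cvg_cst.
apply: cvg_near_cst; near=> n.
suff -> : cut n (U x) = 1 by rewrite mulr1.
by near: n; apply: filterS (cut_eventually Ux) => n [].
Unshelve. all: by end_near. Qed.

(** Measurability comes from D being the pointwise limit of the continuous functions of
    [cut_weight_C1]. *)
Lemma nodal_weight_bounded D : nodal_weight D -> locally_bounded D.
Proof.
move=> wD; split; last by case: wD => _ _ [M DM] N; exists M => x _; exact: DM.
apply: (@measurable_fun_cvg _ _ _ setT (fun n x => D x * cut n (U x))) => //.
  by move=> n; case: (cut_weight_C1 n wD) => c _ _ _ _; exact: continuous_measurable2.
by move=> x _; exact: cut_weight_cvg.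
Qed.

Lemma int_cvgM (A : nat -> R * R -> R) a T (M : R) : tame T ->
  (forall n, locally_bounded (A n)) -> locally_bounded a ->
  (forall n x, `|A n x| <= M) ->
  (forall x, A n x @[n --> \oo] --> a x) ->
  \int[leb2]_x (A n x * T x) @[n --> \oo] --> \int[leb2]_x (a x * T x).
Proof.
move=> tT lA la AM cA; have [mT [N [B hB]]] := tT.
apply: (@int_cvg _ _ _ N (M * B)).
- by move=> n; exact: (tameMl tT (lA n)).1.
- exact: (tameMl tT la).1.
- move=> n x; split.
    by rewrite normrM; apply: ler_pM => //; exact: (hB x).1.
  by rewrite mulf_eq0 negb_or => /andP[_ /(hB x).2].
- by move=> x; apply: cvgMr_tmp; exact: cA.
Qed.

Lemma int_cut_weight_cvg D T : nodal_weight D -> tame T ->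
  \int[leb2]_x (D x * cut n (U x) * T x) @[n --> \oo] --> \int[leb2]_x (D x * T x).
Proof.
move=> wD tT; have [_ _ [M DM]] := wD; apply: (@int_cvgM _ _ _ M) => //.
- by move=> n; case: (C1_locally_bounded (cut_weight_C1 n wD)).
- exact: nodal_weight_bounded.
- move=> n x; rewrite normrM -[leRHS]mulr1; apply: ler_pM => //; exact: cut_bounds.
- by move=> x; exact: cut_weight_cvg.
Qed.

(** The integrand is uniformly bounded by [dcut_bounds] and eventually 0 at every point. It is the
    error made by the cutoff in an integration by parts. *)
Lemma int_dcut_weight_cvg D T : nodal_weight D -> tame T ->
  \int[leb2]_x (D x * (dcut n (U x) * U x) * T x) @[n --> \oo] --> (0 : R).
Proof.
move=> wD tT; have [_ _ [M DM]] := wD.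
have lU : locally_bounded U by case: (C1_locally_bounded CU).
have M0 : 0 <= M by exact: le_trans (DM (0, 0)).
have -> : (0 : R) = \int[leb2]_x (0 * T x).
  by rewrite (intZ 0 tT) mul0r.
apply: (@int_cvgM _ (fun=> 0) _ (M * 16)) => //.
- move=> n; apply: locally_boundedM; first exact: nodal_weight_bounded.
  apply: locally_boundedM => //; apply: continuous_locally_bounded.
  by apply: continuous_comp2 => //; exact: continuous_dcut.
- exact: locally_bounded_cst.
- move=> n x; rewrite normrM; apply: ler_pM => //.
  by have /andP[h1 h2] := dcut_bounds n (U x); rewrite ger0_norm.
- move=> x; have [Ux|Ux] := eqVneq (U x) 0.
    by rewrite Ux; under eq_fun do rewrite !mulr0; exact: cvg_cst.
  apply: cvg_near_cst; near=> n.
  suff -> : dcut n (U x) = 0 by rewrite mul0r mulr0.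
  by near: n; apply: filterS (cut_eventually Ux) => n [].
Unshelve. all: by end_near. Qed.

(** The jumps of D occur where U vanishes and leave no trace in the first derivatives of D U:
    integrate by parts with the cutoff, then let n tend to infinity. *)
Lemma weighted_by_parts D phi phi1 phi2 : nodal_weight D -> C1c phi phi1 phi2 ->
  (\int[leb2]_x (D x * U x * phi1 x) = - (\int[leb2]_x (D x * U1 x * phi x))) /\
  (\int[leb2]_x (D x * U x * phi2 x) = - (\int[leb2]_x (D x * U2 x * phi x))).
Proof.
move=> wD cphi; have [tp tp1 tp2] := C1c_tame cphi.
have [lU lU1 lU2] := C1_locally_bounded CU.
have core V psi : tame psi -> locally_bounded V ->
   (forall n, \int[leb2]_x (D x * cut n (U x) * U x * psi x) =
     - (\int[leb2]_x ((D x * (dcut n (U x) * V x) * U x + D x * cut n (U x) * V x) * phi x))) ->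
   \int[leb2]_x (D x * U x * psi x) = - (\int[leb2]_x (D x * V x * phi x)).
  move=> tpsi lV E.
  have t1 : tame (fun x => U x * psi x) by exact: tameMl.
  have t2 : tame (fun x => V x * phi x) by exact: tameMl.
  have lim1 := int_cut_weight_cvg wD t1.
  have lim2 := int_cut_weight_cvg wD t2.
  have lim3 := int_dcut_weight_cvg wD t2.
  have E' n : \int[leb2]_x (D x * cut n (U x) * (U x * psi x)) =
    - (\int[leb2]_x (D x * (dcut n (U x) * U x) * (V x * phi x)) +
       \int[leb2]_x (D x * cut n (U x) * (V x * phi x))).
    rewrite -intD.
    - rewrite -(int_eq (f := fun x => D x * cut n (U x) * U x * psi x)) ?E; last first.
        by move=> x; rewrite mulrA.
      by congr (- _); apply: int_eq => x; ring.
    - apply: tameMl => //; apply: locally_boundedM; first exact: nodal_weight_bounded.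
      apply: locally_boundedM => //; apply: continuous_locally_bounded.
      by apply: continuous_comp2 => //; exact: continuous_dcut.
    - by apply: tameMl => //; case: (C1_locally_bounded (cut_weight_C1 n wD)).
  have lim4 : - (\int[leb2]_x (D x * (dcut n (U x) * U x) * (V x * phi x)) +
       \int[leb2]_x (D x * cut n (U x) * (V x * phi x))) @[n --> \oo] -->
     - (0 + \int[leb2]_x (D x * (V x * phi x))).
    by apply: cvgN; apply: cvgD.
  rewrite add0r in lim4.
  have e1 : \int[leb2]_x (D x * U x * psi x) = \int[leb2]_x (D x * (U x * psi x)).
    by apply: int_eq => x; rewrite mulrA.
  have e2 : \int[leb2]_x (D x * V x * phi x) = \int[leb2]_x (D x * (V x * phi x)).
    by apply: int_eq => x; rewrite mulrA.
  rewrite e1 e2; move: lim1; rewrite (funext E') => lim1.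
  exact: cvgn_unique lim1 lim4.
have CW n := C1M (cut_weight_C1 n wD) CU.
split.
  by apply: (core U1 phi1) => // n; exact: (int_by_parts (CW n) cphi).1.
by apply: (core U2 phi2) => // n; exact: (int_by_parts (CW n) cphi).2.
Qed.

End NodalWeights.

(** * Signs of the weak form for weighted solutions *)

Section Flux.
Context {R : realType}.
Variables (omega : R) (U U1 U2 U11 U12 U21 U22 : R * R -> R).
Hypothesis CU : C1 U U1 U2.
Hypothesis CU1 : C1 U1 U11 U12.
Hypothesis CU2 : C1 U2 U21 U22.
Hypothesis eqU : forall x, - (U11 x + U22 x) + omega * (- x.2 * U1 x + x.1 * U2 x) = 0.
Implicit Types (D T phi : R * R -> R) (x : R * R).

(* The integrand of the weak form of [- Laplacian U + omega x^perp . grad U]. *)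
Definition flux phi phi1 phi2 x : R :=
  U1 x * phi1 x + U2 x * phi2 x + omega * (- x.2 * U1 x + x.1 * U2 x) * phi x.

Let lb_fst : locally_bounded (fun x : R * R => x.1).
Proof. by apply: continuous_locally_bounded => x; exact: cvg_fst. Qed.

Let lb_snd : locally_bounded (fun x : R * R => x.2).
Proof. by apply: continuous_locally_bounded => x; exact: cvg_snd. Qed.

Let lb_drift : locally_bounded (fun x => omega * (- x.2 * U1 x + x.1 * U2 x)).
Proof.
have [_ l1 l2] := C1_locally_bounded CU.
apply: locally_boundedM; first exact: locally_bounded_cst.
by apply: locally_boundedD; apply: locally_boundedM => //; exact: locally_boundedN.
Qed.

Lemma flux_tame phi phi1 phi2 : C1c phi phi1 phi2 -> tame (flux phi phi1 phi2).
Proof.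
move=> /C1c_tame[t t1 t2]; have [_ l1 l2] := C1_locally_bounded CU.
by apply: tameD; [apply: tameD|]; exact: tameMl.
Qed.

Lemma int_flux phi phi1 phi2 : C1c phi phi1 phi2 ->
  \int[leb2]_x flux phi phi1 phi2 x = 0.
Proof.
move=> cphi; have [tp tp1 tp2] := C1c_tame cphi.
have [h1 _] := int_C1c (C1cM CU1 cphi); have [_ h2] := int_C1c (C1cM CU2 cphi).
have [_ t1 _] := C1c_tame (C1cM CU1 cphi).
have [_ _ t2] := C1c_tame (C1cM CU2 cphi).
rewrite -[RHS]addr0 -{1}h1 -h2 -intD //; apply: int_eq => x.
have e : omega * (- x.2 * U1 x + x.1 * U2 x) = U11 x + U22 x.
  by apply/eqP; rewrite -subr_eq0 addrC; apply/eqP; rewrite -(eqU x); ring.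
by rewrite /flux e; ring.
Qed.

(** The equation is tested with D cut_n(U) phi. The derivative that falls on the cutoff gives |grad
    U|^2, with the sign of D U phi because s cut_n'(s) >= 0. No derivative of phi is left on the
    right. *)
Lemma cut_flux D n phi phi1 phi2 : nodal_weight U D -> C1c phi phi1 phi2 ->
  \int[leb2]_x (D x * cut n (U x) * flux phi phi1 phi2 x) =
  - (\int[leb2]_x (D x * dcut n (U x) * phi x * (U1 x ^+ 2 + U2 x ^+ 2))).
Proof.
move=> wD cphi; have [tp tp1 tp2] := C1c_tame cphi.
have [lU lU1 lU2] := C1_locally_bounded CU.
have CD := cut_weight_C1 CU n wD; have [lD lD1 lD2] := C1_locally_bounded CD.
have g1 := C1cM CU1 cphi; have g2 := C1cM CU2 cphi.
have [h1 _] := int_by_parts CD g1; have [_ h2] := int_by_parts CD g2.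
have [t1 t11 _] := C1c_tame g1; have [t2 _ t22] := C1c_tame g2.
have -> : \int[leb2]_x (D x * cut n (U x) * flux phi phi1 phi2 x) =
  \int[leb2]_x (D x * cut n (U x) * (U11 x * phi x + U1 x * phi1 x)) +
  \int[leb2]_x (D x * cut n (U x) * (U22 x * phi x + U2 x * phi2 x)).
  rewrite -intD; [|exact: tameMl..]; apply: int_eq => x.
  have e : omega * (- x.2 * U1 x + x.1 * U2 x) = U11 x + U22 x.
    by apply/eqP; rewrite -subr_eq0 addrC; apply/eqP; rewrite -(eqU x); ring.
  by rewrite /flux e; ring.
rewrite h1 h2 -opprD; congr (- _); rewrite -intD; [|exact: tameMl..].
by apply: int_eq => x; ring.
Qed.

(** The limit is taken in the left side of [cut_flux] alone; of the right side, which concentrates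
    on the nodal set, only the sign is kept. *)
Lemma flux_le0 D phi phi1 phi2 : nodal_weight U D -> C1c phi phi1 phi2 ->
  (forall x, 0 <= D x * U x * phi x) ->
  \int[leb2]_x (D x * flux phi phi1 phi2 x) <= 0.
Proof.
move=> wD cphi pos.
have lim := int_cut_weight_cvg CU wD (flux_tame cphi).
rewrite -(cvg_lim (@Rhausdorff R) lim).
apply: limr_le; first by apply/cvg_ex; eexists; exact: lim.
near=> n.
rewrite cut_flux // oppr_le0; apply: int_ge0 => x.
rewrite mulr_ge0 ?addr_ge0 ?sqr_ge0 // /dcut.
have /andP[d0 _] := dstep_bounds (n%:R * U x ^+ 2 - 1).
have -> : D x * (dstep (n%:R * U x ^+ 2 - 1) * (2 * n%:R * U x)) * phi x =
  dstep (n%:R * U x ^+ 2 - 1) * (2 * n%:R) * (D x * U x * phi x) by ring.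
by apply: mulr_ge0 => //; apply: mulr_ge0 => //; exact: mulr_ge0.
Unshelve. all: by end_near. Qed.

Lemma nodal_weightN D : nodal_weight U D -> nodal_weight U (fun x => - D x).
Proof.
move=> [D0 Dl [M DM]]; split.
- by move=> x /D0 ->; rewrite oppr0.
- by move=> x /Dl; apply: filterS => y ->.
- by exists M => x; rewrite normrN.
Qed.

Lemma flux_ge0 D phi phi1 phi2 : nodal_weight U D -> C1c phi phi1 phi2 ->
  (forall x, D x * U x * phi x <= 0) ->
  0 <= \int[leb2]_x (D x * flux phi phi1 phi2 x).
Proof.
move=> wD cphi neg.
have := flux_le0 (nodal_weightN wD) cphi.
have -> : \int[leb2]_x (- D x * flux phi phi1 phi2 x) =
   (-1) * \int[leb2]_x (D x * flux phi phi1 phi2 x).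
  rewrite -intZ; first by apply: int_eq => x; rewrite mulN1r mulNr.
  by apply: tameMl; [exact: flux_tame | exact: (nodal_weight_bounded CU wD)].
rewrite mulN1r oppr_le0; apply => x.
by rewrite !mulNr oppr_ge0.
Qed.

Definition nonzero_weight x : R := (U x != 0)%:R.

Lemma nonzero_weightP : nodal_weight U nonzero_weight.
Proof.
split.
- by move=> x Ux; rewrite /nonzero_weight Ux eqxx.
- move=> x Ux; have c : {for x, continuous (fun y => `|U y|)}.
    apply: (@continuous_comp _ _ _ U (fun s => `|s|)); first by case: CU => c _ _ _ _; exact: c.
    exact: norm_continuous.
  have : \forall y \near x, 0 < `|U y| by apply: (cvgr_gt _ c); rewrite normr_gt0.
  by apply: filterS => y; rewrite normr_gt0 /nonzero_weight Ux => ->.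
- by exists 1 => x; rewrite /nonzero_weight; case: (U x != 0); rewrite ?normr0 ?normr1.
Qed.

Definition plateau (N : R) s : R := 1 - step (s ^+ 2 - N ^+ 2).

Lemma plateau_C1c (N : R) : 0 <= N -> exists z z1 z2,
  [/\ C1c z z1 z2, forall x, 0 <= z x & forall x, box N x -> z x = 1].
Proof.
move=> N0.
pose p s := plateau N s; pose p' s := - (dstep (s ^+ 2 - N ^+ 2) * (2 * s)).
have dp (s : R) : is_derive s 1 p (p' s).
  have h : is_derive s 1 (fun s => s ^+ 2 - N ^+ 2) (2 * s).
    by eapply dv_eq; [dv | rewrite /=; ring].
  have := dvD (dvC 1 s) (dvN (@dv_comp _ step (fun s => s ^+ 2 - N ^+ 2) s _ _ (dv_step _) h)).
  by move=> /dv_eq; apply; rewrite add0r.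
have cp' : continuous p'.
  have c1 : continuous (fun s : R => s ^+ 2 - N ^+ 2).
    by move=> s; apply: cvgB; [exact: exprn_continuous | exact: cvg_cst].
  have c2 : continuous (fun s : R => dstep (s ^+ 2 - N ^+ 2)).
    by move=> s; apply: (@continuous_comp _ _ _ (fun s : R => s ^+ 2 - N ^+ 2) dstep);
      [exact: c1 | exact: continuous_dstep].
  have c3 : continuous (fun s : R => 2 * s) by move=> s; apply: cvgMl_tmp; exact: cvg_id.
  by move=> s; apply: cvgN; apply: cvgM; [exact: c2 | exact: c3].
have p_out s : N + 1 < `|s| -> p s = 0 /\ p' s = 0.
  move=> h; have : 1 <= s ^+ 2 - N ^+ 2.
    by rewrite -real_normK ?num_real //; nra.
  by move=> /step_ge1[e e']; rewrite /p /p' /plateau e e' subrr mul0r oppr0.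
have p_in s : `|s| <= N -> p s = 1.
  move=> h; have : s ^+ 2 - N ^+ 2 <= 0.
    by rewrite -real_normK ?num_real //; have := normr_ge0 s; nra.
  by move=> /step_le0[e _]; rewrite /p /plateau e subr0.
have p0 s : 0 <= p s.
  by rewrite /p /plateau subr_ge0; have /andP[] := step_bounds (s ^+ 2 - N ^+ 2).
have cp : continuous p by move=> s; exact: dv_continuous (dp s).
exists (fun x => p x.1 * p x.2), (fun x => p' x.1 * p x.2), (fun x => p x.1 * p' x.2).
have c1 : continuous (fun x : R * R => x.1) by move=> x; exact: cvg_fst.
have c2 : continuous (fun x : R * R => x.2) by move=> x; exact: cvg_snd.
have cc (f : R -> R) : continuous f ->
    continuous (fun x : R * R => f x.1) /\ continuous (fun x : R * R => f x.2).
  move=> cf; split; exact: continuous_comp2.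
have [k1 k2] := cc p cp; have [k3 k4] := cc p' cp'.
split; last 2 first.
- by move=> x; rewrite mulr_ge0.
- by move=> x [b1 b2]; rewrite !p_in // mulr1.
split.
  split; try exact: continuousM2.
  - move=> a b; have := dvM (dp a) (dvC (p b) a).
    by move=> /dv_eq; apply; rewrite mulr0 addr0.
  - move=> a b; have := dvM (dvC (p a) b) (dp b).
    by move=> /dv_eq; apply; rewrite mul0r add0r.
exists (N + 1); first by rewrite addr_ge0.
move=> x /not_andP[] /negP; rewrite -ltNge => /p_out[-> ->].
  by rewrite !mul0r.
by rewrite !mulr0.
Qed.

(* [U] equals [nonzero_weight * U], so their weak gradients [(U1, U2)] and
   [nonzero_weight * (U1, U2)] agree almost everywhere. *)
Lemma null_on_nodal_set : (forall psi, tame psi ->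
    \int[leb2]_x ((1 - nonzero_weight x) * U1 x * psi x) = 0) /\
  (forall psi, tame psi ->
    \int[leb2]_x ((1 - nonzero_weight x) * U2 x * psi x) = 0).
Proof.
have wN := nonzero_weightP; have lN := nodal_weight_bounded CU wN.
have [lU lU1 lU2] := C1_locally_bounded CU.
have lN' : locally_bounded (fun x => 1 - nonzero_weight x).
  by apply: locally_boundedD; [exact: locally_bounded_cst | exact: locally_boundedN].
have NU x : nonzero_weight x * U x = U x.
  by rewrite /nonzero_weight; have [->|_] := eqVneq; rewrite ?mulr0 // mul1r.
have N01 x : 1 - nonzero_weight x = 0 \/ 1 - nonzero_weight x = 1.
  by rewrite /nonzero_weight; case: (U x != 0); rewrite ?subrr ?subr0; [left|right].
have step1 phi phi1 phi2 : C1c phi phi1 phi2 ->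
   \int[leb2]_x ((1 - nonzero_weight x) * (U1 x * phi x)) = 0 /\
   \int[leb2]_x ((1 - nonzero_weight x) * (U2 x * phi x)) = 0.
  move=> cphi; have [tp tp1 tp2] := C1c_tame cphi.
  have [h1 h2] := int_by_parts CU cphi.
  have [k1 k2] := weighted_by_parts CU wN cphi.
  have T V : locally_bounded V -> \int[leb2]_x ((1 - nonzero_weight x) * (V x * phi x)) =
     \int[leb2]_x (V x * phi x) - \int[leb2]_x (nonzero_weight x * V x * phi x).
    move=> lV; rewrite -[- _]mulN1r -intZ; last first.
      by apply: tameMl => //; exact: locally_boundedM.
    rewrite -intD; [by apply: int_eq => x; ring | exact: tameMl |].
    by apply: tameZ; apply: tameMl => //; exact: locally_boundedM.
  have e1 : \int[leb2]_x (nonzero_weight x * U x * phi1 x) = \int[leb2]_x (U x * phi1 x).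
    by apply: int_eq => x; rewrite NU.
  have e2 : \int[leb2]_x (nonzero_weight x * U x * phi2 x) = \int[leb2]_x (U x * phi2 x).
    by apply: int_eq => x; rewrite NU.
  rewrite e1 h1 in k1; rewrite e2 h2 in k2.
  by rewrite !T // (oppr_inj k1) (oppr_inj k2) !subrr.
(* A tame [psi] need not be C^1. The admissible test function V z, with z = 1 on the box carrying
   [psi], shows that the integral of (1 - nonzero_weight) V^2 z is 0; Young's inequality with weight
   [e] then bounds the integral against [psi] by e Q for both signs [s]. *)
have core V V1 V2 : C1 V V1 V2 ->
    (forall phi phi1 phi2, C1c phi phi1 phi2 ->
      \int[leb2]_x ((1 - nonzero_weight x) * (V x * phi x)) = 0) ->
    forall psi, tame psi -> \int[leb2]_x ((1 - nonzero_weight x) * V x * psi x) = 0.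
  move=> CV H psi tpsi; have [lV _ _] := C1_locally_bounded CV.
  have [mpsi [N [B hB]]] := tpsi.
  have [z [z1 [z2 [cz z0 zN]]]] := plateau_C1c (normr_ge0 N).
  have [tz _ _] := C1c_tame cz.
  have zz := H _ _ _ (C1cM CV cz).
  set Q := \int[leb2]_x (psi x ^+ 2).
  have tQ : tame (fun x => psi x ^+ 2).
    by apply: tame_eq (tameM tpsi (tame_locally_bounded tpsi)) => x.
  have tV : tame (fun x => (1 - nonzero_weight x) * (V x * (V x * z x))).
    by do 3 (apply: tameMl => //).
  have tP : tame (fun x => (1 - nonzero_weight x) * V x * psi x).
    by apply: tameMl => //; exact: locally_boundedM.
  have bound (e s : R) : 0 < e -> s ^+ 2 = 1 ->
      s * \int[leb2]_x ((1 - nonzero_weight x) * V x * psi x) <= e * Q.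
    move=> e0 s2; rewrite -subr_ge0.
    have -> : e * Q - s * \int[leb2]_x ((1 - nonzero_weight x) * V x * psi x) =
       \int[leb2]_x (e * psi x ^+ 2 + (- s) * ((1 - nonzero_weight x) * V x * psi x)
          + e^-1 * ((1 - nonzero_weight x) * (V x * (V x * z x)))).
      rewrite intD; [|by apply: tameD; exact: tameZ|exact: tameZ].
      rewrite intD; [|exact: tameZ|exact: tameZ].
      by rewrite !intZ // zz mulr0 addr0 mulNr.
    apply: int_ge0 => x.
    have [p0|p0] := eqVneq (psi x) 0.
      rewrite p0 expr0n !mulr0 !add0r mulr_ge0 ?invr_ge0 ?(ltW e0) //.
      case: (N01 x) => ->; rewrite ?mul0r // mul1r mulrA -expr2.
      by rewrite mulr_ge0 ?sqr_ge0.
    have -> : z x = 1.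
      by apply: zN; apply: box_le ((hB x).2 p0); exact: ler_norm.
    case: (N01 x) => ->; first by rewrite !mul0r !mulr0 !addr0 mulr_ge0 ?sqr_ge0 ?ltW.
    have -> : e * psi x ^+ 2 + - s * (1 * V x * psi x) + e^-1 * (1 * (V x * (V x * 1))) =
       e^-1 * ((e * psi x - s / 2 * V x) ^+ 2 + 3 / 4 * V x ^+ 2).
      have -> : (e * psi x - s / 2 * V x) ^+ 2 =
         e ^+ 2 * psi x ^+ 2 - e * s * psi x * V x + s ^+ 2 / 4 * V x ^+ 2 by field.
      by rewrite s2; field; rewrite lt0r_neq0.
    by rewrite mulr_ge0 ?invr_ge0 ?(ltW e0) // addr_ge0 ?sqr_ge0 // mulr_ge0 ?sqr_ge0.
  have Q0 : 0 <= Q by apply: int_ge0 => x; exact: sqr_ge0.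
  set I := \int[leb2]_x _ in bound *.
  have small s : s ^+ 2 = 1 -> s * I <= 0.
    move=> s2; apply/ler_addgt0Pr => e e0; rewrite add0r.
    have q1 : 0 < Q + 1 by rewrite ltr_wpDl.
    apply: (le_trans (bound (e / (Q + 1)) s _ s2)); first by rewrite divr_gt0.
    by rewrite mulrAC ler_pdivrMr // ler_wpM2l ?ltW // ltrDl.
  apply/eqP; rewrite eq_le -[I]mul1r small ?expr1n //=.
  by rewrite -oppr_le0 -mulN1r mul1r small // sqrrN expr1n.
split; first by apply: core CU1 _ => phi phi1 phi2 /step1[].
by apply: core CU2 _ => phi phi1 phi2 /step1[].
Qed.

(** Where phi is carried, D U is c U, and the nodal set contributes nothing by [null_on_nodal_set]:
    the integral is c times that of [int_flux]. *)
Lemma flux_const D (c : R) phi phi1 phi2 : nodal_weight U D -> C1c phi phi1 phi2 ->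
  (forall x, phi x != 0 -> U x != 0 -> D x = c) ->
  \int[leb2]_x (D x * flux phi phi1 phi2 x) = 0.
Proof.
move=> wD cphi Dc; have wN := nonzero_weightP.
have [tp tp1 tp2] := C1c_tame cphi.
have [lU lU1 lU2] := C1_locally_bounded CU.
have lN := nodal_weight_bounded CU wN.
have tf := flux_tame cphi.
have -> : \int[leb2]_x (D x * flux phi phi1 phi2 x) =
    c * \int[leb2]_x (nonzero_weight x * flux phi phi1 phi2 x).
  (* D is known only where phi is nonzero, while the flux also contains derivatives of phi;
     [cut_flux] replaces them by phi before the two weights are compared. *)
  have l1 := int_cut_weight_cvg CU wD tf; have l2 := int_cut_weight_cvg CU wN tf.
  apply: (cvgn_unique l1).
  rewrite (_ : (fun n => _) = fun n => c *
    \int[leb2]_x (nonzero_weight x * cut n (U x) * flux phi phi1 phi2 x)).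
    exact: cvgMl_tmp.
  apply/funext => n; rewrite !cut_flux // mulrN -intZ; last first.
    have [_ l3 l4] := C1_locally_bounded (cut_weight_C1 CU n wN).
    apply: (@tame_eq _ (fun x => (nonzero_weight x * (dcut n (U x) * U1 x) * U1 x +
       nonzero_weight x * (dcut n (U x) * U2 x) * U2 x) * phi x)).
      by move=> x; ring.
    by apply: tameMl => //; apply: locally_boundedD; exact: locally_boundedM.
  congr (- _); apply: int_eq => x; have [->|p0] := eqVneq (phi x) 0.
    by rewrite !(mulr0, mul0r).
  have [Ux|Ux] := eqVneq (U x) 0; first by rewrite Ux (cut0 n).2 !(mulr0, mul0r).
  by rewrite (Dc x p0 Ux) /nonzero_weight Ux mul1r; ring.
have [n1 n2] := null_on_nodal_set.
have tpsi1 : tame (fun x => phi1 x + omega * - x.2 * phi x).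
  apply: tameD => //; apply: tameMl => //; apply: locally_boundedM; first exact: locally_bounded_cst.
  exact: locally_boundedN.
have tpsi2 : tame (fun x => phi2 x + omega * x.1 * phi x).
  by apply: tameD => //; apply: tameMl => //; apply: locally_boundedM => //; exact: locally_bounded_cst.
have lN' : locally_bounded (fun x => 1 - nonzero_weight x).
  by apply: locally_boundedD; [exact: locally_bounded_cst | exact: locally_boundedN].
suff -> : \int[leb2]_x (nonzero_weight x * flux phi phi1 phi2 x) = 0 by rewrite mulr0.
have h := int_flux cphi.
apply: etrans h; apply/eqP; rewrite eq_sym -subr_eq0 -[- _]mulN1r -intZ; last exact: tameMl.
rewrite -intD //; last by apply: tameZ; exact: tameMl.
rewrite -[X in _ == X]addr0 -{1}(n1 _ tpsi1) -(n2 _ tpsi2) -intD.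
- by apply/eqP; apply: int_eq => x; rewrite /flux; ring.
- by apply: tameMl => //; exact: locally_boundedM.
- by apply: tameMl => //; exact: locally_boundedM.
Qed.

End Flux.

Lemma sqnorm_gt0 (R : realType) (x : R * R) : x != (0, 0) -> 0 < x.1 ^+ 2 + x.2 ^+ 2.
Proof.
move=> x0; rewrite lt0r addr_ge0 ?sqr_ge0 // andbT paddr_eq0 ?sqr_ge0 // !sqrf_eq0.
by apply: contra x0 => /andP[/eqP e1 /eqP e2]; rewrite [x]surjective_pairing e1 e2.
Qed.

(** * Removal of the origin and gluing *)

Section Patching.
Context {R : realType}.
Variables (omega : R) (U U1 U2 U11 U12 U21 U22 : R * R -> R).
Hypothesis CU : C1 U U1 U2.
Hypothesis CU1 : C1 U1 U11 U12.
Hypothesis CU2 : C1 U2 U21 U22.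
Hypothesis eqU : forall x, - (U11 x + U22 x) + omega * (- x.2 * U1 x + x.1 * U2 x) = 0.
Hypothesis U0 : U (0, 0) = 0.
Hypothesis radial_bound : forall N : R, exists C : R, forall x, box N x ->
  `|x.1 * U1 x + x.2 * U2 x| <= C * (x.1 ^+ 2 + x.2 ^+ 2).
Implicit Types (D phi : R * R -> R) (x : R * R).

Let flx := flux omega U1 U2.

Definition puncture n x : R := step (n%:R * (x.1 ^+ 2 + x.2 ^+ 2) - 1).
Definition puncture1 n x : R := dstep (n%:R * (x.1 ^+ 2 + x.2 ^+ 2) - 1) * (2 * n%:R * x.1).
Definition puncture2 n x : R := dstep (n%:R * (x.1 ^+ 2 + x.2 ^+ 2) - 1) * (2 * n%:R * x.2).

Lemma C1_sq (n : R) : C1 (fun x : R * R => n * (x.1 ^+ 2 + x.2 ^+ 2) - 1)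
  (fun x => 2 * n * x.1) (fun x => 2 * n * x.2).
Proof.
have c1 : continuous (fun x : R * R => x.1) by move=> x; exact: cvg_fst.
have c2 : continuous (fun x : R * R => x.2) by move=> x; exact: cvg_snd.
have cc (c : R) : continuous (fun _ : R * R => c) by exact: cst_continuous.
have q1 : continuous (fun x : R * R => x.1 ^+ 2).
  by apply: (@continuous_comp2 _ (fun x => x.1) (fun s => s ^+ 2)) => //; exact: exprn_continuous.
have q2 : continuous (fun x : R * R => x.2 ^+ 2).
  by apply: (@continuous_comp2 _ (fun x => x.2) (fun s => s ^+ 2)) => //; exact: exprn_continuous.
split.
- exact: (continuousD2 (continuousM2 (cc n) (continuousD2 q1 q2)) (cc (- 1))).
- exact: (continuousM2 (cc (2 * n)) c1).
- exact: (continuousM2 (cc (2 * n)) c2).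
- by move=> a b /=; eapply dv_eq; [dv | rewrite /=; ring].
- by move=> a b /=; eapply dv_eq; [dv | rewrite /=; ring].
Qed.

Lemma puncture_C1 n : C1 (puncture n) (puncture1 n) (puncture2 n).
Proof. exact: C1_comp (C1_sq n%:R) (@dv_step R) (@continuous_dstep R). Qed.

Lemma puncture_eventually x : x != (0, 0) ->
  \forall n \near \oo, [/\ puncture n x = 1, puncture1 n x = 0 & puncture2 n x = 0].
Proof.
move=> /sqnorm_gt0 r0.
near=> n.
have h : 1 <= n%:R * (x.1 ^+ 2 + x.2 ^+ 2) - 1.
  suff : 2 <= n%:R * (x.1 ^+ 2 + x.2 ^+ 2) by lra.
  by rewrite -ler_pdivrMr //; near: n; exact: nbhs_infty_ger.
by have [e e'] := step_ge1 h; rewrite /puncture /puncture1 /puncture2 e e' !mul0r.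
Unshelve. all: by end_near. Qed.

(** The cutoff is radial, so its gradient meets only the radial derivative of U. The quadratic bound
    offsets the factor n, since n |x|^2 <= 2 on the support; 16 is 4 * 2 * 2, with 4 the bound on
    [dstep]. *)
Lemma puncture_grad_bound n x (C : R) : 0 <= C ->
  `|x.1 * U1 x + x.2 * U2 x| <= C * (x.1 ^+ 2 + x.2 ^+ 2) ->
  `|U1 x * puncture1 n x + U2 x * puncture2 n x| <= 16 * C.
Proof.
move=> C0 h; rewrite /puncture1 /puncture2.
set r := x.1 ^+ 2 + x.2 ^+ 2 in h *; set d := dstep _.
have r0 : 0 <= r by rewrite addr_ge0 ?sqr_ge0.
have -> : U1 x * (d * (2 * n%:R * x.1)) + U2 x * (d * (2 * n%:R * x.2)) =
  d * (2 * n%:R) * (x.1 * U1 x + x.2 * U2 x) by ring.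
have /andP[d0 d4] := dstep_bounds (n%:R * r - 1).
have dn : 0 <= d * (2 * n%:R) by apply: mulr_ge0 => //; exact: mulr_ge0.
rewrite normrM (ger0_norm dn).
apply: (@le_trans _ _ (d * (2 * n%:R) * (C * r))).
  exact: ler_wpM2l.
have [nr|nr] := leP 2 (n%:R * r).
  have h1 : 1 <= n%:R * r - 1 by lra.
  by rewrite /d (step_ge1 h1).2 !mul0r mulr_ge0.
have -> : d * (2 * n%:R) * (C * r) = d * 2 * (n%:R * r) * C by ring.
apply: ler_wpM2r => //.
have -> : 16 = 4 * 2 * 2 :> R by ring.
have nr0 : 0 <= n%:R * r by rewrite mulr_ge0.
apply: ler_pM => //; [exact: mulr_ge0 | | exact: ltW].
by apply: ler_pM.
Qed.

(** Both integrands are bounded uniformly in n, eventually 0 off the origin, and 0 at the origin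
    because D vanishes there with U; dominated convergence applies. *)
Lemma flux_puncture_cvg D phi phi1 phi2 : nodal_weight U D -> C1c phi phi1 phi2 ->
  \int[leb2]_x (D x * flx (fun x => (1 - puncture n x) * phi x)
     (fun x => - puncture1 n x * phi x + (1 - puncture n x) * phi1 x)
     (fun x => - puncture2 n x * phi x + (1 - puncture n x) * phi2 x) x)
  @[n --> \oo] --> (0 : R).
Proof.
move=> wD cphi; have [tp tp1 tp2] := C1c_tame cphi.
have [_ l1 l2] := C1_locally_bounded CU.
have tf := flux_tame omega CU cphi.
have lD := nodal_weight_bounded CU wD.
have [D0 _ [M DM]] := wD.
have M0 : 0 <= M by exact: le_trans (DM (0, 0)).
have lpt n := C1_locally_bounded (puncture_C1 n).
have lA n : locally_bounded (fun x => D x * (1 - puncture n x)).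
  have [lz _ _] := lpt n; apply: locally_boundedM => //.
  by apply: locally_boundedD; [exact: locally_bounded_cst | exact: locally_boundedN].
have lB n : locally_bounded (fun x => D x * - (U1 x * puncture1 n x + U2 x * puncture2 n x)).
  have [_ lz1 lz2] := lpt n; apply: locally_boundedM => //; apply: locally_boundedN.
  by apply: locally_boundedD; exact: locally_boundedM.
have zero : \int[leb2]_x ((fun=> 0) x * flx phi phi1 phi2 x) = 0 :> R.
  by rewrite (intZ 0 tf) mul0r.
have lim1 : \int[leb2]_x (D x * (1 - puncture n x) * flx phi phi1 phi2 x)
    @[n --> \oo] --> (0 : R).
  rewrite -zero; apply: (@int_cvgM _ _ (fun=> 0) _ M) => //.
  - exact: locally_bounded_cst.
  - move=> n x; rewrite normrM -[leRHS]mulr1; apply: ler_pM => //.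
    have /andP[h1 h2] := step_bounds (n%:R * (x.1 ^+ 2 + x.2 ^+ 2) - 1).
    by rewrite ger0_norm /puncture ?subr_ge0 // lerBlDr lerDl.
  - move=> x; have [->|x0] := eqVneq x (0, 0).
      by rewrite (D0 _ U0); under eq_fun do rewrite mul0r; exact: cvg_cst.
    apply: cvg_near_cst; near=> n.
    suff -> : puncture n x = 1 by rewrite subrr mulr0.
    by near: n; apply: filterS (puncture_eventually x0) => n [].
have lim2 : \int[leb2]_x (D x * - (U1 x * puncture1 n x + U2 x * puncture2 n x) * phi x)
    @[n --> \oo] --> (0 : R).
  have [mp [N [B hB]]] := tp; have [C hC] := radial_bound N.
  have -> : (0 : R) = \int[leb2]_x ((fun _ : R * R => 0 : R) x * phi x).
    by rewrite (intZ 0 tp) mul0r.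
  apply: (@int_cvg _ _ _ N (M * (16 * `|C|) * B)).
  - by move=> n; exact: (tameMl tp (lB n)).1.
  - by have [] := tameZ 0 tp.
  - move=> n x; split; last by rewrite mulf_eq0 negb_or => /andP[_ /(hB x).2].
    have [p0|p0] := eqVneq (phi x) 0.
      rewrite p0 mulr0 normr0 mulr_ge0 ?mulr_ge0 //.
      by apply: le_trans (hB x).1.
    rewrite normrM; apply: ler_pM => //; last exact: (hB x).1.
    rewrite normrM normrN; apply: ler_pM => //.
    apply: puncture_grad_bound => //; apply: (le_trans (hC x ((hB x).2 p0))).
    by apply: ler_wpM2r; [rewrite addr_ge0 ?sqr_ge0 | exact: ler_norm].
  - move=> x; apply: cvgMr_tmp; have [->|x0] := eqVneq x (0, 0).
      by rewrite (D0 _ U0); under eq_fun do rewrite mul0r; exact: cvg_cst.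
    apply: cvg_near_cst; near=> n.
    suff [_ -> ->] : [/\ puncture n x = 1, puncture1 n x = 0 & puncture2 n x = 0].
      by rewrite !mulr0 addr0 oppr0 mulr0.
    by near: n; exact: puncture_eventually x0.
have lim3 := cvgD lim1 lim2; rewrite addr0 in lim3.
rewrite (_ : (fun n => _) = fun n =>
  \int[leb2]_x (D x * (1 - puncture n x) * flx phi phi1 phi2 x) +
  \int[leb2]_x (D x * - (U1 x * puncture1 n x + U2 x * puncture2 n x) * phi x)).
  exact: lim3.
apply/funext => n; rewrite -intD; [|exact: tameMl..].
by apply: int_eq => x; rewrite /flx /flux; ring.
Unshelve. all: by end_near. Qed.

(* Near the origin [phi] is cut off at no cost; elsewhere it splits into a part
   carried by the set where the weight is constant, so that [D * U] is a solution,
   and a part carried by the set where [D * U <= 0], a negated subsolution. *)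
Lemma patched_flux_ge0 D (c : R) (X X1 X2 : nat -> R * R -> R) phi phi1 phi2 :
  nodal_weight U D -> C1c phi phi1 phi2 -> (forall x, 0 <= phi x) ->
  (forall n, C1 (X n) (X1 n) (X2 n)) ->
  (forall n x, X n x != 0 -> U x != 0 -> D x = c) ->
  (forall n x, 0 <= puncture n x - X n x) ->
  (forall n x, puncture n x - X n x != 0 -> D x * U x <= 0) ->
  0 <= \int[leb2]_x (D x * flx phi phi1 phi2 x).
Proof.
move=> wD cphi phi0 CX Xc X_le Xneg; have [tp tp1 tp2] := C1c_tame cphi.
have lD := nodal_weight_bounded CU wD.
have lim := flux_puncture_cvg wD cphi.
(* Writing 0 as the limit of the parts near the origin reduces the claim, for each n, to the
   nonnegativity of the two other parts. *)
rewrite -(cvg_lim (@Rhausdorff R) lim).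
apply: limr_le; first by apply/cvg_ex; eexists; exact: lim.
near=> n.
have CZ := puncture_C1 n.
have CY : C1 (fun x => puncture n x - X n x) (fun x => puncture1 n x - X1 n x)
    (fun x => puncture2 n x - X2 n x).
  apply: C1D => //; have := C1M (C1_cst (-1)) (CX n).
  by apply: C1_eq => x; rewrite ?mul0r ?add0r mulN1r.
have CV : C1 (fun x => 1 - puncture n x) (fun x => - puncture1 n x) (fun x => - puncture2 n x).
  have := C1D (C1_cst 1) (C1M (C1_cst (-1)) CZ).
  by apply: C1_eq => x; rewrite ?mul0r ?add0r mulN1r.
have cX := C1cM (CX n) cphi; have cY := C1cM CY cphi; have cV := C1cM CV cphi.
have tame_flux f f1 f2 : C1c f f1 f2 -> tame (fun x => D x * flx f f1 f2 x).
  by move=> cf; exact: tameMl (flux_tame omega CU cf) lD.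
pose P (Z Z1 Z2 : R * R -> R) x := D x * flx (fun x => Z x * phi x)
  (fun x => Z1 x * phi x + Z x * phi1 x) (fun x => Z2 x * phi x + Z x * phi2 x) x.
have tX : tame (P (X n) (X1 n) (X2 n)) by exact: tame_flux.
have tY : tame (P (fun x => puncture n x - X n x) (fun x => puncture1 n x - X1 n x)
  (fun x => puncture2 n x - X2 n x)) by exact: tame_flux.
have tV : tame (P (fun x => 1 - puncture n x) (fun x => - puncture1 n x)
  (fun x => - puncture2 n x)) by exact: tame_flux.
have e : \int[leb2]_x (D x * flx phi phi1 phi2 x) =
    \int[leb2]_x P (X n) (X1 n) (X2 n) x +
    \int[leb2]_x P (fun x => puncture n x - X n x) (fun x => puncture1 n x - X1 n x)
      (fun x => puncture2 n x - X2 n x) x +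
    \int[leb2]_x P (fun x => 1 - puncture n x) (fun x => - puncture1 n x)
      (fun x => - puncture2 n x) x.
  rewrite -(intD tX tY) -(intD (tameD tX tY) tV).
  by apply: int_eq => x; rewrite /P /flx /flux; ring.
rewrite e lerDr addr_ge0 //.
  rewrite (flux_const CU CU1 CU2 eqU (c := c) wD cX) // => x.
  by rewrite mulf_eq0 negb_or => /andP[/Xc h _]; exact: h.
apply: (flux_ge0 CU CU1 CU2 eqU wD cY) => x.
have [->|h] := eqVneq (puncture n x - X n x) 0; first by rewrite mul0r mulr0.
by rewrite mulr_le0_ge0 ?(Xneg n) // mulr_ge0.
Unshelve. all: by end_near. Qed.

Lemma test_function_C1c phi : test_function phi ->
  C1c phi (fun x => 'D_e1 phi x) (fun x => 'D_e2 phi x).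
Proof.
move=> [sm cp]; have d0 := sm [::]; have d1 := sm [:: e1]; have d2 := sm [:: e2].
have C : C1 phi (fun x => 'D_e1 phi x) (fun x => 'D_e2 phi x).
  apply: C1_of_derive => //.
  - by move=> x; exact: differentiable_continuous (d1 x).
  - by move=> x; exact: differentiable_continuous (d2 x).
split => //; have /compact_bounded[M [_ hM]] := cp.
exists (`|M| + 1); first by rewrite addr_ge0.
move=> x xM; have out : ~ closure [set x | phi x != 0] x.
  move=> /(hM (`|M| + 1)) /= h; apply: xM.
  have : `|x| <= `|M| + 1 by apply: h; rewrite ltr_pwDr // ler_norm.
  by rewrite /Num.norm /= ge_max => /andP[].
have near0 : \forall y \near x, phi y = 0.
  have : nbhs x (~` closure [set x | phi x != 0]).
    by apply: open_nbhs_nbhs; split => //; rewrite openC; exact: closed_closure.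
  apply: filterS => y yo; apply: contrapT => /eqP py.
  by apply: yo; exact: subset_closure.
have zd v : 'D_v phi x = 0.
  have := @near_eq_derive _ _ _ phi (fun=> 0) x v near0.
  by move=> ->; exact: derive_cst.
by split => //; exact: nbhs_singleton near0.
Qed.

Lemma locally_bounded_L2loc f : locally_bounded f -> @L2loc R f.
Proof.
move=> lf; split; first exact: lf.1.
move=> C cC; have [_ b2] := locally_boundedM lf lf.
have mC : measurable (C : set (measurableTypeR R * measurableTypeR R)).
  rewrite -[C]setCK; apply: measurableC; apply: open_measurable2.
  by rewrite openC; apply: compact_closed => //; exact: norm_hausdorff.
have /compact_bounded[M [_ hM]] := cC.
have CM : C `<=` box (`|M| + 1).
  move=> x Cx; have : `|x| <= `|M| + 1 by apply: hM => //; rewrite ltr_pwDr // ler_norm.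
  by rewrite /Num.norm /= ge_max => /andP[].
have [B hB] := b2 (`|M| + 1).
apply: measurable_bounded_integrable => //.
- apply: le_lt_trans (box_fin (`|M| + 1)); apply: le_measure; rewrite ?inE //.
  exact: measurable_box.
- by apply: measurable_funTS; apply: measurable_funX; exact: lf.1.
- exists B; split; rewrite ?num_real // => B' BB' x Cx /=.
  by apply: le_trans (ltW BB'); rewrite expr2; apply: hB; exact: CM.
Qed.

Lemma weighted_weak_gradient D : nodal_weight U D ->
  weak_gradient (fun x => D x * U x) (fun x => (D x * U1 x, D x * U2 x)).
Proof.
move=> wD; have lD := nodal_weight_bounded CU wD.
have [l0 l1 l2] := C1_locally_bounded CU.
split; try by apply: locally_bounded_L2loc; exact: locally_boundedM.
- by move=> phi /test_function_C1c cphi; exact: (weighted_by_parts CU wD cphi).1.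
- by move=> phi /test_function_C1c cphi; exact: (weighted_by_parts CU wD cphi).2.
Qed.

Lemma rot_form_weighted D phi :
  rot_form 0 omega (fun x => D x * U x) (fun x => (D x * U1 x, D x * U2 x)) phi =
  \int[leb2]_x (D x * flx phi (fun x => 'D_e1 phi x) (fun x => 'D_e2 phi x) x).
Proof.
apply: int_eq => x; rewrite /flx /flux /perp /rotation /= cos_pihalf sin_pihalf; ring.
Qed.

Lemma weighted_subsolution D : nodal_weight U D -> (forall x, 0 <= D x * U x) ->
  rot_subsolution 0 omega (fun x => D x * U x).
Proof.
move=> wD pos; exists (fun x => (D x * U1 x, D x * U2 x)).
  exact: weighted_weak_gradient.
move=> phi /test_function_C1c cphi phi0; rewrite rot_form_weighted.
by apply: (flux_le0 CU CU1 CU2 eqU wD cphi) => x; rewrite mulr_ge0.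
Qed.

Lemma patched_supersolution D (c : R) (X X1 X2 : nat -> R * R -> R) :
  nodal_weight U D -> (forall n, C1 (X n) (X1 n) (X2 n)) ->
  (forall n x, X n x != 0 -> U x != 0 -> D x = c) ->
  (forall n x, 0 <= puncture n x - X n x) ->
  (forall n x, puncture n x - X n x != 0 -> D x * U x <= 0) ->
  rot_supersolution 0 omega (fun x => D x * U x).
Proof.
move=> wD CX Xc X_le Xneg; exists (fun x => (D x * U1 x, D x * U2 x)).
  exact: weighted_weak_gradient.
move=> phi /test_function_C1c cphi phi0; rewrite rot_form_weighted.
exact: (patched_flux_ge0 wD cphi phi0 CX Xc X_le Xneg).
Qed.

End Patching.

(** * The segregated system *)

Section LocalC1.
Context {R : realType}.
Implicit Types (f g : R * R -> R) (x : R * R) (P : set (R * R)).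

(** Angular functions are regular only off the origin; [C1_mul_vanishing] returns to the whole plane
    after multiplication by a cutoff that vanishes near the excluded points. *)
Definition C1on P f f1 f2 : Prop := forall x, P x ->
  [/\ {for x, continuous f}, {for x, continuous f1}, {for x, continuous f2},
      is_derive x.1 1 (fun s => f (s, x.2)) (f1 x) &
      is_derive x.2 1 (fun s => f (x.1, s)) (f2 x)].

Lemma C1_C1on P f f1 f2 : C1 f f1 f2 -> C1on P f f1 f2.
Proof.
move=> [c c1 c2 d1 d2] [a b] _; split; [exact: c | exact: c1 | exact: c2 | |].
  exact: d1.
exact: d2.
Qed.

Lemma C1onT_C1 f f1 f2 : (forall x, C1on [set x] f f1 f2) -> C1 f f1 f2.
Proof.
move=> H; split.
- by move=> x; have [] := H x x erefl.
- by move=> x; have [] := H x x erefl.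
- by move=> x; have [] := H x x erefl.
- by move=> a b; have [] := H (a, b) (a, b) erefl.
- by move=> a b; have [] := H (a, b) (a, b) erefl.
Qed.

Lemma C1onD P f f1 f2 g g1 g2 : C1on P f f1 f2 -> C1on P g g1 g2 ->
  C1on P (fun x => f x + g x) (fun x => f1 x + g1 x) (fun x => f2 x + g2 x).
Proof.
move=> cf cg x Px; have [f0 h1 h2 d1 d2] := cf x Px; have [g0 k1 k2 e1 e2] := cg x Px.
split; try by apply: cvgD.
  exact: dvD d1 e1.
exact: dvD d2 e2.
Qed.

Lemma C1onM P f f1 f2 g g1 g2 : C1on P f f1 f2 -> C1on P g g1 g2 ->
  C1on P (fun x => f x * g x) (fun x => f1 x * g x + f x * g1 x)
     (fun x => f2 x * g x + f x * g2 x).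
Proof.
move=> cf cg x Px; have [f0 h1 h2 d1 d2] := cf x Px; have [g0 k1 k2 e1 e2] := cg x Px.
split.
- exact: cvgM.
- by apply: cvgD; exact: cvgM.
- by apply: cvgD; exact: cvgM.
- by have := dvM d1 e1; rewrite /= -surjective_pairing.
- by have := dvM d2 e2; rewrite /= -surjective_pairing.
Qed.

Lemma C1on_comp P f f1 f2 (h h' : R -> R) : C1on P f f1 f2 ->
  (forall x, P x -> is_derive (f x) 1 h (h' (f x)) /\ {for f x, continuous h'}) ->
  C1on P (fun x => h (f x)) (fun x => h' (f x) * f1 x) (fun x => h' (f x) * f2 x).
Proof.
move=> cf ch x Px; have [f0 h1 h2 d1 d2] := cf x Px; have [dh ch'] := ch x Px.
have c0 : {for x, continuous (fun x => h' (f x))}.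
  exact: (@continuous_comp _ _ _ f h').
have ef : f (x.1, x.2) = f x by rewrite -surjective_pairing.
split.
- by apply: (@continuous_comp _ _ _ f h) => //; exact: dv_continuous dh.
- exact: cvgM.
- exact: cvgM.
- by apply: (@dv_comp _ h (fun s => f (s, x.2)) x.1) => //; rewrite ef.
- by apply: (@dv_comp _ h (fun s => f (x.1, s)) x.2) => //; rewrite ef.
Qed.

Lemma C1_mul_vanishing P z z1 z2 f f1 f2 : C1 z z1 z2 -> C1on P f f1 f2 ->
  (forall x, ~ P x -> \forall y \near x, [/\ z y = 0, z1 y = 0 & z2 y = 0]) ->
  C1 (fun x => z x * f x) (fun x => z1 x * f x + z x * f1 x)
     (fun x => z2 x * f x + z x * f2 x).
Proof.
move=> cz cf z0; apply: C1onT_C1 => x.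
have [Px|/z0 nz] := pselect (P x).
  move=> _ ->; have cz' : C1on P z z1 z2 by exact: C1_C1on.
  exact: (C1onM cz' cf Px).
move=> _ ->; move: x nz => [a b] nz.
have loc (h : R * R -> R) : (\forall y \near (a, b), h y = 0) ->
    {for (a, b), continuous h}.
  move=> h0; have e := nbhs_singleton h0; rewrite /prop_for /continuous_at e.
  by apply: cvg_near_cst; exact: h0.
have e0 : \forall y \near (a, b), z y * f y = 0.
  by apply: filterS nz => y [-> _ _]; rewrite mul0r.
have e1 : \forall y \near (a, b), z1 y * f y + z y * f1 y = 0.
  by apply: filterS nz => y [-> -> _]; rewrite !mul0r addr0.
have e2 : \forall y \near (a, b), z2 y * f y + z y * f2 y = 0.
  by apply: filterS nz => y [-> _ ->]; rewrite !mul0r addr0.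
split; try exact: loc.
- rewrite (nbhs_singleton e1) /=.
  have h : \forall s \near a, 0 = z (s, b) * f (s, b).
    have hh : \forall s \near a, z (s, b) * f (s, b) = 0 by exact: (@slice1 _ a b _ e0).
    by apply: filterS hh => s ->.
  exact: near_eq_is_derive h (dvC 0 a).
- rewrite (nbhs_singleton e2) /=.
  have h : \forall s \near b, 0 = z (a, s) * f (a, s).
    have hh : \forall s \near b, z (a, s) * f (a, s) = 0 by exact: (@slice2 _ a b _ e0).
    by apply: filterS hh => s ->.
  exact: near_eq_is_derive h (dvC 0 b).
Qed.

Lemma elementary_C1 f : elementary f -> C1 f (fun x => 'D_e1 f x) (fun x => 'D_e2 f x).
Proof.
move=> /elementary_smooth sm; apply: C1_of_derive => //.
- exact: (sm [::]).
- by move=> x; exact: differentiable_continuous (sm [:: e1] x).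
- by move=> x; exact: differentiable_continuous (sm [:: e2] x).
Qed.

End LocalC1.

Section NodalWeightCombinations.
Context {R : realType}.
Variable U : R * R -> R.
Implicit Types (D : R * R -> R).

Lemma nodal_weight0 : nodal_weight U (fun=> 0).
Proof.
split => //; first by move=> x _; exact: filterE.
by exists 0 => x; rewrite normr0.
Qed.

Lemma nodal_weightDZ (c : R) D D' : nodal_weight U D -> nodal_weight U D' ->
  nodal_weight U (fun x => c * D x + D' x).
Proof.
move=> [D0 Dl [M DM]] [D0' Dl' [M' DM']]; split.
- by move=> x Ux; rewrite D0 // D0' // mulr0 addr0.
- by move=> x Ux; apply: filterS2 (Dl x Ux) (Dl' x Ux) => y -> ->.
- exists (`|c| * M + M') => x; apply: (le_trans (ler_normD _ _)).
  by apply: lerD => //; rewrite normrM; apply: ler_wpM2l.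
Qed.

Lemma nodal_weight_sum (I : Type) (s : seq I) (c : I -> R) (D : I -> R * R -> R) :
  (forall i, nodal_weight U (D i)) ->
  nodal_weight U (fun x => \sum_(i <- s) c i * D i x).
Proof.
move=> wD; elim: s => [|i s IH].
  rewrite (_ : (fun x => _) = fun=> 0); first exact: nodal_weight0.
  by apply/funext => x; rewrite big_nil.
rewrite (_ : (fun x => _) = fun x => c i * D i x + \sum_(j <- s) c j * D j x).
  exact: nodal_weightDZ.
by apply/funext => x; rewrite big_cons.
Qed.

End NodalWeightCombinations.

Lemma near_sg (R : realType) (T : topologicalType) (f : T -> R) (x : T) :
  {for x, continuous f} -> f x != 0 -> \forall y \near x, Num.sg (f y) = Num.sg (f x).
Proof.
move=> cf; rewrite neq_lt => /orP[fn|fp].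
  have : \forall y \near x, f y < 0 by apply: (cvgr_lt _ cf).
  by apply: filterS => y fy; rewrite (ltr0_sg fy) (ltr0_sg fn).
have : \forall y \near x, 0 < f y by apply: (cvgr_gt _ cf).
by apply: filterS => y fy; rewrite (gtr0_sg fy) (gtr0_sg fp).
Qed.

Section PlaneFacts.
Context {R : realType}.
Implicit Types (x : R * R) (P : set (R * R)).

Lemma C1on_cst P (c : R) : C1on P (fun=> c) (fun=> 0) (fun=> 0).
Proof. exact/C1_C1on/C1_cst. Qed.

Lemma C1on_sqnorm P : C1on P (fun x => x.1 ^+ 2 + x.2 ^+ 2)
  (fun x => 2 * x.1) (fun x => 2 * x.2).
Proof.
have := C1onD (C1_C1on (P := P) (@C1_sq R 1)) (@C1on_cst P 1).
have -> : (fun x => 1 * (x.1 ^+ 2 + x.2 ^+ 2) - 1 + 1) = fun x : R * R => x.1 ^+ 2 + x.2 ^+ 2.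
  by apply/funext => x; rewrite mul1r subrK.
have -> : (fun x => 2 * 1 * x.1 + 0) = fun x : R * R => 2 * x.1.
  by apply/funext => x; rewrite mulr1 addr0.
have -> // : (fun x => 2 * 1 * x.2 + 0) = fun x : R * R => 2 * x.2.
by apply/funext => x; rewrite mulr1 addr0.
Qed.

Lemma puncture_near0 n : \forall y \near ((0, 0) : R * R),
  [/\ puncture n y = 0, puncture1 n y = 0 & puncture2 n y = 0].
Proof.
have [c0 _ _ _ _] := C1_sq (n%:R : R).
have : \forall y \near ((0, 0) : R * R), n%:R * (y.1 ^+ 2 + y.2 ^+ 2) - 1 < 0.
  by apply: (cvgr_lt _ (c0 (0, 0))); rewrite /= expr0n addr0 mulr0 sub0r oppr_lt0.
apply: filterS => y /ltW/step_le0[e e'].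
by rewrite /puncture /puncture1 /puncture2 e e' !mul0r.
Qed.

End PlaneFacts.

(** * Weights and angular cutoffs attached to a sector *)

Section SectorWeights.
Context {R : realType}.
Variables (k : nat) (g rho : R -> R) (u : R * R -> R).
Hypothesis k_gt1 : (1 < k)%N.
Hypothesis cont_g : forall r, 0 < r -> {for r, continuous g}.
Hypothesis rho_gt0 : forall r, 0 < r -> 0 < rho r.
Hypothesis rho0 : rho 0 = 0.
Hypothesis uE : forall x,
  u x = rho (modulus x) * cos (k%:R * (angle x + g (modulus x))).
Hypothesis cont_u : continuous u.
Variables g1 g2 : R * R -> R.
Hypothesis Cg : C1on [set x | x != (0, 0)] (fun x => g (modulus x)) g1 g2.
Implicit Types (x : R * R) (r th : R).

Let k_gt0 : (0 < k)%N. Proof. exact: ltnW. Qed.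
Let kR : 0 < k%:R :> R. Proof. by rewrite ltr0n. Qed.
Let w : R := pi / k%:R.
Let w0 : 0 < w. Proof. by rewrite divr_gt0 ?pi_gt0. Qed.
Let sec (z : int) : set (R * R) := sector k g z.

Let cover x : u x != 0 <-> exists z, sec z x.
Proof. exact: (nonzero_cover k_gt0 rho_gt0 rho0 uE). Qed.

Definition sector_weight (z : int) x : R := Num.sg (u x) * \1_(sec z) x.

Lemma sector_weightP z : nodal_weight u (sector_weight z).
Proof.
split.
- by move=> x ux; rewrite /sector_weight ux sgr0 mul0r.
- move=> x ux; have s1 := near_sg (@cont_u x) ux.
  have [n nx] := (cover x).1 ux.
  have no : nbhs x (sec n) by apply: open_nbhs_nbhs; split => //; exact: sector_open.
  have s2 : \forall y \near x, \1_(sec z) y = \1_(sec z) x :> R.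
    apply: filterS no => y ny; rewrite !indicE; congr (_%:R); congr nat_of_bool.
    have same p q : sec n p -> sec n q -> sec z p -> sec z q.
      move=> np nq zp; have [e ->] := sector_unique k_gt0 zp np.
      by rewrite /sec sector_periodic.
    by apply/idP/idP; rewrite !inE; exact: same.
  by apply: filterS2 s1 s2 => y e1 e2; exact: (congr2 *%R e1 e2).
- exists 1 => x; rewrite /sector_weight normrM -[leRHS]mulr1; apply: ler_pM => //.
    by rewrite normr_sg; case: (u x != 0).
  by rewrite indicE; case: (x \in _); rewrite ?normr1 ?normr0.
Qed.

Lemma sector_weight_mul z x : sector_weight z x * u x = `|u x| * \1_(sec z) x.
Proof. by rewrite /sector_weight mulrAC -normrEsg. Qed.

(** The half-width 3/4 w exceeds the half-width w / 2 of the sector, and 5/4 w stays below 3/2 w,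
    where the second neighbours begin. Both are at most pi because k >= 2 gives w <= pi / 2, so the
    cosine orders them. *)
Let al : R := cos (5 / 4 * w).
Let be : R := cos (3 / 4 * w).

Let angles : [/\ 0 <= w / 2 <= pi, 0 <= 3 / 4 * w <= pi & 0 <= 5 / 4 * w <= pi].
Proof.
have h : w <= pi / 2.
  rewrite /w ler_wpM2l ?pi_ge0 // lef_pV2 ?posrE ?ltr0n // ler_nat //.
have := w0; move: h; have := @pi_gt0 R; move: (@pi R) => p p0 hw wp.
split; apply/andP; split; lra.
Qed.

Let al_be : al < be.
Proof.
have [_ h1 h2] := angles; rewrite /al /be ltr_cos ?in_itv //=.
by rewrite ltr_pM2r // ltr_pM2r // ltr_nat.
Qed.

(* In polar coordinates, a step in [cos (th + g r - z pi / k)] that rises from 0 to 1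
   as the angle decreases from [5/4] to [3/4] of [pi / k]. *)
Definition angular_cutoff (z : int) x : R :=
  step ((tilt k g z x * (modulus x)^-1 - al) * (be - al)^-1).

Lemma angular_cutoff_C1 z : exists f1 f2,
  C1on [set x | x != (0, 0)] (angular_cutoff z) f1 f2.
Proof.
set P := [set x | _].
have C1c := @C1on_cst R P; have Csq := @C1on_sqnorm R P.
have [m1 [m2 Cinv]] : exists m1 m2, C1on P (fun x => (modulus x)^-1) m1 m2.
  pose h (s : R) := (Num.sqrt s)^-1; pose h' (s : R) := - ((2 * Num.sqrt s)^-1 * 1) / Num.sqrt s ^+ 2.
  eexists; eexists; apply: (C1on_comp (h := h) (h' := h') Csq).
  move=> x /sqnorm_gt0 s0; have q0 : Num.sqrt (x.1 ^+ 2 + x.2 ^+ 2) != 0 by rewrite gt_eqF // sqrtr_gt0.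
  split.
    exact: (@dvV _ (fun y => Num.sqrt y) _ _ q0 (@dv_sqrt _ (fun y => y) _ _ s0 (dvid _))).
  have cs : {for x.1 ^+ 2 + x.2 ^+ 2, continuous (@Num.sqrt R)} by exact: sqrt_continuous.
  apply: cvgM.
    apply: cvgN; apply: cvgM; last exact: cvg_cst.
    by apply: cvgV; [rewrite mulf_neq0 | apply: cvgMl_tmp].
  apply: cvgV; first by rewrite expf_neq0.
  by apply: (@continuous_comp _ _ _ (@Num.sqrt R) (fun s => s ^+ 2)) => //; exact: exprn_continuous.
have CG := C1onD Cg (C1c (- (z%:~R * w))).
have [f1 [f2 Cfst]] : exists f1 f2, C1on P (fun x : R * R => x.1) f1 f2.
  by eexists; eexists; exact/C1_C1on/elementary_C1/elementary_fst.
have [d1 [d2 Csnd]] : exists f1 f2, C1on P (fun x : R * R => x.2) f1 f2.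
  by eexists; eexists; exact/C1_C1on/elementary_C1/elementary_snd.
have Nsin : continuous (fun s : R => - sin s) by move=> s; apply: cvgN; exact: continuous_sin.
have Ccos := @C1on_comp _ P _ _ _ (@cos R) (fun s => - sin s) CG (fun x _ =>
  conj (is_derive_cos _) (Nsin _)).
have Csin := @C1on_comp _ P _ _ _ (@sin R) (@cos R) CG (fun x _ =>
  conj (is_derive_sin _) (@continuous_cos R _)).
have Ct := C1onD (C1onM Cfst Ccos) (C1onM (C1c (-1)) (C1onM Csnd Csin)).
have Cq := C1onM (C1onD (C1onM Ct Cinv) (C1c (- al))) (C1c (be - al)^-1).
have Cs := @C1on_comp _ P _ _ _ step dstep Cq (fun x _ =>
  conj (dv_step _) (@continuous_dstep R _)).
have -> : angular_cutoff z = fun x => step (((x.1 * cos (g (modulus x) - z%:~R * w) +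
    -1 * (x.2 * sin (g (modulus x) - z%:~R * w))) * (modulus x)^-1 + - al) * (be - al)^-1).
  by apply/funext => x; rewrite /angular_cutoff /tilt mulN1r.
by eexists; eexists; exact: Cs.
Qed.

Let tilt_norm z x : 0 < modulus x ->
  tilt k g z x * (modulus x)^-1 = cos (angle x + (g (modulus x) - z%:~R * w)).
Proof.
move=> r0; rewrite -{1}(polar_angle x) tilt_polar ?modulus_ge0 // mulrAC mulfV ?mul1r //.
exact: lt0r_neq0.
Qed.

Lemma angular_cutoff_sector z x : sec z x -> angular_cutoff z x = 1.
Proof.
move=> [r0 h]; apply: (step_ge1 _).1.
have [w2 w34 _] := angles.
have d0 : 0 < be - al by rewrite subr_gt0.
rewrite ler_pdivlMr // mul1r lerD2r; apply: (@le_trans _ _ (cos (w / 2))).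
  rewrite /be ltW // ltr_cos ?in_itv //=; have := w0; lra.
by rewrite ler_pdivlMr // ltW.
Qed.

Lemma angular_cutoff_support z x : angular_cutoff z x != 0 -> u x != 0 ->
  [\/ sec (z - 1) x, sec z x | sec (z + 1) x].
Proof.
move=> cx ux; have [n nx] := (cover x).1 ux; have [r0 _] := nx.
have [_ _ w54] := angles.
have d0 : 0 < be - al by rewrite subr_gt0.
have h : al < cos (angle x + (g (modulus x) - z%:~R * w)).
  rewrite -tilt_norm // ltNge; apply: contra cx => le.
  rewrite /angular_cutoff (step_le0 _).1 // pmulr_lle0 ?invr_gt0 //.
  by rewrite subr_le0.
have [p hp] := cos_gt_cos w54 h.
have [_ nx'] := nx; rewrite -{2}(polar_angle x) tilt_polar ?modulus_ge0 // in nx'.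
rewrite [_ * modulus x]mulrC ltr_pM2l // in nx'.
have [w2 _ _] := angles.
have [q hq] := cos_gt_cos w2 nx'.
pose d := (n - z + (q - p) * (2 * k)%:Z).
(* The centres are less than 5/4 + 1/2 = 7/4 steps apart, hence at most one. *)
have dw : `|d%:~R * w| < 7 / 4 * w.
  set X := angle x + _ - p%:~R * _ in hp; set Y := angle x + _ - q%:~R * _ in hq.
  have -> : d%:~R * w = X - Y.
    rewrite /X /Y /d !(intrD, intrM, intrB) -[((2 * k)%:Z)%:~R]/((2 * k)%:R : R) natrM /w.
    by rewrite -[pi *+ 2]mulr_natr; field; rewrite lt0r_neq0.
  apply: (le_lt_trans (ler_normB _ _)).
  have -> : 7 / 4 * w = 5 / 4 * w + w / 2 by field.
  exact: ltrD.
have d1 : `|d| <= 1.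
  have : `|d%:~R| < 2 :> R.
    move: dw; rewrite normrM (gtr0_norm w0) ltr_pM2r // => dw.
    by apply: (lt_le_trans dw); lra.
  by rewrite -intr_norm (ltr_int R _ 2) -(ltzD1 `|d| 1).
have e : sec n x = sec (z + d) x.
  have -> : z + d = n + (q - p) * (2 * k)%:Z by rewrite /d; ring.
  by rewrite /sec sector_periodic.
rewrite e in nx.
have : d = -1 \/ d = 0 \/ d = 1 by clear -d1; move: d d1 => d; lia.
move=> [E|[E|E]]; rewrite E ?addr0 in nx; [exact: Or31|exact: Or32|exact: Or33].
Qed.

Lemma angular_cutoff_bounds z x : 0 <= angular_cutoff z x <= 1.
Proof. exact: step_bounds. Qed.


End SectorWeights.

Section SegregatedSolution.
Context {R : realType}.
Variables (omega : R) (k : nat).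
Hypothesis omega_gt0 : 0 < omega.
Hypothesis k_gt1 : (1 < k)%N.
Implicit Types (x : R * R) (r th : R).

Let k_gt0 : (0 < k)%N. Proof. exact: ltnW. Qed.
Let a := bessel_scale omega k.
Let kR : 0 < k%:R :> R. Proof. by rewrite ltr0n. Qed.
Let w : R := pi / k%:R.
Let w0 : 0 < w. Proof. by rewrite divr_gt0 ?pi_gt0. Qed.

Variable b : R -> R.
Hypothesis db : forall u : R, -1 < u -> is_derive u 1 b (kimag k u / kmod2 k u).
Hypothesis bE : forall u, 0 <= u ->
  kel k 0 u = Num.sqrt (kmod2 k u) * cos (b u) /\
  - kel k 1 u = Num.sqrt (kmod2 k u) * sin (b u).

Let U x : R := rotU omega k x 0.
Let g : R -> R := twist omega k b 0.
Let sec (z : int) : set (R * R) := sector k g z.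
Let A : R := Num.sqrt a ^+ k.
Let tau : R := k%:R * (omega * 0 + pi / 4).

Let UE : U = fun x => A * wave a k tau x.
Proof. by apply/funext => x; rewrite /U rotU_wave // ltW. Qed.

Let elemU : elementary U.
Proof. by rewrite UE; apply: elem_mul; [exact: elem_cst | exact: elementary_wave]. Qed.

Let U1 x : R := 'D_e1 U x.
Let U2 x : R := 'D_e2 U x.

Lemma elementary_derive (V : normedModType R) (f : V -> R) (v : V) :
  elementary f -> elementary (fun y => 'D_v f y).
Proof.
move=> /elem_diff[df [dfx edf]]; rewrite (_ : (fun y => _) = fun y => df y v); first exact: edf.
by apply/funext => y; exact: df_derive.
Qed.

Let CU : C1 U U1 U2. Proof. exact: elementary_C1. Qed.
Let CU1 : C1 U1 (fun x => 'D_e1 U1 x) (fun x => 'D_e2 U1 x).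
Proof. exact/elementary_C1/elementary_derive. Qed.
Let CU2 : C1 U2 (fun x => 'D_e1 U2 x) (fun x => 'D_e2 U2 x).
Proof. exact/elementary_C1/elementary_derive. Qed.

Let gradU x : U1 x = A * wave1 a k tau x /\ U2 x = A * wave2 a k tau x.
Proof.
have h : is_diff x U (fun v => A * (v.1 * wave1 a k tau x + v.2 * wave2 a k tau x)).
  rewrite UE; apply: df_eq (dfM (dfC A x) (df_wave a k tau x)) _ => v /=; ring.
by rewrite /U1 /U2 !(df_derive _ h) /e1 /e2 /=; split; ring.
Qed.

(** For a function rotating at speed omega the time derivative is omega times the derivative along
    x^perp, so this is the heat equation at time 0. *)
Let eqU x : - ('D_e1 U1 x + 'D_e2 U2 x) + omega * (- x.2 * U1 x + x.1 * U2 x) = 0.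
Proof.
have dt : is_derive (0 : R) 1 (fun t => k%:R * (omega * t + pi / 4)) (k%:R * omega).
  by eapply dv_eq; [dv | ring].
have Dt := dvM (dvC A 0) (dv_wave_time a k x dt).
have et : rotU omega k x = fun t => A * wave a k (k%:R * (omega * t + pi / 4)) x.
  by apply/funext => s; rewrite rotU_wave // ltW.
have h : derive1 (rotU omega k x) 0 - ('D_e1 U1 x + 'D_e2 U2 x) = 0.
  have [_ heat] := heat_rotU (ltW omega_gt0) k_gt0; exact: heat.
rewrite et derive1E (@derive_val _ _ _ _ _ _ _ Dt) in h.
have [-> ->] := gradU x.
have -> : - x.2 * (A * wave1 a k tau x) + x.1 * (A * wave2 a k tau x) =
   A * (- x.2 * wave1 a k tau x + x.1 * wave2 a k tau x) by ring.
have rearrange (o B K p q s v : R) : - (p + q) + o * (B * (K * s)) =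
    0 * v + B * (K * o * s) - (p + q) by ring.
by rewrite wave_rotation_derivative; apply: etrans h; exact: rearrange.
Qed.

(** Since k >= 2, a factor z^2 comes out of z^k: its parts x.1^2 - x.2^2 and 2 x.1 x.2 are at most
    |x|^2, and [F1], [F2], [F3] are the locally bounded cofactors. *)
Let radial_bound (N : R) : exists C : R, forall x, box N x ->
  `|x.1 * U1 x + x.2 * U2 x| <= C * (x.1 ^+ 2 + x.2 ^+ 2).
Proof.
pose m := (k - 2)%N.
have ek : k = m.+2 by rewrite /m; lia.
pose E p x := ke tau k p (a * (x.1 ^+ 2 + x.2 ^+ 2)).
pose F1 x : R := A * k%:R * (zpow m x * E 0%N x + zimpow m x * E 1%N x).
pose F2 x : R := A * k%:R * (zpow m x * E 1%N x - zimpow m x * E 0%N x).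
pose F3 x : R := 2 * A * a * radial a k tau x.
have lb (f : R * R -> R) : elementary f -> locally_bounded f.
  move=> /elem_diff[df [dfx _]]; apply: continuous_locally_bounded => x.
  exact: df_continuous (dfx x).
have [z1 z2] := elementary_zpow m (@elementary_fst R) (@elementary_snd R).
have [y1 y2] := elementary_zpow k (@elementary_fst R) (@elementary_snd R).
have eE p : elementary (E p) by exact: elementary_ke.
have [M1 h1] : exists M, forall x, box N x -> `|F1 x| <= M.
  have [_] := lb F1 (elem_mul (elem_cst _) (elem_add (elem_mul z1 (eE _)) (elem_mul z2 (eE _)))).
  exact.
have [M2 h2] : exists M, forall x, box N x -> `|F2 x| <= M.
  have [_] := lb F2 (elem_mul (elem_cst _) (elem_add (elem_mul z1 (eE _))
    (elementary_opp (elem_mul z2 (eE _))))).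
  exact.
have [M3 h3] : exists M, forall x, box N x -> `|F3 x| <= M.
  have er : elementary F3.
    apply: elem_mul; first exact: elem_cst.
    by apply: elem_add; apply: elem_mul => //; exact: elementary_ke.
  by have [_] := lb F3 er; exact.
exists (M1 + M2 + M3) => x xN.
have -> : x.1 * U1 x + x.2 * U2 x =
   (x.1 ^+ 2 - x.2 ^+ 2) * F1 x + 2 * x.1 * x.2 * F2 x + (x.1 ^+ 2 + x.2 ^+ 2) * F3 x.
  have [-> ->] := gradU x; rewrite /wave1 /wave2 /F1 /F2 /F3 /E.
  rewrite [in zpow k.-1 x]ek [in zimpow k.-1 x]ek /= zpowS zimpowS; ring.
set s := x.1 ^+ 2 + x.2 ^+ 2.
have s0 : 0 <= s by rewrite addr_ge0 ?sqr_ge0.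
have b1 : `|x.1 ^+ 2 - x.2 ^+ 2| <= s.
  by rewrite ler_norml /s; have := sqr_ge0 x.1; have := sqr_ge0 x.2 => *; apply/andP; split; lra.
have b2 : `|2 * x.1 * x.2| <= s.
  have := sqr_ge0 (x.1 - x.2); have := sqr_ge0 (x.1 + x.2).
  rewrite sqrrD sqrrB => *; rewrite ler_norml /s; apply/andP; split; lra.
have b3 : `|s| <= s by rewrite ger0_norm.
have T (p q M : R) : `|p| <= s -> `|q| <= M -> `|p * q| <= M * s.
  by move=> hp hq; rewrite normrM mulrC; apply: ler_pM.
have -> : (M1 + M2 + M3) * s = M1 * s + M2 * s + M3 * s by ring.
apply: (le_trans (ler_normD _ _)); apply: lerD; last exact: T b3 (h3 x xN).
by apply: (le_trans (ler_normD _ _)); apply: lerD; [exact: T b1 (h1 x xN) | exact: T b2 (h2 x xN)].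
Qed.

Let U0 : U (0, 0) = 0.
Proof.
rewrite UE /wave; have -> : zpow k (0, 0) = 0 :> R.
  by rewrite -(prednK k_gt0) zpowS /= !mul0r subr0.
have -> : zimpow k (0, 0) = 0 :> R.
  by rewrite -(prednK k_gt0) zimpowS /= !mul0r addr0.
by rewrite !mul0r addr0 mulr0.
Qed.

Let cont_g r : 0 < r -> {for r, continuous g}.
Proof. by move=> _; exact: (continuous_twist omega_gt0 k_gt0 db). Qed.

Let amp0 : amplitude omega k 0 = 0. Proof. exact: amplitude0. Qed.
Let ampE x : U x = amplitude omega k (modulus x) * cos (k%:R * (angle x + g (modulus x))).
Proof. exact: (rotU_twist omega_gt0 k_gt0 bE). Qed.
Let amp_gt0 r : 0 < r -> 0 < amplitude omega k r.
Proof. exact: amplitude_gt0. Qed.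

Let cont_U : continuous U. Proof. by case: CU. Qed.

Let Cg : exists g1 g2, C1on [set x | x != (0, 0)] (fun x => g (modulus x)) g1 g2.
Proof.
set P := [set x | _].
have [b1 [b2 Cb]] : exists b1 b2, C1on P (fun x => b (a * (x.1 ^+ 2 + x.2 ^+ 2))) b1 b2.
  have := C1onM (@C1on_cst R P a) (@C1on_sqnorm R P) => Ca; eexists; eexists.
  apply: (C1on_comp (h := b) (h' := fun u => kimag k u / kmod2 k u) Ca) => x /sqnorm_gt0 s0.
  split; last exact: continuous_kimag_kmod2.
  apply: db; apply: (lt_trans (ltrN10 _)); apply: mulr_gt0 => //.
  by rewrite /a /bessel_scale !mulr_gt0.
have -> : (fun x => g (modulus x)) =
    fun x => (tau + b (a * (x.1 ^+ 2 + x.2 ^+ 2))) * k%:R^-1.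
  by apply/funext => x; rewrite /g /twist sqr_modulus.
by eexists; eexists; exact: (C1onM (C1onD (@C1on_cst R P tau) Cb) (@C1on_cst R P k%:R^-1)).
Qed.

Let wt (z : int) : R * R -> R := sector_weight k g U z.
(** The partition is given by the puncture times the angular cutoff. The puncture restores
    regularity at the origin, and its difference with the product vanishes on sector z, where the
    angular factor is 1. *)
Lemma sector_patched_supersolution z (D : R * R -> R) (c : R) :
  nodal_weight U D ->
  (forall x, [\/ sec (z - 1) x, sec z x | sec (z + 1) x] -> D x = c) ->
  (forall x, ~ sec z x -> D x * U x <= 0) ->
  rot_supersolution 0 omega (fun x => D x * U x).
Proof.
move=> wD Dc Dneg; have [g1 [g2 cg]] := Cg.
have [f1 [f2 Cf]] := angular_cutoff_C1 k cg z.
have CX n := C1_mul_vanishing (puncture_C1 n) Cf.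
have van n x : ~ [set x : R * R | x != (0, 0)] x ->
    \forall y \near x, [/\ puncture n y = 0, puncture1 n y = 0 & puncture2 n y = 0].
  by move=> /= /negP; rewrite negbK => /eqP ->; exact: puncture_near0.
have CX' n := CX n (van n).
apply: (patched_supersolution CU CU1 CU2 eqU U0 radial_bound wD (c := c) CX').
- move=> n x; rewrite mulf_eq0 negb_or => /andP[_ cx] Ux.
  by apply: Dc; exact: (angular_cutoff_support k_gt1 amp_gt0 amp0 ampE cx Ux).
- move=> n x; have /andP[h1 h2] := angular_cutoff_bounds k g z x.
  have /andP[p1 _] := step_bounds (n%:R * (x.1 ^+ 2 + x.2 ^+ 2) - 1).
  by rewrite subr_ge0 -[leRHS]mulr1 ler_wpM2l.
- move=> n x h; apply: Dneg => zx; move: h.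
  by rewrite (angular_cutoff_sector k_gt1 zx) mulr1 subrr eqxx.
Qed.

Lemma sector_weight_nodal z : nodal_weight U (wt z).
Proof. exact: (sector_weightP k_gt1 cont_g amp_gt0 amp0 ampE cont_U). Qed.

Lemma sector_weight_subsolution z (c : R) : 0 <= c ->
  rot_subsolution 0 omega (fun x => c * wt z x * U x).
Proof.
move=> c0; have wD : nodal_weight U (fun x => c * wt z x).
  have := nodal_weightDZ c (sector_weight_nodal z) (nodal_weight0 U).
  rewrite (_ : (fun x => c * _ + 0) = fun x => c * wt z x) //.
  by apply/funext => x; rewrite addr0.
apply: (weighted_subsolution CU CU1 CU2 eqU wD) => x.
by rewrite -mulrA sector_weight_mul !mulr_ge0.
Qed.

End SegregatedSolution.

(** * Cyclic coefficients and verification of the system *)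

Section CyclicWeights.
Context {R : realType}.

Lemma ordS_neq (K : nat) (i : 'I_K) : (1 < K)%N -> i != ordS i.
Proof.
move=> K1; rewrite -val_eqE /=; have := ltn_ord i; rewrite leq_eqVlt => /orP[/eqP e|lt].
  by rewrite e modnn; lia.
by rewrite modn_small // ltn_eqF.
Qed.

(** The recursion determines c i as the product of the ratios q j over j < i; it closes up around
    the cycle exactly when the full product is 1, which is [alpha a = 0]. *)
Lemma cyclic_weights (K : nat) (a : 'I_K -> 'I_K -> R) : (1 < K)%N ->
  (forall i j, i != j -> 0 < a i j) -> alpha a = 0 ->
  exists c : 'I_K -> R, (forall i, 0 < c i) /\
    forall i, c (ordS i) * a i (ordS i) = c i * a (ordS i) i.
Proof.
move=> K1 a0 alpha0.
have neS i := ordS_neq i K1.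
pose q (j : 'I_K) := a (ordS j) j / a j (ordS j).
have q0 j : 0 < q j by rewrite divr_gt0 ?a0 // eq_sym.
have prod_q : \prod_(j < K) q j = 1.
  move: alpha0 => /eqP; rewrite mulf_eq0 invr_eq0 mulf_eq0 pnatr_eq0 /= gt_eqF ?pi_gt0 //=.
  rewrite ln_eq0; last by apply: prodr_gt0 => i _; rewrite divr_gt0 ?a0 // eq_sym.
  move=> /eqP e; apply: invr_inj; rewrite invr1 -prodfV -[RHS]e; apply: eq_bigr => j _.
  by rewrite /q invf_div.
(* Extending q by 1 lets the partial products be indexed by natural numbers, so that the last step
   of the cycle compares [C K] with the empty product. *)
pose f (n : nat) : R := if insub n is Some j then q j else 1.
pose C n := \prod_(0 <= j < n) f j.
have fE (j : 'I_K) : f j = q j by rewrite /f valK.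
have f0 n : 0 < f n by rewrite /f; case: insubP.
have CK : C K = 1 by rewrite -prod_q /C big_mkord; apply: eq_bigr => j _.
exists (fun i : 'I_K => C i); split; first by move=> i; exact: prodr_gt0.
move=> i; have -> : C (ordS i) = C i * q i.
  have -> : C (ordS i) = C i.+1.
    rewrite /=; have := ltn_ord i; rewrite leq_eqVlt => /orP[/eqP e|lt].
      by rewrite e modnn CK /C big_nil.
    by rewrite modn_small.
  by rewrite /C big_nat_recr //= fE.
by rewrite /q; field; rewrite gt_eqF // a0.
Qed.

End CyclicWeights.

Section SegregatedSectors.
Context {R : realType}.
Variables (omega : R) (k : nat) (g rho : R -> R) (u : R * R -> R).
Hypothesis k_gt1 : (1 < k)%N.
Hypothesis cont_g : forall r, 0 < r -> {for r, continuous g}.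
Hypothesis rho_gt0 : forall r, 0 < r -> 0 < rho r.
Hypothesis rho0 : rho 0 = 0.
Hypothesis uE : forall x,
  u x = rho (modulus x) * cos (k%:R * (angle x + g (modulus x))).
Implicit Types (x : R * R).

Let k_gt0 : (0 < k)%N. Proof. exact: ltnW. Qed.
Let sec (z : int) : set (R * R) := sector k g z.
Let wt (z : int) : R * R -> R := sector_weight k g u z.

Hypothesis nodal_wt : forall z, nodal_weight u (wt z).
Hypothesis sub_wt : forall z (c : R), 0 <= c ->
  rot_subsolution 0 omega (fun x => c * wt z x * u x).
Hypothesis super_wt : forall z (D : R * R -> R) (c : R), nodal_weight u D ->
  (forall x, [\/ sec (z - 1) x, sec z x | sec (z + 1) x] -> D x = c) ->
  (forall x, ~ sec z x -> D x * u x <= 0) ->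
  rot_supersolution 0 omega (fun x => D x * u x).

Variable a : 'I_(2 * k) -> 'I_(2 * k) -> R.
Hypothesis a_gt0 : forall i j, i != j -> 0 < a i j.
Variable c : 'I_(2 * k) -> R.
Hypothesis c_gt0 : forall i, 0 < c i.
Hypothesis cS : forall i, c (ordS i) * a i (ordS i) = c i * a (ordS i) i.

Let sg_sector z x : sec z x -> Num.sg (u x) = (-1) ^+ `|z|%N.
Proof.
move=> /(nonzero_sector k_gt0 rho_gt0 uE); rewrite -signr_odd.
case: odd; rewrite ?expr1 ?expr0 ?mulN1r ?mul1r; last exact: gtr0_sg.
by rewrite oppr_gt0; exact: ltr0_sg.
Qed.

Let disjoint_sectors (i j : 'I_(2 * k)) x : sec i%:Z x -> sec j%:Z x -> i = j.
Proof.
move=> ix jx; apply: val_inj; apply: (sector_inj (g := g) k_gt0); rewrite ?inE //=.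
have comp := sector_component k_gt0 cont_g rho_gt0 rho0 uE.
by rewrite -[LHS](comp _ _ ix) -[RHS](comp _ _ jx).
Qed.

Let wt_sector (i j : 'I_(2 * k)) x : sec j%:Z x -> wt i%:Z x = Num.sg (u x) *+ (i == j).
Proof.
move=> jx; rewrite /wt /sector_weight indicE.
have [e|ij] := eqVneq i j; first by rewrite mem_set ?mulr1 // e.
rewrite memNset ?mulr0 // => ix; move: ij.
by rewrite (disjoint_sectors ix jx) eqxx.
Qed.

Let Ui i x : R := c i * `|u x| * \1_(sec i%:Z) x.

Let UiE i x : Ui i x = c i * wt i%:Z x * u x.
Proof. by rewrite /Ui -mulrA -(sector_weight_mul k g u i%:Z) mulrA. Qed.

Let be (i j : 'I_(2 * k)) : R := if j == i then c i else - (a i j / a j i * c j).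
Let H i x : R := \sum_j be i j * wt j%:Z x.

Let hatE i : hat a Ui i = fun x => H i x * u x.
Proof.
apply/funext => x.
have -> : H i x = be i i * wt i%:Z x + \sum_(j | j != i) be i j * wt j%:Z x.
  by rewrite /H (bigD1 i).
rewrite /hat mulrDl mulr_suml -sumrN /be eqxx -UiE; congr (_ + _).
by apply: eq_bigr => j /negbTE ->; rewrite UiE; ring.
Qed.

Let H_sector i (j : 'I_(2 * k)) x : sec j%:Z x -> H i x = be i j * Num.sg (u x).
Proof.
move=> jx; rewrite /H (bigD1 j) //= big1 ?addr0; first by rewrite (wt_sector j jx) eqxx.
by move=> l lj; rewrite (wt_sector l jx) (negbTE lj) mulr0.
Qed.

Let K1 : (1 < 2 * k)%N. Proof. by lia. Qed.

(** The choice of c makes a i j / a j i * c j equal to c i for the two neighbours j of i. *)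
Let be_succ i : be i (ordS i) = - c i.
Proof.
have iS := ordS_neq i K1; rewrite /be eq_sym (negbTE iS).
have : a (ordS i) i != 0 by rewrite gt_eqF // a_gt0 // eq_sym.
by move=> a0; congr (- _); apply: (mulIf a0); rewrite -cS; field.
Qed.

Let be_pred i : be i (ord_pred i) = - c i.
Proof.
have iS := ordS_neq (ord_pred i) K1; have := cS (ord_pred i); rewrite ord_predK in iS *.
rewrite /be (negbTE iS) => e; have a0 : a (ord_pred i) i != 0 by rewrite gt_eqF // a_gt0.
by congr (- _); apply: (mulIf a0); rewrite e; field.
Qed.

Let be_le0 (i j : 'I_(2 * k)) : i != j -> be i j <= 0.
Proof.
move=> ij; rewrite /be eq_sym (negbTE ij) oppr_le0 mulr_ge0 ?ltW //.
by rewrite divr_gt0 // a_gt0 // eq_sym.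
Qed.

Let sec_succ (i : 'I_(2 * k)) : sec (i%:Z + 1) = sec (ordS i)%:Z.
Proof.
rewrite /sec sector_modz //; congr (sector _ _ _).
by rewrite /= -modz_nat; congr modz; lia.
Qed.

Let sec_pred (i : 'I_(2 * k)) : sec (i%:Z - 1) = sec (ord_pred i)%:Z.
Proof.
rewrite /sec -(sector_periodic g k_gt0 (i%:Z - 1) 1) sector_modz //; congr (sector _ _ _).
by rewrite /= -modz_nat; congr modz; lia.
Qed.

(** Two sign changes cancel: from sector i to a neighbour the coefficient passes from c i to - c i,
    and the sign of u alternates as well. *)
Let H_neighbours (i : 'I_(2 * k)) x : [\/ sec (i%:Z - 1) x, sec i%:Z x | sec (i%:Z + 1) x] ->
  H i x = c i * (-1) ^+ (i : nat).
Proof.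
case=> h; have sg := sg_sector h.
- rewrite sec_pred in h; rewrite (H_sector i h) be_pred sg mulNr -mulrN; congr (_ * _).
  (* For i = 0 the neighbour has index -1, whose absolute value is 1. *)
  case: (nat_of_ord i) => [|n]; first by rewrite expr1 opprK.
  by rewrite exprS mulN1r; congr (- (_ ^+ _)); lia.
- by rewrite (H_sector i h) sg /be eqxx.
- rewrite sec_succ in h; rewrite (H_sector i h) be_succ sg mulNr -mulrN; congr (_ * _).
  have -> : absz (i%:Z + 1) = i.+1 by lia.
  by rewrite exprS mulN1r opprK.
Qed.

Lemma sectors_segregated :
  set_bij [set: 'I_(2 * k)] (connected_component [set x | u x != 0] @` [set x | u x != 0])
    (fun i => sec i%:Z) /\
  segregated_system 0 omega a (fun i x => c i * `|u x| * \1_(sec i%:Z) x).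
Proof.
split.
  have e := regionsE k_gt0 cont_g rho_gt0 rho0 uE.
  rewrite e; split.
  - by move=> i _; exists i => //=; exact: ltn_ord.
  - move=> i j _ _ ij; apply: val_inj; apply: (sector_inj (g := g) k_gt0); rewrite ?inE //=.
  - move=> A [m mk <-]; exists (Ordinal mk) => //.
split.
- by move=> i x; rewrite !mulr_ge0 // ltW.
- move=> i; rewrite (_ : (fun x => _) = fun x => c i * wt i%:Z x * u x).
    by apply: sub_wt; exact: ltW.
  by apply/funext => x; exact: UiE.
- move=> i; rewrite hatE; apply: (super_wt (z := i%:Z) (c := c i * (-1) ^+ (i : nat))).
  + exact: nodal_weight_sum.
  + exact: H_neighbours.
  + move=> x ix; have [->|ux] := eqVneq (u x) 0; first by rewrite mulr0.
    have [z zx] := (nonzero_cover k_gt0 rho_gt0 rho0 uE x).1 ux.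
    have [m mk e] := sector_nat g k_gt0 z; rewrite e in zx.
    rewrite (H_sector i (j := Ordinal mk) zx) -mulrA -normrEsg mulr_le0_ge0 // be_le0 //.
    by apply: contra_not_neq ix => ->.
- move=> i j ij x; have [ix|ix] := pselect (sec i%:Z x); last first.
    by rewrite [\1_(sec i%:Z) x]indicE (memNset ix) mulr0 mul0r.
  rewrite [\1_(sec j%:Z) x]indicE memNset ?mulr0 // => jx.
  by move: ij; rewrite (disjoint_sectors ix jx) eqxx.
Qed.

End SegregatedSectors.

Lemma segregated_rotU (R : realType) (omega : R) (k : nat) (a : 'I_(2 * k) -> 'I_(2 * k) -> R) :
  0 < omega -> (3 <= 2 * k)%N -> (forall i j, i != j -> 0 < a i j) -> alpha a = 0 ->
  exists (Omega : 'I_(2 * k) -> set (R * R)) (c : 'I_(2 * k) -> R),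
    [/\ set_bij [set: 'I_(2 * k)] (nodal_regions (rotU omega k) 0) Omega,
        forall i, 0 < c i &
        segregated_system 0 omega a
          (fun i x => c i * `|rotU omega k x 0| * \1_(Omega i) x)].
Proof.
(* At least three components means k >= 2, which both the angular cutoff and the bound on the radial
   derivative require. *)
move=> omega0 k3 a0 al0; have k1 : (1 < k)%N by lia.
have k0 : (0 < k)%N by exact: ltnW.
have [b [b0 db bE]] := @kel_polar R k.
have [c [c0 cS]] := cyclic_weights (ltnW k3) a0 al0.
have cont_g r : 0 < r -> {for r, continuous (twist omega k b 0)}.
  by move=> _; exact: (continuous_twist omega0 k0 db).
have [bij seg] := sectors_segregated k1 cont_g (amplitude_gt0 omega0 k0)
  (amplitude0 omega k0) (fun x => rotU_twist omega0 k0 bE x 0)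
  (sector_weight_nodal omega0 k1 db bE) (sector_weight_subsolution omega0 k1 db bE)
  (sector_patched_supersolution omega0 k1 db bE) a0 c0 cS.
by eexists; exists c; split; [exact: bij | exact: c0 | exact: seg].
Qed.

Theorem mainTheorem5 (R : realType) (k : nat) (k_ge1 : (1 <= k)%N) :
  (forall omega : R, 0 < omega ->
    let U := rotU omega k in
    [/\ forall r theta t : R, 0 <= r ->
          U (polar r theta) t =
          complex.Re (expi (k%:R * (theta + omega * t)) *
            besselI k ((Num.sqrt (2%:R * omega * k%:R) / 2%:R)%:C *
                       (1 +i* 1) * r%:C))%C,
        smooth_heat_solution U /\ rotating omega U,
        forall t : R,
          (nodal_regions U t #= `I_(2 * k))%card /\
          forall A B, nodal_regions U t A -> nodal_regions U t B ->
            exists m : nat, B = rotation (m%:R * (pi / k%:R)) @` A,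
        forall t : R, exists theta : R -> R,
          [/\ {in `]0, +oo[, continuous theta},
              [set x | U x t = 0] `\ (0, 0) =
                \bigcup_(m in `I_(2 * k))
                  [set polar r (theta r + m%:R * (pi / k%:R)) |
                       r in [set r : R | 0 < r]],
              exists theta0 : R, theta r @[r --> 0^'+] --> theta0 &
              exists c : R,
                theta r + Num.sqrt (omega / (2%:R * k%:R)) * r
                  @[r --> +oo] --> c] &
        forall a : 'I_(2 * k) -> 'I_(2 * k) -> R,
          (3 <= 2 * k)%N ->
          (forall i j, i != j -> 0 < a i j) ->
          alpha a = 0 ->
          exists (Omega : 'I_(2 * k) -> set (R * R)) (c : 'I_(2 * k) -> R),
            [/\ set_bij [set: 'I_(2 * k)] (nodal_regions U 0) Omega,
                forall i, 0 < c i &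
                segregated_system 0 omega a
                  (fun i x => c i * `|U x 0| * \1_(Omega i) x)] ])
  /\
  harmonic_function (@zpow R k) /\
  exists (lambda : R -> R) (beta : R),
    (forall omega, 0 < omega -> 0 < lambda omega) /\
    {family compact,
      (fun p : R * R * R =>
         lambda omega * rotU omega k (rotation beta p.1) p.2) @[omega --> 0^'+] -->
      (fun p : R * R * R => zpow k p.1)}.
Proof.
split; last first.
  split; first exact: harmonic_zpow.
  exists (rescale k), (- (pi / 4)); split; first by move=> omega; exact: rescale_gt0.
  exact: rescaled_cvg.
move=> omega omega0 U; have omega_ge0 := ltW omega0.
have [b [_ db bE]] := @kel_polar R k.
split.
- by move=> r theta t _; exact: rotU_polar.
- by split; [exact: heat_rotU | exact: rotating_rotU].
- move=> t; split; first exact: (card_nodal_regions omega0 k_ge1 db bE).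
  by move=> A B; exact: (rotate_nodal_regions omega0 k_ge1 db bE).
- exact: (spiral_nodal_lines omega0 k_ge1 db bE).
- by move=> a k3 a0 al0; exact: segregated_rotU.
Qed.
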